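(* Let $E$ be a separable r.i. space on $[0,1]$ which has the disjoint $Q_2$-property. If Rosenthal's space $\mathcal{U}_E$ is isomorphic to a subspace of $E$, then $E\supseteq G$, where $G$ is the closure of $L^\infty[0,1]$ in the exponential Orlicz space $\mathrm{Exp}\,L^2[0,1]$.
   Context: $m$ is Lebesgue measure and $I=[0,1]$ or $(0,\infty)$. Functions $x,y$ are equimeasurable if $m\{|x|>\tau\}=m\{|y|>\tau\}$ for all $\tau>0$. An r.i. (rearrangement invariant) space $E$ on $I$ is a nonzero Banach space of (classes of) measurable functions on $I$ such that: if $|x|\le|y|$ a.e. and $y\in E$, then $x\in E$ and $\|x\|_E\le\|y\|_E$; and if $x,y$ are equimeasurable and $y\in E$, then $x\in E$ and $\|x\|_E=\|y\|_E$. For $I=[0,1]$ it is assumed that $\|\chi_{[0,1]}\|_E=1$. $x^*$ is the non-increasing rearrangement of $|x|$. $Z_E$ is the r.i. space on $(0,\infty)$ of all measurable $f$ with $\|f\|_{Z_E}:=\|f^*\chi_{[0,1]}\|_E+\|f^*\chi_{[1,\infty)}\|_{L^2}<\infty$ (a quasinorm equivalent to a norm). Rosenthal's space $\mathcal{U}_E$ is the closed linear span in $Z_E$ of $\{\chi_{A_n}\}_{n=1}^\infty$, where $A_n\subset(0,\infty)$ are disjoint sets of positive measure with $m(A_n)\le1$, $m(A_n)\to0$, $\sum_n m(A_n)=\infty$; up to isomorphism it does not depend on the choice of such $\{A_n\}$. A sequence $\{x_n\}$ is $C$-equivalent to the unit vector $\ell^2$-basis if $C^{-1}\|(a_n)\|_2\le\|\sum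 a_nx_n\|\le C\|(a_n)\|_2$ for all finitely supported scalar sequences $(a_n)$, and equivalent if this holds for some $C$. A Banach lattice $E$ has the disjoint $Q_2$-property ($E\in\mathcal{D}Q_2$) if there is a constant $C_E>0$, depending only on $E$, such that every disjoint sequence $\{h_n\}\subset E$ with $\|h_n\|_E=1$ that is equivalent to the unit vector $\ell^2$-basis has a subsequence $C_E$-equivalent to the unit vector $\ell^2$-basis. $\mathrm{Exp}\,L^2$ is the Orlicz space on $[0,1]$ generated by an Orlicz function equivalent to $e^{u^2}$ for large $u$ (e.g. $e^{u^2}-1$), with the Luxemburg norm. *)

(* Defs.v *)
(* All scalars and function values are real. *)
From HB Require Import structures.
From mathcomp Require Import all_boot all_order all_algebra.
From mathcomp Require Import all_classical all_reals all_analysis.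
Set Implicit Arguments.
Unset Strict Implicit.
Unset Printing Implicit Defensive.
Import Order.TTheory GRing.Theory Num.Theory.
Import numFieldNormedType.Exports.

Local Open Scope classical_set_scope.
Local Open Scope ring_scope.

(* A (quasi-)normed space of classes of measurable functions on a set
   [dom X], described through representatives defined on all of [R].  Only the
   values on [dom X] matter: membership and norm are invariant under a.e.
   equality on [dom X] for all the spaces considered here, and "equal elements
   of [X]" means [ae_eq_on (dom X)].  [fnorm X] is meaningful only on
   [carrier X]. *)
Record fun_space (R : realType) := FunSpace {
  dom : set R ;
  carrier : set (R -> R) ;
  fnorm : (R -> R) -> R }.

Section Defs.
Context {R : realType}.
Implicit Types (D : set R) (x y f : R -> R) (X Y E : fun_space R).

Local Notation mu := (@lebesgue_measure R).
Local Notation I01 := (`[0, 1]%classic : set R).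
Local Notation halfline := (`]0, +oo[%classic : set R).

Definition ae_eq_on D x y := x = y %[ae mu in D].

Definition ae_le_on D x y := {ae mu, forall t, D t -> x t <= y t}.

Definition distr D x (tau : R) : \bar R := mu [set t | D t /\ tau < `|x t|].

Definition equimeasurable D x y :=
  forall tau : R, 0 < tau -> distr D x tau = distr D y tau.

(* For measurable [x], finite at every [t > 0] as soon as [distr D x] is finite
   somewhere; may be [+oo] at [t = 0]. *)
Definition rearr D x (t : R) : \bar R :=
  ereal_inf [set s%:E | s in [set s : R | 0 <= s /\ (distr D x s <= t%:E)%E]].

Definition linear_set (S : set (R -> R)) :=
  S 0 /\ forall (a : R) x y, S x -> S y -> S (a *: x + y).

Definition fun_complete X := forall u : nat -> R -> R,
  (forall n, carrier X (u n)) ->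
  (forall eps : R, 0 < eps -> exists N : nat, forall m n : nat,
     (N <= m)%N -> (N <= n)%N -> fnorm X (u m - u n) < eps) ->
  exists x, carrier X x /\ (fun n => fnorm X (u n - x)) @ \oo --> (0 : R).

Record banach_fun_space X : Prop := {
  carrier_measurable : forall x, carrier X x -> measurable_fun (dom X) x ;
  carrier_linear : linear_set (carrier X) ;
  fnorm_ge0 : forall x, carrier X x -> 0 <= fnorm X x ;
  fnorm_eq0 : forall x, carrier X x ->
    (fnorm X x = 0 <-> ae_eq_on (dom X) x 0) ;
  fnormZ : forall (a : R) x, carrier X x -> fnorm X (a *: x) = `|a| * fnorm X x ;
  fnormD : forall x y, carrier X x -> carrier X y ->
    fnorm X (x + y) <= fnorm X x + fnorm X y ;
  carrier_complete : fun_complete X }.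

Record ri_space X : Prop := {
  ri_banach : banach_fun_space X ;
  ri_nonzero : exists x, carrier X x /\ ~ ae_eq_on (dom X) x 0 ;
  ri_ideal : forall x y, measurable_fun (dom X) x -> carrier X y ->
    ae_le_on (dom X) (fun t => `|x t|) (fun t => `|y t|) ->
    carrier X x /\ fnorm X x <= fnorm X y ;
  ri_equimeasurable : forall x y, measurable_fun (dom X) x -> carrier X y ->
    equimeasurable (dom X) x y ->
    carrier X x /\ fnorm X x = fnorm X y }.

Record ri_space01 E : Prop := {
  ri01_dom : dom E = I01 ;
  ri01_ri : ri_space E ;
  ri01_normalized : carrier E \1_I01 /\ fnorm E \1_I01 = 1 }.

Definition separable_space X := exists S : set (R -> R),
  [/\ countable S, S `<=` carrier X &
    forall x (eps : R), carrier X x -> 0 < eps ->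
      exists2 y, S y & fnorm X (x - y) < eps].

Definition closure_in X (S : set (R -> R)) : set (R -> R) :=
  [set x | carrier X x /\ forall eps : R, 0 < eps ->
    exists y, [/\ S y, carrier X y & fnorm X (x - y) < eps]].

Definition lin_span (x : nat -> R -> R) : set (R -> R) :=
  [set f | exists (n : nat) (a : nat -> R), f = \sum_(i < n) a i *: x i].

Definition closed_subspace X (S : set (R -> R)) :=
  [/\ S `<=` carrier X, linear_set S & closure_in X S `<=` S].

Definition subspace_of X (S : set (R -> R)) : fun_space R :=
  FunSpace (dom X) S (fnorm X).

(* Linearity and surjectivity are up to a.e. equality; together with the lower
   norm bound this says that [T] induces a linear bijection between the spaces
   of classes that is bounded with bounded inverse. *)
Definition isomorphic X Y := exists T : (R -> R) -> (R -> R),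
  [/\ forall x, carrier X x -> carrier Y (T x),
      forall (a : R) x y, carrier X x -> carrier X y ->
        ae_eq_on (dom Y) (T (a *: x + y)) (a *: T x + T y),
      forall y, carrier Y y -> exists2 x, carrier X x & ae_eq_on (dom Y) (T x) y
    & exists c C : R, [/\ 0 < c, 0 < C & forall x, carrier X x ->
        c * fnorm X x <= fnorm Y (T x) <= C * fnorm X x]].

Definition isomorphic_to_subspace X Y :=
  exists S, closed_subspace Y S /\ isomorphic X (subspace_of Y S).

(* The two parts of the functional defining [Z_E]; [fine] only discards the
   value [+oo], taken at most on a null set when the second part is finite. *)
Definition ZE_head f : R -> R := (fine \o rearr halfline f) \_ I01.

Definition ZE_tail f : \bar R := 'N[mu]_2%:E[rearr halfline f \_ `[1, +oo[%classic].

Definition ZE E : fun_space R :=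
  FunSpace halfline
    [set f | [/\ measurable_fun halfline f, carrier E (ZE_head f) &
                 (ZE_tail f < +oo)%E]]
    (fun f => fnorm E (ZE_head f) + fine (ZE_tail f)).

Record rosenthal_sets (A : nat -> set R) : Prop := {
  rs_measurable : forall n, measurable (A n) ;
  rs_sub : forall n, A n `<=` halfline ;
  rs_disjoint : trivIset [set: nat] A ;
  rs_gt0 : forall n, (0 < mu (A n))%E ;
  rs_le1 : forall n, (mu (A n) <= 1)%E ;
  rs_cvg0 : (fun n => mu (A n)) @ \oo --> 0%E ;
  rs_sum : (\sum_(0 <= n <oo) mu (A n) = +oo)%E }.

Definition rosenthal_space E (A : nat -> set R) : fun_space R :=
  subspace_of (ZE E) (closure_in (ZE E) (lin_span (fun n => \1_(A n)))).

Definition l2_equivalent_with X (C : R) (x : nat -> R -> R) :=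
  forall (n : nat) (a : nat -> R),
    C^-1 * Num.sqrt (\sum_(i < n) a i ^+ 2)
      <= fnorm X (\sum_(i < n) a i *: x i)
      <= C * Num.sqrt (\sum_(i < n) a i ^+ 2).

Definition l2_equivalent X (x : nat -> R -> R) :=
  exists2 C : R, 0 < C & l2_equivalent_with X C x.

Definition disjoint_seq X (h : nat -> R -> R) := forall m n : nat, m != n ->
  ae_eq_on (dom X) (fun t => Num.min `|h m t| `|h n t|) 0.

Definition disjoint_Q2 X := exists2 C : R, 0 < C &
  forall h : nat -> R -> R,
    (forall n, carrier X (h n) /\ fnorm X (h n) = 1) ->
    disjoint_seq X h -> l2_equivalent X h ->
    exists2 k : nat -> nat, {homo k : m n / (m < n)%N} &
      l2_equivalent_with X C (h \o k).

Record orlicz_function (M : R -> R) : Prop := {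
  orlicz0 : M 0 = 0 ;
  orlicz_continuous : {within `[0, +oo[%classic, continuous M} ;
  orlicz_nondecreasing : {in `[0, +oo[ &, {homo M : u v / u <= v}} ;
  orlicz_convex : convex_function (`[0, +oo[%classic : set R) M ;
  orlicz_cvgy : M u @[u --> +oo] --> +oo }.

Definition equiv_at_infty (M N : R -> R) := exists K u0 : R,
  [/\ 0 < K, 0 < u0 & forall u, u0 <= u ->
    K^-1 * N (K^-1 * u) <= M u <= K * N (K * u)].

Definition luxemburg (M : R -> R) x : \bar R :=
  ereal_inf [set lambda%:E | lambda in [set lambda : R | 0 < lambda /\
    (\int[mu]_(t in I01) (M (`|x t| / lambda))%:E <= 1)%E]].

Definition orlicz_space (M : R -> R) : fun_space R :=
  FunSpace I01
    [set x | measurable_fun I01 x /\ (luxemburg M x < +oo)%E]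
    (fine \o luxemburg M).

Definition Linfty01 : set (R -> R) :=
  [set x | measurable_fun I01 x /\
           ('N[mu]_+oo[EFin \o (x \_ I01)] < +oo)%E].

Definition exp_L2_function (M : R -> R) :=
  orlicz_function M /\ equiv_at_infty M (fun u => expR (u ^+ 2)).

Definition closure_Linfty (M : R -> R) : set (R -> R) :=
  closure_in (orlicz_space M) Linfty01.

End Defs.

(* Main.v *)
(* Write phi(d) for the norm of the indicator of [0, d] in E.  If phi(d) is at
   most K sqrt(d), then E contains L_{2,1}, hence every function with Gaussian
   tails.  Otherwise fix d with phi(d) / sqrt(d) large and group the A_n into
   disjoint sets U_k of measure between d and 2d.  In Z_E the indicators of the
   U_k are equivalent to the l^2-basis, but sums of n of them have norm of order
   sqrt(d n) only, much less than phi(d) sqrt(n).  Let x_k be their images in E,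
   which may be perturbed to step functions.

   If the L^1-norms of the x_k are not bounded below, the Kadec-Pelczynski method
   gives an almost disjoint subsequence, and the disjoint Q_2-property forces
   sums of n of its terms to have norm at least of order phi(d) sqrt(n), a
   contradiction.

   If the L^1-norms are bounded below, no limit theorem is needed.  Since the
   integrals of x_k over a fixed interval are square summable, one selects x_k
   and independent signs rho_k with the integral of x_k rho_k bounded below.
   Averaging the sums of +-x_k over the measure-preserving maps that act on the
   signs by translation of {-1, 1}^n, which are isometries of E, turns them into
   multiples of the sums of the rho_k.  So n^{-1/2} (rho_1 + ... + rho_n) is
   bounded in E; its tails are Gaussian by the Paley-Zygmund inequality.

   In both cases the truncations of log^{1/2}(1/s) are bounded in E, which gives
   a norm estimate for bounded functions with Gaussian tails; a function in the
   closure of L^infty is then the limit in E of its truncations. *)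
Require Import Defs.
From mathcomp Require Import all_boot all_order all_algebra.
From mathcomp Require Import all_classical all_reals all_analysis.
From mathcomp Require Import measurable_realfun ess_sup_inf.
From mathcomp Require Import ring lra zify.
Set Implicit Arguments.
Unset Strict Implicit.
Unset Printing Implicit Defensive.
Import Order.TTheory GRing.Theory Num.Theory.
Import numFieldNormedType.Exports.
Local Open Scope classical_set_scope.
Local Open Scope ring_scope.

(** * Rearrangement invariant spaces *)

(** The uniformity of the constant $Q$ of the disjoint $Q_2$-property is decisive. For fixed $d$ the
    $\ell^2$-constants of the images involve $d$ and phi(d) and are not controlled as $d$ varies;
    only $Q$ survives the passage to normalized terms. The threshold for phi(d) / sqrt(d) is
    $4CQ/c$, with $c, C$ the bounds of the embedding: one factor 2 is lost in perturbing norms, one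
    in $\sqrt{2d} \le 2\sqrt{d}$.

    Both cases end in [gauss_bounded]. Up to a constant factor, $\log^{1/2}(1/s)$ exceeds $2^q$ on
    an interval of length $b^{4^q}$, so it is comparable to the sum of $2^q$ over nested intervals
    of these lengths.

    Step functions on equal cells make everything finite: equimeasurability is equality of counts,
    measure-preserving maps are permutations of cells, and independence of signs says that all sign
    patterns fill equally many cells. Separability enters through order continuity of the norm,
    which yields the density of step functions and phi(d) -> 0. *)

Lemma indic_in {R : pzRingType} {T : Type} (A : set T) t : A t -> \1_A t = 1 :> R.
Proof. by move=> At; rewrite indicE mem_set. Qed.

Lemma indic_notin {R : pzRingType} {T : Type} (A : set T) t :
  ~ A t -> \1_A t = 0 :> R.
Proof. by move=> At; rewrite indicE memNset. Qed.

Section AlmostEverywhere.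
Context {R : realType}.
Local Notation mu := (@lebesgue_measure R).

Lemma leb_ae_mono (P Q : R -> Prop) : (forall t, P t -> Q t) ->
  {ae mu, forall t, P t} -> {ae mu, forall t, Q t}.
Proof. by move=> PQ; apply: filterS; first exact: (ae_filter_ringOfSetsType mu). Qed.

Lemma leb_ae_and (P Q : R -> Prop) :
  {ae mu, forall t, P t} -> {ae mu, forall t, Q t} ->
  {ae mu, forall t, P t /\ Q t}.
Proof. by apply: filterI; exact: (ae_filter_ringOfSetsType mu). Qed.

Lemma leb_ae_all (P : R -> Prop) : (forall t, P t) -> {ae mu, forall t, P t}.
Proof.
move=> h; apply: (@leb_ae_mono (fun=> True)) => //.
exact: (@filterT _ _ (ae_filter_ringOfSetsType mu)).
Qed.

Lemma leb_measureU (A B : set R) : measurable A -> measurable B ->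
  A `&` B = set0 -> mu (A `|` B) = (mu A + mu B)%E.
Proof. by move=> mA mB AB; exact: measureU. Qed.

Lemma leb_le_ae (A B : set R) : measurable A -> measurable B ->
  {ae mu, forall t, A t -> B t} -> (mu A <= mu B)%E.
Proof.
move=> mA mB [N [mN N0 hN]].
apply: (@le_trans _ _ (mu (B `|` N))).
  apply: le_measure; rewrite ?inE//; first exact: measurableU.
  move=> t At; have [Bt|Bt] := pselect (B t); [by left|right].
  by apply: hN => /= h; apply: Bt; exact: h.
apply: le_trans (measureU2 mu mB mN) _.
apply: le_trans (leeD2l _ (_ : (_ <= 0)%E)) _; last by rewrite adde0.
by rewrite le_eqVlt; apply/orP; left; apply/eqP.
Qed.

End AlmostEverywhere.

Section RiBasics.
Context {R : realType}.
Variables (E : fun_space R) (hE : ri_space01 E).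
Local Notation mu := (@lebesgue_measure R).
Local Notation I01 := (`[0, 1]%classic : set R).
Local Notation nE := (fnorm E).
Implicit Types (x y : R -> R) (B : set R).

Lemma measurable_I01 : measurable I01. Proof. exact: measurable_itv. Qed.

Lemma mu_I01 : mu I01 = 1%E.
Proof. by rewrite lebesgue_measure_itv /= lte_fin ltr01 sube0. Qed.

Lemma mu_setT_gt0 : (0 < mu [set: R])%E.
Proof.
apply: (@lt_le_trans _ _ (mu I01)); first by rewrite mu_I01.
by apply: le_measure; rewrite ?inE//; exact: measurable_I01.
Qed.

Let bE := ri_banach (ri01_ri hE).

Lemma ri_measurable x : carrier E x -> measurable_fun I01 x.
Proof. by move/(carrier_measurable bE); rewrite (ri01_dom hE). Qed.

Lemma ri_norm_ge0 x : carrier E x -> 0 <= nE x.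
Proof. exact: (fnorm_ge0 bE). Qed.

Lemma ri_carrier0 : carrier E 0.
Proof. by have [] := carrier_linear bE. Qed.

Lemma ri_carrierZ (a : R) x : carrier E x -> carrier E (a *: x).
Proof.
move=> hx; have [h0 h] := carrier_linear bE.
by have := h a x 0 hx h0; rewrite addr0.
Qed.

Lemma ri_carrierD x y : carrier E x -> carrier E y -> carrier E (x + y).
Proof.
move=> hx hy; have [h0 h] := carrier_linear bE.
by have := h 1 x y hx hy; rewrite scale1r.
Qed.

Lemma ri_carrierB x y : carrier E x -> carrier E y -> carrier E (x - y).
Proof.
by move=> hx hy; apply: ri_carrierD => //; rewrite -scaleN1r; apply: ri_carrierZ.
Qed.

Lemma ri_normZ (a : R) x : carrier E x -> nE (a *: x) = `|a| * nE x.
Proof. exact: (fnormZ bE). Qed.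

Lemma ri_norm0 : nE 0 = 0.
Proof. by have := ri_normZ 0 ri_carrier0; rewrite scale0r normr0 mul0r. Qed.

Lemma ri_normD x y : carrier E x -> carrier E y -> nE (x + y) <= nE x + nE y.
Proof. exact: (fnormD bE). Qed.

Lemma ri_normN x : carrier E x -> nE (- x) = nE x.
Proof. by move=> hx; rewrite -scaleN1r ri_normZ// normrN1 mul1r. Qed.

Lemma ri_normB x y : carrier E x -> carrier E y -> nE (x - y) <= nE x + nE y.
Proof.
move=> hx hy; rewrite -(ri_normN hy); apply: ri_normD => //.
by rewrite -scaleN1r; apply: ri_carrierZ.
Qed.

Lemma ri_distC x y : carrier E x -> carrier E y -> nE (x - y) = nE (y - x).
Proof. by move=> hx hy; rewrite -ri_normN ?opprB//; apply: ri_carrierB. Qed.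

Lemma ri_carrier_sum (I : Type) (r : seq I) (P : pred I) (f : I -> R -> R) :
  (forall i, P i -> carrier E (f i)) -> carrier E (\sum_(i <- r | P i) f i).
Proof. by move=> h; apply: big_ind => //; [exact: ri_carrier0|exact: ri_carrierD]. Qed.

Lemma ri_norm_sum (I : Type) (r : seq I) (P : pred I) (f : I -> R -> R) :
  (forall i, P i -> carrier E (f i)) ->
  nE (\sum_(i <- r | P i) f i) <= \sum_(i <- r | P i) nE (f i).
Proof.
move=> h; suff : carrier E (\sum_(i <- r | P i) f i) /\
  nE (\sum_(i <- r | P i) f i) <= \sum_(i <- r | P i) nE (f i) by case.
apply: (big_rec2 (fun a b => carrier E a /\ nE a <= b)).
  by split; [exact: ri_carrier0|rewrite ri_norm0].
move=> i a b Pi [ha hab]; split; first exact: ri_carrierD (h _ Pi) _.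
by apply: le_trans (ri_normD (h _ Pi) ha) _; rewrite lerD2l.
Qed.

Lemma ri_le_ae x y : measurable_fun I01 x -> carrier E y ->
  ae_le_on I01 (fun t => `|x t|) (fun t => `|y t|) ->
  carrier E x /\ nE x <= nE y.
Proof.
move=> mx hy hxy; apply: (ri_ideal (ri01_ri hE)) => //; by rewrite (ri01_dom hE).
Qed.

Lemma ri_le x y : measurable_fun I01 x -> carrier E y ->
  (forall t, I01 t -> `|x t| <= `|y t|) -> carrier E x /\ nE x <= nE y.
Proof.
by move=> mx hy hxy; apply: ri_le_ae => //; apply: leb_ae_all => t; apply: hxy.
Qed.

Lemma ri_eq_ae x y : measurable_fun I01 x -> carrier E y ->
  ae_eq_on I01 x y -> carrier E x /\ nE x = nE y.
Proof.
move=> mx hy hxy.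
have h1 : ae_le_on I01 (fun t => `|x t|) (fun t => `|y t|).
  by apply: leb_ae_mono hxy => t /= h /h ->.
have h2 : ae_le_on I01 (fun t => `|y t|) (fun t => `|x t|).
  by apply: leb_ae_mono hxy => t /= h /h ->.
have [hx xy] := ri_le_ae mx hy h1.
split=> //; apply/le_anti; rewrite xy /=.
by have [] := ri_le_ae (ri_measurable hy) hx h2.
Qed.

Lemma ri_norm_ae x y : carrier E x -> carrier E y ->
  ae_eq_on I01 x y -> nE x = nE y.
Proof. by move=> /ri_measurable mx hy /(ri_eq_ae mx hy)[]. Qed.

Lemma ri_eqfun x y : carrier E x -> (forall t, I01 t -> y t = x t) ->
  carrier E y /\ nE y = nE x.
Proof.
move=> hx h; apply: ri_eq_ae => //.
  by apply: eq_measurable_fun (ri_measurable hx) => t /set_mem/h.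
by apply: leb_ae_all => t; apply: h.
Qed.

Lemma ri_equi x y : measurable_fun I01 x -> carrier E y ->
  equimeasurable I01 x y -> carrier E x /\ nE x = nE y.
Proof.
move=> mx hy hxy.
by apply: (ri_equimeasurable (ri01_ri hE)) => //; rewrite (ri01_dom hE).
Qed.

Lemma ri_norm_eq0 x : carrier E x -> nE x = 0 -> ae_eq_on I01 x 0.
Proof. by move=> hx /(fnorm_eq0 bE hx); rewrite (ri01_dom hE). Qed.

Lemma ri_carrier1 : carrier E (cst 1) /\ nE (cst 1) = 1.
Proof.
have [h1 n1] := ri01_normalized hE.
rewrite -n1; apply: ri_eqfun => // t It.
by rewrite indicE mem_set.
Qed.

Lemma ri_bounded x (K : R) : measurable_fun I01 x ->
  (forall t, I01 t -> `|x t| <= K) -> carrier E x /\ nE x <= K.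
Proof.
move=> mx hK; have [c1 n1] := ri_carrier1.
have K0 : 0 <= K by apply: le_trans (hK 0 _); rewrite //= in_itv /= lexx ler01.
have hc := ri_carrierZ K c1.
have [hx] : carrier E x /\ nE x <= nE (K *: cst 1).
  apply: ri_le => // t It.
  have -> : (K *: (cst 1 : R -> R)) t = K by exact: mulr1.
  by rewrite (ger0_norm K0) hK.
by rewrite ri_normZ// n1 mulr1 ger0_norm.
Qed.

Lemma ri_restr x B : measurable B -> carrier E x ->
  carrier E (x \* \1_B) /\ nE (x \* \1_B) <= nE x.
Proof.
move=> mB hx; apply: ri_le => //.
  by apply: measurable_funM; [exact: ri_measurable|exact: measurable_indic].
by move=> t _ /=; rewrite normrM indicE; case: (t \in B);
   rewrite ?normr1 ?normr0 ?mulr1 ?mulr0.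
Qed.

Lemma ri_indic B : measurable B -> carrier E \1_B.
Proof.
move=> mB; apply: (ri_bounded (K := 1) _ _).1; first exact: measurable_indic.
by move=> t _; rewrite indicE; case: (t \in B); rewrite ?normr1 ?normr0.
Qed.

End RiBasics.

(** * Order continuity of the norm of a separable space *)

Section OrderContinuity.
Context {R : realType}.
Variables (E : fun_space R) (hE : ri_space01 E) (hsep : separable_space E).
Local Notation mu := (@lebesgue_measure R).
Local Notation I01 := (`[0, 1]%classic : set R).
Local Notation nE := (fnorm E).
Implicit Types (f x y : R -> R) (B : set R).

(* Otherwise the set [S0] of indices can be chosen diagonally so that the
   restriction of [f] to the union of the [D n], [n] in [S0], stays away from
   every member of a dense sequence. *)
Lemma sep_disjoint_restr f (D : nat -> set R) (eps : R) : carrier E f ->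
  (forall n, measurable (D n)) -> trivIset setT D -> 0 < eps ->
  exists n, nE (f \* \1_(D n)) < eps.
Proof.
move=> hf mD tD e0; apply/not_existsP => hD.
have {}hD n : eps <= nE (f \* \1_(D n)) by rewrite leNgt; apply/negP/hD.
have [S [cS SE dS]] := hsep.
have /countable_injP[g ginj] := cS.
pose S0 := [set n : nat | exists2 y, S y &
  g y = n /\ eps / 2 <= nE ((f - y) \* \1_(D n))].
pose U := \bigcup_(n in S0) D n.
have mU : measurable U by apply: bigcup_measurable.
have [hfU _] := ri_restr hE mU hf.
have e2 : 0 < eps / 2 by rewrite divr_gt0.
have [y Sy] := dS _ _ hfU e2; apply/negP; rewrite -leNgt.
have hy := SE y Sy.
have hd := ri_carrierB hE hfU hy.
have mDy := mD (g y).
have [hdD ndD] := ri_restr hE mDy hd.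
apply: le_trans ndD.
have hfy := ri_carrierB hE hf hy.
have [hfyD _] := ri_restr hE mDy hfy.
(* If [g y] was selected, [f \* \1_U] equals [f] on [D (g y)] and is far from [y] by the selection.
   Otherwise it vanishes there, while [f], of norm at least [eps], is within [eps / 2] of [y], so
   that [y] itself is large. *)
have [S0y|S0y] := pselect (S0 (g y)).
  have le1 : eps / 2 <= nE ((f - y) \* \1_(D (g y))).
    have [z Sz [gz]] := S0y.
    have -> // : z = y by apply: ginj; rewrite ?inE.
  apply: le_trans le1 _; rewrite le_eqVlt; apply/orP; left; apply/eqP.
  apply: (ri_eqfun hE hdD _).2 => t _ /=; rewrite !fctE /=.
  have [Dt|Dt] := pselect (D (g y) t); last by rewrite (indic_notin Dt) !mulr0.
  have -> : \1_U t = 1 :> R by rewrite indicE mem_set//; exists (g y).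
  by rewrite mulr1.
have le1 : nE ((f - y) \* \1_(D (g y))) < eps / 2.
  by rewrite ltNge; apply/negP => h; apply: S0y; exists y.
have [hyD _] := ri_restr hE mDy hy.
have -> : nE ((f \* \1_U - y) \* \1_(D (g y))) = nE (y \* \1_(D (g y))).
  rewrite -(ri_normN hE hyD); apply: (ri_eqfun hE _ _).2.
    by rewrite -scaleN1r; apply: ri_carrierZ.
  move=> t _ /=; rewrite !fctE /=.
  have [Dt|Dt] := pselect (D (g y) t); last first.
    by rewrite (indic_notin Dt) !mulr0 oppr0.
  have -> : \1_U t = 0 :> R.
    rewrite indicE memNset// => -[n S0n Dn]; apply: S0y.
    suff -> : g y = n by [].
    by apply: (tD _ _ I I); exists t.
  by rewrite mulr0 sub0r mulNr.
have : nE (f \* \1_(D (g y))) <= nE ((f - y) \* \1_(D (g y))) + nE (y \* \1_(D (g y))).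
  apply: le_trans (ri_normD hE hfyD hyD); rewrite le_eqVlt; apply/orP; left.
  apply/eqP; symmetry; apply: (ri_eqfun hE (ri_restr hE mDy hf).1 _).2 => t _.
  by rewrite !fctE /= -mulrDl subrK.
have := hD (g y); lra.
Qed.

(** If the restrictions were not Cauchy, differences of the sets [B] would provide disjoint sets on
    which [f] stays large, which separability excludes. The limit of the restrictions vanishes off
    every [B n], hence almost everywhere. *)
Lemma ri_order_continuous f (B : nat -> set R) (eps : R) : carrier E f ->
  (forall n, measurable (B n)) -> (forall n, B n.+1 `<=` B n) ->
  {ae mu, forall t, I01 t -> exists n, ~ B n t} -> 0 < eps ->
  exists N, forall n, (N <= n)%N -> nE (f \* \1_(B n)) < eps.
Proof.
move=> hf mB dB aeB e0.
have leB m n : (m <= n)%N -> B n `<=` B m.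
  move=> /subnKC <-; elim: (n - m)%N => [|k IH]; first by rewrite addn0.
  by rewrite addnS; apply: subset_trans (dB _) IH.
pose g n := f \* \1_(B n).
have hg n : carrier E (g n) by apply: (ri_restr hE (mB n) hf).1.
have cauchy (e : R) : 0 < e -> exists N, forall m n,
    (N <= m)%N -> (N <= n)%N -> nE (g m - g n) < e.
  move=> ep; apply/not_existsP => hN.
  have hs N : exists n, (N <= n)%N /\ e <= nE (f \* \1_(B N `\` B n)).
    have /existsNP[m /existsNP[n]] := hN N.
    move=> /not_implyP[Nm] /not_implyP[Nn] /negP; rewrite -leNgt => h.
    exists (maxn m n); split; first by rewrite (leq_trans Nm)// leq_maxl.
    apply: le_trans h _.
    apply: (ri_le hE _ _ _).2.
    - apply: (ri_measurable hE); exact: ri_carrierB.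
    - by apply: (ri_restr hE _ hf).1; apply: measurableD.
    - move=> t _; rewrite !fctE /=.
      have [Bt|Bt] := pselect (B (maxn m n) t).
        have Bm := leB _ _ (leq_maxl m n) _ Bt.
        have Bn := leB _ _ (leq_maxr m n) _ Bt.
        by rewrite /g /= (indic_in Bm) (indic_in Bn) subrr normr0.
      have [BN|BN] := pselect (B N t); last first.
        have Bm : ~ B m t by move/(leB _ _ Nm).
        have Bn : ~ B n t by move/(leB _ _ Nn).
        by rewrite /g /= (indic_notin Bm) (indic_notin Bn) !mulr0 subrr normr0.
      rewrite (@indic_in _ _ (B N `\` _)) ?mulr1//.
      rewrite /g /= -mulrBr normrM ler_piMr// !indicE.
      by case: (_ \in _); case: (_ \in _);
        rewrite ?subrr ?subr0 ?sub0r ?normrN ?normr0 ?normr1.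
  have /choice[s hs2] := hs.
  pose k j := iter j s 0%N.
  have kS j : (k j <= k j.+1)%N by rewrite /k iterS; have [] := hs2 (iter j s 0%N).
  have kle i j : (i <= j)%N -> (k i <= k j)%N.
    by apply: (@homo_leq _ _ leq); [exact: leqnn|exact: leq_trans|exact: kS].
  pose D j := B (k j) `\` B (k j.+1).
  have [||j] := sep_disjoint_restr (D := D) hf _ _ ep.
  - by move=> n; apply: measurableD.
  - apply/trivIsetP => i j _ _ ij.
    wlog : i j ij / (i < j)%N.
      move=> h; have [ltij|ltji|eij] := ltngtP i j.
      + exact: h.
      + by rewrite setIC; apply: h => //; rewrite eq_sym.
      + by rewrite eij eqxx in ij.
    move=> ltij; apply/seteqP; split => // t [[_ nb] [b _]]; apply: nb.
    exact: leB (kle _ _ ltij) _ b.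
  by rewrite ltNge => /negP; apply; rewrite /D /k iterS; have [] := hs2 (iter j s 0%N).
have [gl [hgl gcv]] := carrier_complete (ri_banach (ri01_ri hE)) hg cauchy.
have gcv' (e : R) : 0 < e -> exists N, forall n, (N <= n)%N -> nE (g n - gl) < e.
  move=> ep; have /cvgr0Pnorm_lt/(_ _ ep)[N _ hN] := gcv.
  by exists N => n /hN /=; apply: le_lt_trans; exact: ler_norm.
have gl0 : {ae mu, forall t, I01 t -> gl t = 0}.
  have h n : {ae mu, forall t, I01 t -> (gl \* \1_(~` B n)) t = 0}.
    have mC : measurable (~` B n) by apply: measurableC.
    have [hc _] := ri_restr hE mC hgl.
    apply: (ri_norm_eq0 hE hc).
    apply/le_anti/andP; split; last exact: (ri_norm_ge0 hE).
    apply/ler_addgt0Pr => e /gcv'[N hN]; rewrite add0r.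
    apply: le_trans (ltW (hN (maxn N n) (leq_maxl _ _))).
    apply: (ri_le hE (ri_measurable hE hc) (ri_carrierB hE (hg _) hgl) _).2.
    move=> t _; rewrite !fctE /= /g /=.
    have [Bt|Bt] := pselect (B n t).
      by rewrite (@indic_notin _ _ (~` B n)) ?mulr0 ?normr0//; exact.
    have Bm : ~ B (maxn N n) t by move/(leB _ _ (leq_maxr _ _)).
    by rewrite (@indic_in _ _ (~` B n) _ Bt) (indic_notin Bm) mulr1 mulr0 sub0r normrN.
  have {h} := leb_ae_and (ae_foralln h) aeB.
  apply: leb_ae_mono => t [h1 h2] It; have [n Bn] := h2 It.
  by have := h1 n It; rewrite /= (@indic_in _ _ (~` B n))// mulr1.
have [N hN] := gcv' _ e0; exists N => n /hN; apply: le_lt_trans.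
rewrite le_eqVlt; apply/orP; left; apply/eqP.
apply: (ri_norm_ae hE (hg n) (ri_carrierB hE (hg n) hgl)).
by apply: leb_ae_mono gl0 => t h It; rewrite !fctE /= h// subr0.
Qed.

End OrderContinuity.

(** * Nested families of sets *)

Section Chains.
Context {R : realType}.
Local Notation mu := (@lebesgue_measure R).
Local Notation I01 := (`[0, 1]%classic : set R).

Definition chain_fun (c : nat -> R) (Y : nat -> set R) (p : nat) : R -> R :=
  fun t => \sum_(q < p) c q * \1_(Y q) t.

Definition nested (Y : nat -> set R) :=
  forall q r t, (q <= r)%N -> Y r t -> Y q t.

Lemma chain_fun_ge0 c Y p t : (forall q, 0 <= c q) -> 0 <= chain_fun c Y p t.
Proof. by move=> c0; apply: sumr_ge0 => q _; rewrite mulr_ge0// indicE ler0n. Qed.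

(** At a point, the indices [q] with [Y q t] form an initial segment, so the value is a partial sum
    of [c]. The index where these sums first exceed [tau] is fixed before the family [Y] is given,
    which allows two families to be compared. *)
Lemma chain_fun_superlevel (c : nat -> R) (p : nat) (tau : R) :
  (forall q, 0 <= c q) -> 0 < tau ->
  (exists2 q, (q < p)%N &
     forall Y t, nested Y -> (tau < chain_fun c Y p t <-> Y q t)) \/
  (forall Y t, nested Y -> ~ tau < chain_fun c Y p t).
Proof.
move=> c0 tau0; elim: p => [|p [[q qp IH]|IH]].
- by right => Y t _; rewrite /chain_fun big_ord0; apply/negP; rewrite -leNgt ltW.
- left; exists q; first exact: ltnW.
  move=> Y t nY; have IHt := IH Y t nY.
  rewrite /chain_fun big_ord_recr /= -/(chain_fun c Y p t).
  have [Yq|Yq] := pselect (Y q t).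
    split=> // _; apply: lt_le_trans (IHt.2 Yq) _.
    by rewrite lerDl mulr_ge0// indicE ler0n.
  split=> //; rewrite indic_notin ?mulr0 ?addr0; first by move/IHt.
  by move=> Yp; apply: Yq; apply: nY Yp; exact: ltnW.
have [tC|tC] := ltP tau (\sum_(q < p.+1) c q).
- left; exists p => // Y t nY.
  have [Yp|Yp] := pselect (Y p t).
    split=> // _; apply: lt_le_trans tC _; rewrite le_eqVlt; apply/orP; left.
    apply/eqP; apply: eq_bigr => q _; rewrite indic_in ?mulr1//.
    by apply: nY Yp; rewrite -ltnS.
  split=> //; rewrite /chain_fun big_ord_recr /= -/(chain_fun c Y p t).
  by rewrite (indic_notin Yp) mulr0 addr0 => /IH.
- right => Y t nY; apply/negP; rewrite -leNgt; apply: le_trans tC.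
  apply: ler_sum => q _; by rewrite ler_piMr.
Qed.

Lemma chain_fun_equi (D : set R) (c : nat -> R) (Y Z : nat -> set R) (p : nat) :
  (forall q, 0 <= c q) -> nested Y -> nested Z ->
  (forall q, mu (D `&` Y q) = mu (D `&` Z q)) ->
  equimeasurable D (chain_fun c Y p) (chain_fun c Z p).
Proof.
move=> c0 nY nZ mYZ tau tau0; rewrite /distr.
have E W t : nested W -> (tau < `|chain_fun c W p t|) = (tau < chain_fun c W p t).
  by move=> nW; rewrite ger0_norm// chain_fun_ge0.
have [[q _ h]|h] := chain_fun_superlevel p c0 tau0.
- have H W : nested W ->
    [set t | D t /\ tau < `|chain_fun c W p t|] = D `&` W q.
    by move=> nW; apply/seteqP; split=> t /= [Dt]; rewrite E// (h W t nW).
  by rewrite !H.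
- have H W : nested W -> [set t | D t /\ tau < `|chain_fun c W p t|] = set0.
    by move=> nW; apply/seteqP; split=> t //= [Dt]; rewrite E// => /h; apply.
  by rewrite !H.
Qed.

Lemma measurable_chain_fun (D : set R) c Y p : (forall q, measurable (Y q)) ->
  measurable_fun D (chain_fun c Y p).
Proof.
move=> mY; apply: measurable_sum => q.
by apply: measurable_funM; [exact: measurable_cst|exact: measurable_indic].
Qed.

Lemma mu_I01_itv (s : R) : 0 <= s <= 1 -> mu (I01 `&` `[0, s]%classic) = s%:E.
Proof.
move=> /andP[s0 s1]; have -> : I01 `&` `[0, s]%classic = `[0, s]%classic.
  apply/seteqP; split=> t /=; rewrite !in_itv /=; first by case.
  by move=> /andP[-> ts]; rewrite (le_trans ts s1) ts.
rewrite lebesgue_measure_itv /= lte_fin; case: ltP => [_|]; rewrite ?sube0//.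
by move=> s0'; congr EFin; apply/le_anti; rewrite s0 s0'.
Qed.

Lemma mu_I01_sub_fin (B : set R) : measurable B ->
  exists2 s : R, 0 <= s <= 1 & mu (I01 `&` B) = s%:E.
Proof.
move=> mB; have le1 : (mu (I01 `&` B) <= 1)%E.
  rewrite -mu_I01; apply: le_measure; rewrite ?inE//.
  by apply: measurableI => //; exact: measurable_I01.
have ge0 : (0 <= mu (I01 `&` B))%E by [].
have fin : mu (I01 `&` B) \is a fin_num.
  by rewrite ge0_fin_numE// (le_lt_trans le1)// ltry.
exists (fine (mu (I01 `&` B))); last by rewrite fineK.
by rewrite -!lee_fin fineK// ge0 le1.
Qed.

End Chains.

Section RiChains.
Context {R : realType}.
Variables (E : fun_space R) (hE : ri_space01 E).
Local Notation mu := (@lebesgue_measure R).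
Local Notation I01 := (`[0, 1]%classic : set R).
Local Notation nE := (fnorm E).

Lemma ri_chain (c : nat -> R) (Y : nat -> set R) (p : nat) :
  (forall q, 0 <= c q) -> (forall q, measurable (Y q)) ->
  carrier E (chain_fun c Y p).
Proof.
move=> c0 mY; apply: (ri_bounded hE (K := \sum_(q < p) c q) _ _).1.
  exact: measurable_chain_fun.
move=> t _; rewrite ger0_norm ?chain_fun_ge0//; apply: ler_sum => q _.
by rewrite ler_piMr// indicE; case: (_ \in _).
Qed.

(* Nested families of sets enter the norm only through their measures, so they
   may be replaced by intervals [[0, s]] and then compared by inclusion. *)
Lemma ri_chain_le (c : nat -> R) (Y Z : nat -> set R) (p : nat) :
  (forall q, 0 <= c q) ->
  (forall q, measurable (Y q)) -> (forall q, measurable (Z q)) ->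
  nested Y -> nested Z ->
  (forall q, (q < p)%N -> (mu (I01 `&` Y q) <= mu (I01 `&` Z q))%E) ->
  nE (chain_fun c Y p) <= nE (chain_fun c Z p).
Proof.
move=> c0 mY mZ nY nZ YZ.
have H W : (forall q, measurable (W q)) -> nested W -> exists w : nat -> R,
  [/\ forall q, 0 <= w q <= 1, nested (fun q => `[0, w q]%classic),
      (forall q, mu (I01 `&` W q) = (w q)%:E) &
      nE (chain_fun c W p) = nE (chain_fun c (fun q => `[0, w q]%classic) p)].
  move=> mW nW; pose w q := fine (mu (I01 `&` W q)).
  have hw q : 0 <= w q <= 1 /\ mu (I01 `&` W q) = (w q)%:E.
    by have [s s01 es] := mu_I01_sub_fin (mW q); rewrite /w es.
  have dw : nested (fun q => `[0, w q]%classic).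
    move=> q r t qr /=; rewrite !in_itv /= => /andP[-> /le_trans]; apply.
    rewrite -lee_fin -(hw q).2 -(hw r).2; apply: le_measure; rewrite ?inE.
    - by apply: measurableI; [exact: measurable_I01|exact: mW].
    - by apply: measurableI; [exact: measurable_I01|exact: mW].
    - by move=> u [Iu Wu]; split=> //; apply: nW Wu.
  exists w; split=> //; [by move=> q; have [] := hw q|by move=> q; have [] := hw q|].
  apply: (ri_equi hE _ _ _).2.
  - exact: measurable_chain_fun.
  - by apply: ri_chain => // q; exact: measurable_itv.
  - apply: chain_fun_equi => // q; rewrite (hw q).2 mu_I01_itv//.
    by have [] := hw q.
have [y [y01 ny ey ->]] := H Y mY nY.
have [z [z01 nz ez ->]] := H Z mZ nZ.
have mi (w : nat -> R) q : measurable (`[0, w q]%classic : set R) by exact: measurable_itv.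
apply: (ri_le hE _ _ _).2.
- by apply: measurable_chain_fun => q; apply: mi.
- by apply: ri_chain => // q; apply: mi.
- move=> t _; rewrite !ger0_norm ?chain_fun_ge0//; apply: ler_sum => q _.
  apply: ler_wpM2l => //; rewrite !indicE ler_nat.
  have [Yt|Yt] := pselect ((`[0, y q]%classic : set R) t); last by rewrite memNset.
  rewrite mem_set// mem_set//; move: Yt => /=; rewrite !in_itv /=.
  move=> /andP[-> /le_trans]; apply; rewrite -lee_fin -ey -ez; exact/YZ/ltn_ord.
Qed.

Lemma ri_indic_le (A B : set R) : measurable A -> measurable B ->
  (mu (I01 `&` A) <= mu (I01 `&` B))%E -> nE \1_A <= nE \1_B.
Proof.
move=> mA mB AB.
have H (W : set R) : chain_fun (fun=> 1) (fun=> W) 1 = \1_W.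
  by apply/funext => t; rewrite /chain_fun big_ord1 mul1r.
rewrite -H -(H B); apply: ri_chain_le => //.
Qed.

Definition fundamental (s : R) : R := nE \1_(`[0, s]%classic : set R).

Lemma fundamental_ge0 s : 0 <= fundamental s.
Proof. by apply: (ri_norm_ge0 hE); apply: ri_indic => //; exact: measurable_itv. Qed.

Lemma ri_indic_fundamental (B : set R) (s : R) : measurable B -> 0 <= s <= 1 ->
  (mu (I01 `&` B) <= s%:E)%E -> nE \1_B <= fundamental s.
Proof.
move=> mB s01 Bs; apply: ri_indic_le => //.
by rewrite mu_I01_itv.
Qed.

Lemma ri_fundamental_indic (B : set R) (s : R) : measurable B -> 0 <= s <= 1 ->
  (s%:E <= mu (I01 `&` B))%E -> fundamental s <= nE \1_B.
Proof.
move=> mB s01 Bs; apply: ri_indic_le => //.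
by rewrite mu_I01_itv.
Qed.

Lemma fundamental_cvg0 (hsep : separable_space E) (eps : R) : 0 < eps ->
  exists s : R, 0 < s <= 1 /\ fundamental s < eps.
Proof.
move=> e0; pose B n := (`[0, n.+1%:R^-1]%classic : set R).
have [||||N hN] := @ri_order_continuous _ _ hE hsep (cst 1) B eps _ _ _ _ e0.
- exact: (ri_carrier1 hE).1.
- by move=> n; exact: measurable_itv.
- move=> n t; rewrite /B /= !in_itv /= => /andP[-> /le_trans]; apply.
  by rewrite lef_pV2 ?posrE ?ltr0n// ler_nat.
- have : {ae mu, forall t : R, t != 0}.
    exists [set 0]; split; [exact: measurable_set1|exact: lebesgue_measure_set1|].
    by move=> t /= /negP; rewrite negbK => /eqP.
  apply: leb_ae_mono => t t0 /=; rewrite in_itv /= => /andP[t_ge0 _].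
  have tp : 0 < t by rewrite lt_neqAle eq_sym t0.
  have [n hn] := ltr_add_invr tp; exists n; rewrite /B /= ?in_itv /= => /andP[_].
  by rewrite add0r in hn; rewrite leNgt hn.
exists N.+1%:R^-1; split.
  by rewrite invr_gt0 ltr0n /= invf_le1 ?ltr0n// ler1n.
have := hN N (leqnn _); congr (nE _ < _).
by apply/funext => t /=; rewrite mul1r.
Qed.

End RiChains.

(** * Step functions *)

Section StepFunctions.
Context {R : realType}.
Local Notation mu := (@lebesgue_measure R).
Local Notation I01 := (`[0, 1]%classic : set R).

(** On the unit interval the point 1 has cell index [D]; hence pointwise formulas run over [D.+1]
    indices, and measures over [D]. *)
Definition stepf (D : nat) (v : nat -> R) : R -> R :=
  fun t => v (Num.truncn (D%:R * t)).

Lemma truncn_mul_eq (D i : nat) (t : R) : (0 < D)%N -> 0 <= t ->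
  (Num.truncn (D%:R * t) == i) = (t \in `[i%:R / D%:R, i.+1%:R / D%:R[).
Proof.
move=> D0 t0; have D0' : 0 < D%:R :> R by rewrite ltr0n.
rewrite truncn_eq ?mulr_ge0// in_itv /= ler_pdivrMr// ltr_pdivlMr//.
by rewrite (mulrC t).
Qed.

Lemma stepf_sum (D : nat) (v : nat -> R) t : (0 < D)%N -> I01 t ->
  stepf D v t =
  \sum_(i < D.+1) v i * \1_(`[i%:R / D%:R, i.+1%:R / D%:R[%classic) t.
Proof.
move=> D0; rewrite /= in_itv /= => /andP[t0 t1].
have D0' : 0 < D%:R :> R by rewrite ltr0n.
have kD : (Num.truncn (D%:R * t) < D.+1)%N.
  rewrite truncn_lt_nat ?mulr_ge0//; apply: le_lt_trans (_ : D%:R < _).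
    by rewrite ler_piMr.
  by rewrite ltr_nat.
rewrite /stepf (bigD1 (Ordinal kD))//= indic_in ?mulr1 ?big1 ?addr0//.
  move=> i; rewrite -val_eqE /= => ik; rewrite indic_notin ?mulr0// => h.
  by move: ik; rewrite eq_sym truncn_mul_eq// h.
by rewrite /= -truncn_mul_eq.
Qed.

Lemma measurable_stepf (D : nat) (v : nat -> R) : (0 < D)%N ->
  measurable_fun I01 (stepf D v).
Proof.
move=> D0.
have : measurable_fun I01 (fun t : R => \sum_(i < D.+1) v i *
    \1_(`[i%:R / D%:R, i.+1%:R / D%:R[%classic) t : R).
  apply: measurable_sum => i.
  by apply: measurable_funM; [exact: measurable_cst|exact: measurable_indic].
by apply: eq_measurable_fun => t /set_mem It; rewrite -stepf_sum.
Qed.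

Lemma mu_stepf (D : nat) (P : pred nat) : (0 < D)%N ->
  mu (I01 `&` [set t | P (Num.truncn (D%:R * t))]) =
  ((\sum_(i < D) P i)%N%:R / D%:R)%:E.
Proof.
move=> D0; have D0' : 0 < D%:R :> R by rewrite ltr0n.
pose S := [set t | P (Num.truncn (D%:R * t))] : set R.
have S1 i : (`[i%:R / D%:R, i.+1%:R / D%:R[%classic `&` S : set R) =
    if P i then `[i%:R / D%:R, i.+1%:R / D%:R[%classic else set0.
  have H t : (`[i%:R / D%:R, i.+1%:R / D%:R[%classic : set R) t ->
      Num.truncn (D%:R * t) = i.
    move=> h; apply/eqP; rewrite truncn_mul_eq//.
    by move: h; rewrite /= in_itv /= => /andP[/(le_trans _)->//]; rewrite divr_ge0.
  case: ifP => Pi; apply/seteqP; split=> // t.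
  - by move=> h; split=> //; rewrite /S /= (H _ h).
  - by case=> h; rewrite /S /= (H _ h) Pi.
have Hk k : measurable (`[0, k%:R / D%:R[%classic `&` S : set R) /\
  mu (`[0, k%:R / D%:R[%classic `&` S) = ((\sum_(i < k) P i)%N%:R / D%:R)%:E.
  elim: k => [|k [mk IH]].
    rewrite big_ord0 !mul0r (_ : `[0, 0[%classic = set0) ?set0I ?measure0//.
    by apply/seteqP; split=> t //=; rewrite in_itv /=; case: ltgtP.
  have mk1 : measurable (`[k%:R / D%:R, k.+1%:R / D%:R[%classic `&` S : set R).
    by rewrite S1; case: ifP => _ //; exact: measurable_itv.
  have -> : `[0, k.+1%:R / D%:R[%classic `&` S =
      (`[0, k%:R / D%:R[%classic `&` S) `|`
      (`[k%:R / D%:R, k.+1%:R / D%:R[%classic `&` S).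
    rewrite -setIUl; congr (_ `&` _); apply/seteqP; split=> t /=; rewrite !in_itv /=.
      by move=> /andP[-> ->]; case: ltP; [left|right].
    have le1 : k%:R / D%:R <= k.+1%:R / D%:R :> R by rewrite ler_pM2r ?invr_gt0// ler_nat.
    case=> /andP[h1 h2]; first by rewrite h1 (lt_le_trans h2).
    by rewrite h2 (le_trans _ h1)// divr_ge0.
  split; first exact: measurableU.
  rewrite leb_measureU//; last first.
    apply/seteqP; split => // t [[+ _] [+ _]]; rewrite /= !in_itv /=.
    by move=> /andP[_ h1] /andP[h2 _]; have := lt_le_trans h1 h2; rewrite ltxx.
  rewrite IH big_ord_recr /= natrD mulrDl EFinD S1; congr (_ + _)%E.
  case: (P k); last by rewrite mul0r measure0.
  rewrite lebesgue_measure_itv /= lte_fin ltr_pM2r ?invr_gt0// ltr_nat leqnn.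
  by rewrite -EFinD -mulrBl -natrB// subSnn.
have [mD eD] := Hk D; rewrite divff ?gt_eqF// in mD eD.
have m1 : measurable ([set 1] `&` S).
  have [S1'|S1'] := pselect (S 1).
    by rewrite (_ : _ `&` _ = [set 1])//; apply/seteqP; split=> t /= => [[]|->].
  by rewrite (_ : _ `&` _ = set0)//; apply/seteqP; split=> t //= [->].
have -> : I01 `&` S = (`[0, 1[%classic `&` S) `|` ([set 1] `&` S).
  rewrite -setIUl; congr (_ `&` _); apply/seteqP; split=> t /=; rewrite !in_itv /=.
    by move=> /andP[-> ]; rewrite le_eqVlt => /orP[/eqP->|->]; [right|left].
  by case=> [/andP[-> /ltW]//|->]; rewrite ler01 lexx.
rewrite leb_measureU// ?eD; last first.
  apply/seteqP; split=> t // [[h _] [h1 _]].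
  by move: h; rewrite /= in_itv /= h1 ltxx andbF.
rewrite (_ : mu ([set 1] `&` S) = 0%E) ?adde0//.
apply/eqP; rewrite eq_le measure_ge0 andbT -(lebesgue_measure_set1 (1 : R)).
by apply: le_measure; rewrite ?inE.
Qed.

Lemma stepf_equi (D D' : nat) (v w : nat -> R) : (0 < D)%N -> (0 < D')%N ->
  (forall tau : R, 0 < tau ->
    ((\sum_(i < D) (tau < `|v i|)%R)%N * D')%N =
    ((\sum_(i < D') (tau < `|w i|)%R)%N * D)%N) ->
  equimeasurable I01 (stepf D v) (stepf D' w).
Proof.
move=> D0 D0' h tau tau0; rewrite /distr.
have H D1 (v1 : nat -> R) : [set t | I01 t /\ tau < `|stepf D1 v1 t|] =
    I01 `&` [set t | (fun i => tau < `|v1 i|) (Num.truncn (D1%:R * t))] by [].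
rewrite H (H D') (mu_stepf (fun i => tau < `|v i|) D0).
rewrite (mu_stepf (fun i => tau < `|w i|) D0'); congr EFin; apply/eqP.
rewrite eqr_div ?pnatr_eq0 -?lt0n// -!natrM; apply/eqP; congr (_ %:R).
exact: h.
Qed.

(* The vector [f], indexed by any finite type, as a step function whose values
   are taken on sets of equal measure. *)
Definition fstep (K : finType) (f : K -> R) : R -> R :=
  stepf #|K| (fun i => if insub i is Some j then f (enum_val (j : 'I_#|K|)) else 0).

Lemma fstep_count (K : finType) (f : K -> R) (tau : R) :
  (\sum_(i < #|K|) (tau < `|if insub (val i) is Some j then
      f (enum_val (j : 'I_#|K|)) else 0|)%R)%N =
  (\sum_x (tau < `|f x|)%R)%N.
Proof.
transitivity (\sum_(x in K) (tau < `|f x|)%R)%N; last by [].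
rewrite [RHS]big_enum_val /=; apply: eq_bigr => i _.
by rewrite insubT//= => p; congr (nat_of_bool (_ < `|f (enum_val _)|)); apply: val_inj.
Qed.

End StepFunctions.

Section RiStep.
Context {R : realType}.
Variables (E : fun_space R) (hE : ri_space01 E).
Local Notation mu := (@lebesgue_measure R).
Local Notation I01 := (`[0, 1]%classic : set R).
Local Notation nE := (fnorm E).

Lemma ri_stepf (D : nat) (v : nat -> R) : (0 < D)%N -> carrier E (stepf D v).
Proof.
move=> D0; apply: (ri_bounded hE (K := \sum_(i < D.+1) `|v i|) _ _).1.
  exact: measurable_stepf.
move=> t It; rewrite stepf_sum//; apply: le_trans (ler_norm_sum _ _ _) _.
apply: ler_sum => i _; rewrite normrM ler_piMr//.
by rewrite indicE; case: (_ \in _); rewrite ?normr0 ?normr1.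
Qed.

Lemma ri_stepf_count (D D' : nat) (v w : nat -> R) : (0 < D)%N -> (0 < D')%N ->
  (forall tau : R, 0 < tau ->
    ((\sum_(i < D) (tau < `|v i|)%R)%N * D')%N =
    ((\sum_(i < D') (tau < `|w i|)%R)%N * D)%N) ->
  nE (stepf D v) = nE (stepf D' w).
Proof.
move=> D0 D0' h; apply: (ri_equi hE _ _ _).2.
- exact: measurable_stepf.
- exact: ri_stepf.
- exact: stepf_equi.
Qed.

Lemma ri_fstep (K : finType) (f : K -> R) : (0 < #|K|)%N -> carrier E (fstep f).
Proof. exact: ri_stepf. Qed.

Lemma ri_stepf_fstep (K : finType) (v : nat -> R) (e : K -> nat) :
  (0 < #|K|)%N -> injective e -> (forall x, (e x < #|K|)%N) ->
  nE (stepf #|K| v) = nE (fstep (v \o e)).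
Proof.
move=> K0 ei eK; apply: ri_stepf_count => // tau tau0; congr (_ * _)%N.
rewrite fstep_count.
pose e' x : 'I_#|K| := Ordinal (eK x).
have e'b : bijective e'.
  by apply: inj_card_bij; [move=> x y [] /ei|rewrite card_ord].
by rewrite (reindex e') //=; exact: onW_bij.
Qed.

(** Cells have equal measure, so permuting them preserves the distribution. These permutations are
    the measure-preserving maps of the averaging argument. *)
Lemma ri_fstep_perm (K : finType) (f : K -> R) (s : K -> K) : (0 < #|K|)%N ->
  injective s -> nE (fstep (f \o s)) = nE (fstep f).
Proof.
move=> K0 si; apply: ri_stepf_count => // tau tau0; congr (_ * _)%N.
rewrite !fstep_count [RHS](reindex s) //=; apply: onW_bij.
exact: injF_bij.
Qed.

Lemma fstep_sum (K I : finType) (F : I -> K -> R) :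
  fstep (fun x => \sum_i F i x) = \sum_i fstep (F i).
Proof.
apply/funext => t; rewrite fct_sumE /fstep /stepf.
by case: insubP => [//|_]; rewrite big1.
Qed.

(* The translates of [\sum_k a k * chi k g * y k] by [g] average, over the
   group, to the combination of the characters [chi k] weighted by the
   corresponding Fourier coefficients of the [y k]. *)
Lemma ri_group_average (K : finType) (act : K -> K -> K) (n : nat)
    (chi y : 'I_n -> K -> R) (a : 'I_n -> R) (C : R) : (0 < #|K|)%N ->
  (forall g, injective (act g)) -> (forall x, injective (act^~ x)) ->
  (forall k g x, chi k (act g x) = chi k g * chi k x) ->
  (forall k x, chi k x * chi k x = 1) ->
  (forall g, nE (fstep (fun x => \sum_k a k * chi k g * y k x)) <= C) ->
  nE (fstep (fun x => \sum_k a k * (#|K|%:R^-1 * \sum_g chi k g * y k g) * chi k x))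
    <= C.
Proof.
move=> K0 actI actI' chiM chi1 hC.
have K0' : 0 < #|K|%:R :> R by rewrite ltr0n.
pose F g x := \sum_k a k * chi k g * y k (act g x).
have hF g : nE (fstep (F g)) <= C.
  have := hC g.
  by rewrite -(ri_fstep_perm (fun x => \sum_k a k * chi k g * y k x) K0 (actI g)).
have -> : (fun x => \sum_k a k * (#|K|%:R^-1 * \sum_g chi k g * y k g) * chi k x) =
    (fun x => #|K|%:R^-1 * \sum_g F g x).
  apply/funext => x; rewrite /F exchange_big /= big_distrr /=; apply: eq_bigr => k _.
  (* Substituting [act g x] for [g], and using that [chi k x] squares to 1, pulls [chi k x] out and
     leaves the Fourier coefficient of [y k]. *)
  have -> : \sum_g a k * chi k g * y k (act g x) =
      a k * (chi k x * \sum_g chi k g * y k g).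
    rewrite !big_distrr /= [RHS](reindex (act^~ x)) /=; last first.
      exact/onW_bij/injF_bij.
    apply: eq_bigr => g _; rewrite chiM -mulrA; congr (_ * _).
    rewrite -[LHS]mul1r -(chi1 k x).
    by move: (chi k g) (chi k x) (y k _) => u w z; ring.
  by move: (#|K|%:R^-1) (\sum_g chi k g * y k g) => u S; ring.
have -> : fstep (fun x => #|K|%:R^-1 * \sum_g F g x) =
    #|K|%:R^-1 *: \sum_g fstep (F g).
  rewrite -fstep_sum; apply/funext => t; rewrite /fstep /stepf !fctE.
  by case: insubP => [//|_]; rewrite scaler0.
have hc g : carrier E (fstep (F g)) by apply: ri_fstep.
rewrite (ri_normZ hE); last by apply: ri_carrier_sum.
rewrite ger0_norm ?invr_ge0 ?ler0n// ler_pdivrMl//.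
apply: le_trans (ri_norm_sum hE _ _) _ => //.
apply: le_trans (ler_sum _ (fun g _ => hF g)) _.
by rewrite sumr_const mulr_natl.
Qed.

Definition smean (D : nat) (v : nat -> R) : R := D%:R^-1 * \sum_(i < D) v i.

(** Averaging [|v|] over cyclic shifts of the cells, which is group averaging with the trivial
    character, produces its constant mean; the constant 1 has norm 1. *)
Lemma ri_smean_le (D : nat) (v : nat -> R) : (0 < D)%N ->
  smean D (fun i => `|v i|) <= nE (stepf D v).
Proof.
case: D => // D _.
pose m := smean D.+1 (fun i => `|v i|).
have m0 : 0 <= m by rewrite mulr_ge0// sumr_ge0.
have cD : #|{: 'I_D.+1}| = D.+1 by rewrite card_ord.
have -> : nE (stepf D.+1 v) = nE (fstep (fun i : 'I_D.+1 => `|v i|)).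
  have := @ri_stepf_fstep 'I_D.+1 (fun i => `|v i|) (@nat_of_ord D.+1).
  rewrite cD => <- //; last exact: ord_inj.
  apply: ri_stepf_count => // tau _; congr (_ * _)%N; apply: eq_bigr => i _.
  by rewrite normr_id.
have := @ri_group_average 'I_D.+1 (fun g x => g + x) 1
  (fun _ _ => 1) (fun _ x => `|v x|) (fun=> 1)
  (nE (fstep (fun i : 'I_D.+1 => `|v i|))).
rewrite cD => /(_ isT (fun g => addrI g) (fun x => addIr x)).
move=> /(_ (fun _ _ _ => esym (mulr1 1)) (fun _ _ => mulr1 1)) h.
apply: le_trans (h _); last first.
  move=> _; rewrite le_eqVlt; apply/orP; left; apply/eqP; congr (nE (fstep _)).
  by apply/funext => x; rewrite big_ord1 !mul1r.
have -> : (fun _ : 'I_D.+1 => \sum_(k < 1) 1 * (D.+1%:R^-1 *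
    \sum_(g : 'I_D.+1) 1 * `|v g|) * 1) = (fun=> m).
  apply/funext => x; rewrite big_ord1 mul1r mulr1; congr (_ * _).
  by apply: eq_bigr => i _; rewrite mul1r.
have [c1 n1] := ri_carrier1 hE.
rewrite -[leLHS](ger0_norm m0) -[leLHS]mulr1 -n1 -(ri_normZ hE)//.
rewrite le_eqVlt; apply/orP; left; apply/eqP.
have -> : nE (fstep (fun _ : 'I_D.+1 => m)) = nE (stepf D.+1 (fun=> m)).
  have := @ri_stepf_fstep 'I_D.+1 (fun=> m) (@nat_of_ord D.+1).
  by rewrite cD => -> //; exact: ord_inj.
congr (nE _); apply/funext => t; rewrite /stepf !fctE.
exact: mulr1.
Qed.

End RiStep.

(** * Density of step functions *)

Section StepDensity.
Context {R : realType}.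
Local Notation mu := (@lebesgue_measure R).
Local Notation I01 := (`[0, 1]%classic : set R).

Lemma stepf_sample_cvg (g : R -> R) (t : R) : continuous g -> I01 t ->
  (fun m => stepf m.+1 (fun i => g (i%:R / m.+1%:R)) t) @ \oo --> g t.
Proof.
move=> cg /=; rewrite in_itv /= => /andP[t0 _].
suff h : (fun m => (Num.truncn (m.+1%:R * t))%:R / m.+1%:R : R) @ \oo --> t.
  exact: (cvg_comp _ _ h (cg t)).
apply/cvgrPdist_lt => e e0; have [N _ hN] := near_infty_natSinv_lt (PosNum e0).
exists N => // m /hN /= /(le_lt_trans _); apply.
have m0 : 0 < m.+1%:R :> R by rewrite ltr0n.
have /andP[h1 h2] := truncn_itv (mulr_ge0 (ltW m0) t0).
have q0 : (Num.truncn (m.+1%:R * t))%:R / m.+1%:R <= t.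
  by rewrite ler_pdivrMr// (mulrC t).
rewrite ger0_norm ?subr_ge0// lerBlDr -[X in X + _]mul1r -mulrDl.
by rewrite ler_pdivlMr// (mulrC t) nat1r ltW.
Qed.

Lemma dist_clip_le (K a w : R) : `|a| <= K ->
  `|a - Num.max (- K) (Num.min K w)| <= `|a - w|.
Proof.
rewrite ler_norml => /andP[h1 h2]; case: (leP K w) => h3.
  rewrite max_r ?(le_trans h1)//.
  by rewrite -normrN -[leRHS]normrN !ger0_norm; lra.
case: (leP (- K) w) => h4 //.
by rewrite !ger0_norm; lra.
Qed.

Lemma measurable_dist_ge (f g : R -> R) (a : R) :
  measurable_fun I01 f -> measurable_fun I01 g ->
  measurable (I01 `&` [set t | a <= `|f t - g t|]).
Proof.
move=> mf mg.
have mh : measurable_fun I01 (fun t => `|f t - g t|).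
  by apply: measurableT_comp => //; exact: measurable_funB.
have -> : [set t | a <= `|f t - g t|] = (fun t => `|f t - g t|) @^-1` `[a, +oo[.
  by apply/seteqP; split=> t /=; rewrite in_itv /= andbT.
by apply: mh; [exact: measurable_I01|exact: measurable_itv].
Qed.

(** A continuous function close to [x] in L^1 is close in measure, and by Egorov's theorem its
    samples on a fine grid are uniformly close to it off a small set. Clipping the samples to
    [[-K, K]] does not increase the distance to [x]. *)
Lemma step_approx (x : R -> R) (K eta s : R) : measurable_fun I01 x ->
  (forall t, I01 t -> `|x t| <= K) -> 0 < eta -> 0 < s ->
  exists D v, [/\ (0 < D)%N, (forall i, `|v i| <= K) &
    (mu (I01 `&` [set t | (eta <= `|x t - stepf D v t|)%R]) <= s%:E)%E].
Proof.
move=> mx xK eta0 s0.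
have K0 : 0 <= K by apply: le_trans (xK 0 _) => //=; rewrite in_itv /= lexx ler01.
have mI : measurable I01 by exact: measurable_I01.
have If : (mu I01 < +oo)%E by rewrite mu_I01 ltry.
have ix : mu.-integrable I01 (EFin \o x).
  apply: measurable_bounded_integrable => //.
  by exists K; split; [exact: num_real|move=> M KM t It; exact: le_trans (xK t It) (ltW KM)].
have [g_ [cg ig gx]] := approximation_continuous_integrable mI If ix.
(* By Markov's inequality, an L^1-error below this product reaches [eta / 2] only on a set of
   measure at most [s / 2]. *)
have e1 : 0 < eta / 2 * (s / 2) by rewrite mulr_gt0// divr_gt0.
have [n hn] : exists n, (\int[mu]_(z in I01) `|(x z - g_ n z)%:E| < (eta / 2 * (s / 2))%:E)%E.
  have /fine_cvgP[[N1 _ h1] /cvgr0Pnorm_lt/(_ _ e1)[N2 _ h2]] := gx.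
  exists (maxn N1 N2).
  have /= f1 := h1 _ (leq_maxl N1 N2); have /= f2 := h2 _ (leq_maxr N1 N2).
  rewrite -(fineK f1) lte_fin; apply: le_lt_trans f2; exact: ler_norm.
pose g := g_ n.
have mg : measurable_fun I01 g by apply: measurable_funTS; apply: continuous_measurable_fun; exact: cg.
have bad1 : (mu (I01 `&` [set t | (eta / 2 <= `|x t - g t|)%R]) <= (s / 2)%:E)%E.
  have mxg : measurable_fun I01 (fun z => (x z - g z)%:E).
    by apply/measurable_EFinP; exact: measurable_funB.
  have e2 : 0 < eta / 2 by rewrite divr_gt0.
  have := @le_integral_comp_abse _ _ _ mu I01 mI (fun z => (x z - g z)%:E) (eta / 2)
    id (@measurable_id _ _ _) (fun r h => h) (fun a b _ _ h => h) mxg e2.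
  move=> /le_lt_trans /(_ hn) /ltW; rewrite (EFinM (eta / 2)) lee_pmul2l//.
have [] := @pointwise_almost_uniform _ R _ mu
  (fun m => stepf m.+1 (fun i => g (i%:R / m.+1%:R))) g I01 (s / 2).
- by move=> m; exact: measurable_stepf.
- exact: mI.
- exact: If.
- by move=> t It; exact: (stepf_sample_cvg (cg n) It).
- by rewrite divr_gt0.
move=> B [mB Bs Bu].
have e2 : 0 < eta / 2 by rewrite divr_gt0.
have [m hm] : exists m, forall t, (I01 `\` B) t ->
    `|g t - stepf m.+1 (fun i => g (i%:R / m.+1%:R)) t| < eta / 2.
  have := Bu [set h | forall t, (I01 `\` B) t -> `|g t - h t| < eta / 2] _.
  case.
    apply/uniform_nbhs; exists [set xy | ball xy.1 (eta / 2) xy.2].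
    split; first exact: (entourage_ball _ (PosNum e2)).
    by move=> h hh t At; exact: hh.
  by move=> N _ hN; exists N; exact: (hN N (leqnn N)).
pose v i : R := Num.max (- K) (Num.min K (g (i%:R / m.+1%:R))).
exists m.+1, v; split=> //.
  by move=> i; rewrite ler_norml /v le_max lexx /= ge_max ge_min lexx andbT /= -subr_ge0; lra.
set A1 := (I01 `&` [set t | eta / 2 <= `|x t - g t|]) in bad1.
have mA1 : measurable A1 by exact: measurable_dist_ge.
have : (mu (A1 `|` B) <= s%:E)%E.
  apply: le_trans (measureU2 mu mA1 mB) _.
  by rewrite [s in leRHS](splitr s) EFinD; apply: leeD => //; exact: ltW.
apply: le_trans; apply: le_measure; rewrite ?inE.
- by apply: measurable_dist_ge => //; exact: measurable_stepf.
- exact: measurableU.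
move=> t [It /= ht]; have [Bt|Bt] := pselect (B t); [by right|left; split=> //=].
have := hm t (conj It Bt); have := dist_clip_le (stepf m.+1 (fun i => g (i%:R / m.+1%:R)) t) (xK t It).
have := ler_distD (g t) (x t) (stepf m.+1 (fun i => g (i%:R / m.+1%:R)) t).
move: ht; rewrite /stepf /v; lra.
Qed.

End StepDensity.

Section RiStepDensity.
Context {R : realType}.
Variables (E : fun_space R) (hE : ri_space01 E) (hsep : separable_space E).
Local Notation mu := (@lebesgue_measure R).
Local Notation I01 := (`[0, 1]%classic : set R).
Local Notation nE := (fnorm E).

Lemma ri_truncate (x : R -> R) (eps : R) : carrier E x -> 0 < eps ->
  exists n : nat, nE (x \* \1_(I01 `&` [set t | n%:R < `|x t|])) < eps.
Proof.
move=> hx e0; have mx := ri_measurable hE hx.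
have mI : measurable I01 by exact: measurable_I01.
have [|||N hN] := @ri_order_continuous _ _ hE hsep x
    (fun n => I01 `&` [set t | n%:R < `|x t|]) eps hx _ _ _ e0.
- move=> n.
  have -> : [set t | n%:R < `|x t|] = (fun t => `|x t|) @^-1` `]n%:R, +oo[.
    by apply/seteqP; split=> t /=; rewrite in_itv /= andbT.
  have mh : measurable_fun I01 (fun t => `|x t|) by exact: measurableT_comp.
  by apply: mh => //; exact: measurable_itv.
- move=> n t [It /= h]; split=> //=; apply: le_lt_trans h; by rewrite ler_nat.
- apply: leb_ae_all => t It; exists (Num.truncn `|x t|).+1 => -[_ /=].
  apply/negP; rewrite -leNgt ltW//; exact: truncnS_gt.
- by exists N; exact: hN.
Qed.

Lemma ri_step_dense (x : R -> R) (eps : R) : carrier E x -> 0 < eps ->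
  exists D v, (0 < D)%N /\ nE (x - stepf D v) < eps.
Proof.
move=> hx e0; have e4 : 0 < eps / 4 by rewrite divr_gt0.
have mI : measurable I01 by exact: measurable_I01.
have [n hn] := ri_truncate hx e4.
set B := I01 `&` _ in hn.
have mB : measurable B.
  have -> : B = I01 `&` (fun t => `|x t|) @^-1` `]n%:R, +oo[.
    by rewrite /B; congr (_ `&` _); apply/seteqP; split=> t /=; rewrite in_itv /= andbT.
  have mh : measurable_fun I01 (fun t => `|x t|).
    by apply: measurableT_comp => //; exact: (ri_measurable hE hx).
  by apply: mh => //; exact: measurable_itv.
have mCB : measurable (~` B) by exact: measurableC.
pose y := x \* \1_(~` B).
have [hy _] := ri_restr hE mCB hx.
have [hxB _] := ri_restr hE mB hx.
have yn t : I01 t -> `|y t| <= n%:R.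
  move=> It; rewrite /y /=; have [Bt|Bt] := pselect (B t).
    by rewrite indic_notin ?mulr0 ?normr0//; apply.
  rewrite indic_in// mulr1 leNgt; apply/negP => h; apply: Bt; split=> //.
(* An error of at most [2 n] on a set of measure [s] then costs less than [eps / 4]; [n.+1] avoids a
   division by zero. *)
have d0 : 0 < eps / (8 * n.+1%:R) by rewrite divr_gt0// mulr_gt0// ltr0n.
have [s [/andP[s0 s1] hs]] := fundamental_cvg0 hE hsep d0.
have [D [v [D0 vn hv]]] := step_approx (ri_measurable hE hy) yn e4 s0.
exists D, v; split=> //.
have hw := ri_stepf hE v D0.
set Z := I01 `&` _ in hv.
have mZ : measurable Z.
  by apply: measurable_dist_ge; [exact: (ri_measurable hE hy)|exact: measurable_stepf].
have hZ : nE \1_Z <= fundamental E s.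
  apply: (ri_indic_fundamental hE) => //; first by rewrite ltW.
  by rewrite setIA setIid.
have [c1 n1] := ri_carrier1 hE.
have hZc := ri_indic hE mZ.
have h1 := ri_carrierZ hE (eps / 4) c1.
have h2 := ri_carrierZ hE (2 * n.+1%:R) hZc.
have le1 : nE (y - stepf D v) <= eps / 4 + 2 * n.+1%:R * fundamental E s.
  apply: le_trans (_ : nE (eps / 4 *: cst 1 + (2 * n.+1%:R) *: \1_Z) <= _).
    apply: (ri_le hE _ (ri_carrierD hE h1 h2) _).2.
      by apply: (ri_measurable hE); exact: (ri_carrierB hE).
    move=> t It.
    have -> : (eps / 4 *: (cst 1 : R -> R) + (2 * n.+1%:R) *: \1_Z) t =
      eps / 4 + 2 * n.+1%:R * \1_Z t by rewrite !fctE; congr (_ + _); exact: mulr1.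
    rewrite !fctE.
    have [Zt|Zt] := pselect (Z t).
      rewrite indic_in// mulr1 [leRHS]ger0_norm; last by rewrite addr_ge0 ?mulr_ge0// ltW.
      have := yn t It; have := vn (Num.truncn (D%:R * t)).
      have := ler_normB (y t) (stepf D v t); have := ler0n R n; rewrite -[n.+1]addn1 natrD /stepf; lra.
    rewrite indic_notin// mulr0 addr0 [leRHS]ger0_norm; last exact: ltW.
    rewrite leNgt; apply/negP => h; apply: Zt; split=> //=; exact: ltW.
  apply: le_trans (ri_normD hE h1 h2) _.
  rewrite !(ri_normZ hE)// n1 mulr1 (ger0_norm (ltW e4)) ger0_norm ?mulr_ge0//.
  by rewrite lerD2l ler_wpM2l// mulr_ge0.
have le2 : 2 * n.+1%:R * fundamental E s < eps / 4.
  have n0 : 0 < n.+1%:R :> R by rewrite ltr0n.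
  rewrite -ltr_pdivlMl ?mulr_gt0//; apply: lt_le_trans hs _.
  by rewrite le_eqVlt; apply/orP; left; apply/eqP; field; rewrite gt_eqF.
have -> : x - stepf D v = (x \* \1_B) + (y - stepf D v).
  apply/funext => t; rewrite !fctE /y /=; have [Bt|Bt] := pselect (B t).
    by rewrite indic_in// indic_notin ?mulr0 ?mulr1 ?sub0r//; apply.
  by rewrite indic_notin// indic_in ?mulr0 ?mulr1 ?add0r//.
apply: le_lt_trans (ri_normD hE hxB (ri_carrierB hE hy hw)) _.
lra.
Qed.

End RiStepDensity.

(** * Gaussian tails and the closure of bounded functions *)

Section Orlicz.
Context {R : realType}.
Local Notation mu := (@lebesgue_measure R).
Local Notation I01 := (`[0, 1]%classic : set R).
Variable (M : R -> R).
Hypothesis hM : orlicz_function M.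

Let mI : measurable I01. Proof. exact: measurable_I01. Qed.

Lemma orlicz_mono (u v : R) : 0 <= u -> u <= v -> M u <= M v.
Proof.
by move=> u0 uv; apply: (orlicz_nondecreasing hM) => //;
  rewrite in_itv /= andbT// (le_trans u0).
Qed.

Lemma orlicz_ge0 (u : R) : 0 <= u -> 0 <= M u.
Proof. by move=> u0; rewrite -(orlicz0 hM); apply: orlicz_mono. Qed.

Lemma orlicz_midpoint (u v : R) : 0 <= u -> 0 <= v ->
  M ((u + v) / 2) <= M u / 2 + M v / 2.
Proof.
move=> u0 v0; have ha : (0 : R) <= 2^-1 by rewrite invr_ge0.
have hb : (2^-1 : R) <= 1 by rewrite invf_le1// ler1n.
have := @orlicz_convex _ _ hM (Itv01 ha hb) u v.
rewrite !inE /= !in_itv /= !andbT => /(_ u0 v0).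
rewrite [leRHS]convRE [X in M X]convRE /=.
rewrite /unstable.onem; have e : (1 - 2^-1 : R) = 2^-1 by field. by rewrite !e !(mulrC 2^-1) mulrDl.
Qed.

Lemma measurable_orlicz (u : R -> R) (l : R) : measurable_fun I01 u -> 0 < l ->
  measurable_fun I01 (fun t => (M (`|u t| / l))%:E).
Proof.
move=> mu_ l0; apply/measurable_EFinP.
pose N x := M (Num.max 0 x).
have mN : measurable_fun setT N.
  apply: nondecreasing_measurable => // a b ab; apply: orlicz_mono.
    by rewrite le_max lexx.
  by rewrite ge_max !le_max lexx /= ab orbT.
have -> : (fun t => M (`|u t| / l)) = N \o (fun t => `|u t| / l).
  by apply/funext => t /=; rewrite /N max_r// divr_ge0// ltW.
apply: measurableT_comp => //; apply: measurable_funM => //.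
by apply: measurableT_comp.
Qed.

Definition modular_le1 (u : R -> R) (l : R) : Prop :=
  0 < l /\ (\int[mu]_(t in I01) (M (`|u t| / l))%:E <= 1)%E.

Lemma luxemburg_lt (u : R -> R) (r : \bar R) : (luxemburg M u < r)%E ->
  exists2 l : R, modular_le1 u l & (l%:E < r)%E.
Proof. by move=> /ereal_inf_lt[_ [l hl <-] lr]; exists l. Qed.

Lemma luxemburg_le (u : R -> R) (l : R) : modular_le1 u l ->
  (luxemburg M u <= l%:E)%E.
Proof. by move=> h; apply: ereal_inf_lbound; exists l. Qed.

(** Convexity at the midpoint yields the scale [2 * m]. Finiteness must be known before smallness of
    the norm says anything: the norm is [fine] of the Luxemburg functional, and [fine] sends +oo to
    0. *)
Lemma luxemburgB_lty (u v : R -> R) : measurable_fun I01 u -> measurable_fun I01 v ->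
  (luxemburg M u < +oo)%E -> (luxemburg M v < +oo)%E ->
  (luxemburg M (u - v)%R < +oo)%E.
Proof.
move=> mu_ mv /luxemburg_lt[l [l0 hl] _] /luxemburg_lt[k [k0 hk] _].
pose m := Num.max l k.
have m0 : 0 < m by rewrite lt_max l0.
have hlm : l <= m by rewrite le_max lexx.
have hkm : k <= m by rewrite le_max lexx orbT.
apply: le_lt_trans (luxemburg_le (l := 2 * m) _) (ltry _); split; first by rewrite mulr_gt0.
have muv : measurable_fun I01 (u - v) by exact: measurable_funB.
have pos (w : R -> R) (c : R) t : 0 < c -> 0 <= `|w t| / c.
  by move=> c0; rewrite divr_ge0// ltW.
have pM (w : R -> R) (c : R) t : 0 < c -> (0 <= (M (`|w t| / c))%:E)%E.
  by move=> c0; rewrite lee_fin orlicz_ge0// pos.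
apply: (@le_trans _ _ (\int[mu]_(t in I01)
    ((2^-1)%:E * (M (`|u t| / l))%:E + (2^-1)%:E * (M (`|v t| / k))%:E))%E).
  apply: ge0_le_integral => //.
  - by move=> t _; apply: pM; rewrite mulr_gt0.
  - by apply: measurable_orlicz => //; rewrite mulr_gt0.
  - by apply: emeasurable_funD; apply: measurable_funeM; exact: measurable_orlicz.
  move=> t _; rewrite -!EFinM -EFinD lee_fin ![2^-1 * _]mulrC.
  apply: le_trans (orlicz_midpoint (pos u l t l0) (pos v k t k0)).
  apply: orlicz_mono; first by rewrite divr_ge0// mulr_ge0// ltW.
  rewrite invfM mulrA mulrAC ler_pM2r ?invr_gt0//.
  apply: (@le_trans _ _ ((`|u t| + `|v t|) / m)).
    by rewrite ler_pM2r ?invr_gt0//; exact: ler_normB.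
  by rewrite mulrDl lerD// ler_wpM2l// lef_pV2.
rewrite ge0_integralD//; last 4 first.
- by move=> t _; rewrite mule_ge0// ?pM// lee_fin.
- by apply: measurable_funeM; exact: measurable_orlicz.
- by move=> t _; rewrite mule_ge0// ?pM// lee_fin.
- by apply: measurable_funeM; exact: measurable_orlicz.
rewrite !ge0_integralZl_EFin//; first last.
- exact: measurable_orlicz.
- by move=> t _; exact: pM.
- exact: measurable_orlicz.
- by move=> t _; exact: pM.
rewrite [1%E in leRHS](_ : _ = (2^-1)%:E * 1 + (2^-1)%:E * 1)%E; last first.
  by rewrite !mule1 -EFinD; congr EFin; lra.
by apply: leeD; rewrite lee_pmul2l//.
Qed.

Lemma orlicz_markov (u : R -> R) (l s : R) : measurable_fun I01 u ->
  modular_le1 u l -> 0 <= s ->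
  ((M s)%:E * mu (I01 `&` [set t | (l * s < `|u t|)%R]) <= 1)%E.
Proof.
move=> mu_ [l0 hl] s0; apply: le_trans hl.
set A := I01 `&` _.
have mA : measurable A.
  have -> : A = I01 `&` (fun t => `|u t|) @^-1` `]l * s, +oo[.
    by rewrite /A; congr (_ `&` _); apply/seteqP; split=> t /=; rewrite in_itv /= andbT.
  have mh : measurable_fun I01 (fun t => `|u t|) by exact: measurableT_comp.
  by apply: mh => //; exact: measurable_itv.
have := @integral_cst _ _ _ mu A mA ((M s)%:E).
rewrite /cst => <-; apply: (@le_trans _ _ (\int[mu]_(t in A) (M (`|u t| / l))%:E)%E).
  apply: ge0_le_integral => //.
  - by move=> t _; rewrite lee_fin orlicz_ge0.
  - apply: measurable_funS (measurable_orlicz mu_ l0) => //; by move=> t [].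
  - move=> t [_ /= h]; rewrite lee_fin orlicz_mono// ler_pdivlMr// mulrC ltW//.
apply: ge0_subset_integral => //.
- exact: measurable_orlicz.
- by move=> t _; rewrite lee_fin orlicz_ge0// divr_ge0// ltW.
- by move=> t [].
Qed.

End Orlicz.

Section ExpTails.
Context {R : realType}.
Local Notation mu := (@lebesgue_measure R).
Local Notation I01 := (`[0, 1]%classic : set R).

Let mI : measurable I01. Proof. exact: measurable_I01. Qed.

Lemma measurable_superlevel (u : R -> R) (s : R) : measurable_fun I01 u ->
  measurable (I01 `&` [set t | s < `|u t|]).
Proof.
move=> mu_.
have -> : [set t | s < `|u t|] = (fun t => `|u t|) @^-1` `]s, +oo[.
  by apply/seteqP; split=> t /=; rewrite in_itv /= andbT.
have mh : measurable_fun I01 (fun t => `|u t|) by exact: measurableT_comp.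
by apply: mh => //; exact: measurable_itv.
Qed.

(** Doubling $u$ multiplies the exponent in $e^{u^2}$ by 4, whence the powers [4 ^ q]: a constant
    [L] that works at level 0 works at all dyadic levels. *)
Lemma exp_L2_tail (M : R -> R) (b : R) : exp_L2_function M -> 0 < b ->
  exists2 L : R, 0 < L & forall (u : R -> R) (l : R), measurable_fun I01 u ->
    modular_le1 M u l -> forall q : nat,
    (mu (I01 `&` [set t | (L * l * 2 ^+ q < `|u t|)%R]) <= (b ^+ (4 ^ q))%:E)%E.
Proof.
move=> [hM [K [u0 [K0 u00 hK]]]] b0.
(* As [K^-1 * L] is at least [w], the exponential of its square is at least [(K + 1) / b]: the
   factor [1 / b] gives the decay, and [K + 1] beats the factor [K^-1] in the equivalence. The
   summand [u0] of [L] reaches the range where the equivalence holds. *)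
pose w := 1 + (K + 1) / b.
have wb : (K + 1) / b <= w by rewrite /w lerDr.
have wb0 : 0 < (K + 1) / b by rewrite divr_gt0// addr_gt0.
have w1 : 1 <= w by rewrite /w lerDl ltW.
have L0 : 0 < u0 + K * w by rewrite addr_gt0// mulr_gt0// (lt_le_trans ltr01).
exists (u0 + K * w) => // u l mu_ hl q.
set L := u0 + K * w in L0 *.
have p1 : (1 : R) <= 2 ^+ q by rewrite exprn_ege1// ler1n.
have s0 : 0 <= L * 2 ^+ q by rewrite mulr_ge0// ltW.
have := orlicz_markov hM mu_ hl s0.
have -> : l * (L * 2 ^+ q) = L * l * 2 ^+ q by ring.
have Ls : u0 <= L * 2 ^+ q.
  apply: (@le_trans _ _ L); first by rewrite lerDl mulr_ge0 ?(ltW K0)// (le_trans ler01).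
  by rewrite ler_peMr// ltW.
have /andP[hMs _] := hK _ Ls.
have bq0 : 0 < b ^+ (4 ^ q) by rewrite exprn_gt0.
have Mb : (b ^+ (4 ^ q))^-1 <= M (L * 2 ^+ q).
  apply: le_trans hMs.
  have e1 : (K + 1) / b <= expR ((K^-1 * L) ^+ 2).
    apply: le_trans (_ : w <= _) => //; apply: le_trans (_ : (K^-1 * L) ^+ 2 <= _).
      have wL : w <= K^-1 * L by rewrite ler_pdivlMl// /L lerDr ltW.
      have x1 : 1 <= K^-1 * L := le_trans w1 wL.
      by apply: le_trans wL _; rewrite expr2 ler_peMl// (le_trans ler01).
    by apply: le_trans (expR_ge1Dx _); rewrite lerDr.
  have -> : (K^-1 * (L * 2 ^+ q)) ^+ 2 = (4 ^ q)%N%:R * (K^-1 * L) ^+ 2.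
    rewrite mulrA exprMn mulrC; congr (_ * _).
    by rewrite -exprM mulnC exprM natrX; congr (_ ^+ _); rewrite expr2 -natrM.
  rewrite expRM_natl mulrC ler_pdivlMr// mulrC ler_pdivrMr// mulrC.
  apply: (@le_trans _ _ (b ^+ (4 ^ q) * ((K + 1) / b) ^+ (4 ^ q))); last first.
    by rewrite ler_pM2l// lerXn2r// nnegrE ?ltW// expR_gt0.
  rewrite -exprMn (mulrC b) divfK ?gt_eqF//.
  have n0 : (0 < 4 ^ q)%N by rewrite expn_gt0.
  rewrite -(prednK n0) exprS; apply: (@le_trans _ _ (K + 1)); first by rewrite lerDl.
  by rewrite ler_peMr ?addr_ge0 ?(ltW K0)// exprn_ege1// lerDr ltW.
set A := I01 `&` _ => h.
have [s s01 es] := mu_I01_sub_fin (measurable_superlevel (L * l * 2 ^+ q) mu_).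
move: h; rewrite /A.
have -> : I01 `&` [set t | L * l * 2 ^+ q < `|u t|] =
  I01 `&` (I01 `&` [set t | L * l * 2 ^+ q < `|u t|]) by rewrite setIA setIid.
rewrite es -EFinM !lee_fin => h.
have {}h : (b ^+ (4 ^ q))^-1 * s <= 1.
  by apply: le_trans h; rewrite ler_wpM2r//; case/andP: s01.
by rewrite mulrC ler_pdivrMr// mul1r in h.
Qed.

End ExpTails.

Section Closing.
Context {R : realType}.
Variables (E : fun_space R) (hE : ri_space01 E).
Local Notation mu := (@lebesgue_measure R).
Local Notation I01 := (`[0, 1]%classic : set R).
Local Notation nE := (fnorm E).

(* Uniform bounds for truncations of [log^{1/2} (1 / s)], which up to constants
   is the largest decreasing function with Gaussian tails. *)
Definition gauss_bounded (b C : R) := forall p,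
  nE (chain_fun (fun q => 2 ^+ q) (fun q => `[0, b ^+ (4 ^ q)]%classic) p) <= C.

(** If [k * 2 ^+ p] is the first dyadic level not below [a], the weights of the levels passed add up
    to [2 ^+ p - 1]; the summand 1 completes this to [2 ^+ p]. *)
Lemma dyadic_chain_ge (k a : R) (Y : nat -> set R) (t : R) (p : nat) : 0 <= k ->
  (forall q, k * 2 ^+ q < a -> Y q t) -> a <= k * 2 ^+ p ->
  a <= k * (1 + chain_fun (fun q => 2 ^+ q) Y p t).
Proof.
move=> k0 hY; elim: p => [|p IH] hp.
  by rewrite /chain_fun big_ord0 addr0 -(expr0 2).
have [h|h] := leP a (k * 2 ^+ p).
  apply: le_trans (IH h) _; rewrite ler_wpM2l// lerD2l /chain_fun.
  by rewrite [leRHS]big_ord_recr /= lerDl mulr_ge0// ?exprn_ge0// indicE ler0n.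
apply: le_trans hp _; rewrite ler_wpM2l// /chain_fun.
have -> : \sum_(q < p.+1) 2 ^+ q * \1_(Y q) t = \sum_(q < p.+1) 2 ^+ q :> R.
  apply: eq_bigr => q _; rewrite indic_in ?mulr1//; apply: hY.
  apply: le_lt_trans h; rewrite ler_wpM2l// ler_weXn2l// ?ler1n//.
  by rewrite -ltnS.
have h2 : (2 - 1) * \sum_(q < p.+1) 2 ^+ q = 2 ^+ p.+1 - 1 :> R by rewrite subrX1.
have e1 : 2 - 1 = 1 :> R by lra.
rewrite e1 mul1r in h2; rewrite h2; lra.
Qed.

(** Boundedness makes finitely many levels enough: [u] lies pointwise below a chain over its level
    sets, which rearrangement replaces by the intervals in [gauss_bounded]. The number of levels
    depends on [K], the estimate does not. *)
Lemma ri_gauss_tail (b C k : R) (u : R -> R) (K : R) : 0 < b -> b < 1 ->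
  gauss_bounded b C ->
  0 < k -> measurable_fun I01 u -> (forall t, I01 t -> `|u t| <= K) ->
  (forall q, (mu (I01 `&` [set t | (k * 2 ^+ q < `|u t|)%R]) <= (b ^+ (4 ^ q))%:E)%E) ->
  nE u <= k * (1 + C).
Proof.
move=> b0 b1 hC k0 mu_ uK hu.
pose Y q := I01 `&` [set t | k * 2 ^+ q < `|u t|].
have mY q : measurable (Y q) by exact: measurable_superlevel.
have c0 q : 0 <= 2 ^+ q :> R by rewrite exprn_ge0.
have [p hp] : exists p, K <= k * 2 ^+ p.
  exists (Num.truncn (K / k)).+1.
  rewrite mulrC -ler_pdivrMr//; apply: le_trans (ltW (truncnS_gt _)) _.
  by rewrite -natrX ler_nat ltnW// ltn_expl.
have hc := ri_chain hE p c0 mY.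
have [c1 n1] := ri_carrier1 hE.
have h1 := ri_carrierD hE c1 hc.
have h2 := ri_carrierZ hE k h1.
apply: le_trans (_ : nE (k *: (cst 1 + chain_fun (fun q => 2 ^+ q) Y p)) <= _).
  apply: (ri_le hE mu_ h2 _).2 => t It.
  rewrite [leRHS]ger0_norm; last by rewrite !fctE mulr_ge0 ?addr_ge0 ?chain_fun_ge0// ltW.
  rewrite !fctE; apply: dyadic_chain_ge => //; first exact: ltW.
  exact: le_trans (uK t It) hp.
rewrite (ri_normZ hE)// gtr0_norm// ler_pM2l//.
apply: le_trans (ri_normD hE c1 hc) _; rewrite n1 lerD2l.
apply: le_trans (hC p); apply: (ri_chain_le hE) => //.
- move=> q r t qr [It /= h]; split=> //=; apply: le_lt_trans h.
  by rewrite ler_pM2l// ler_weXn2l// ler1n.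
- move=> q r t qr /=; rewrite !in_itv /= => /andP[-> /le_trans]; apply.
  by rewrite ler_wiXn2l// ?ltW// leq_pexp2l.
- move=> q _; rewrite mu_I01_itv; last by rewrite exprn_ge0 ?exprn_ile1// ltW.
  by rewrite /Y setIA setIid; exact: hu.
Qed.

(** Where two late truncations of [z] differ, [|z|] is more than twice an essential bound of an
    approximating [y], hence at most [2 * |z - y|]. Their difference inherits the Gaussian tails of
    [z - y], with a small constant, so the truncations are Cauchy in [E]. *)
Lemma closure_Linfty_sub (M : R -> R) (b C : R) : 0 < b -> b < 1 ->
  gauss_bounded b C -> exp_L2_function M -> closure_Linfty M `<=` carrier E.
Proof.
move=> b0 b1 hC hM z [[mz lz] clz].
have [L L0 hL] := exp_L2_tail hM b0.
have C0 : 0 <= C.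
  apply: le_trans (hC 0%N); apply: (ri_norm_ge0 hE); apply: (ri_chain hE) => // q.
have mI : measurable I01 by exact: measurable_I01.
pose T n := I01 `&` [set t | n%:R < `|z t|].
have mT n : measurable (T n) by exact: measurable_superlevel.
pose zn n := z \* \1_(~` T n).
have mzn n : measurable_fun I01 (zn n).
  by apply: measurable_funM => //; apply: measurable_indic; exact: measurableC.
have znb n t : I01 t -> `|zn n t| <= n%:R.
  move=> It; rewrite /zn /=; have [Tt|Tt] := pselect (T n t).
    by rewrite indic_notin ?mulr0 ?normr0//; apply.
  by rewrite indic_in// mulr1 leNgt; apply/negP => h; apply: Tt.
have hzn n : carrier E (zn n) := (ri_bounded hE (mzn n) (znb n)).1.
have cauchy (e : R) : 0 < e -> exists N, forall m n,
    (N <= m)%N -> (N <= n)%N -> nE (zn m - zn n) < e.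
  (* The final estimate is [2 * (L * l) * (1 + C)] with [l < d], which is less than [e / 2]. *)
  move=> e0; pose d := e / (4 * L * (1 + C)).
  have d0 : 0 < d by rewrite divr_gt0// !mulr_gt0// ltr_wpDr.
  have [y [[my yoo] [_ ly] zy]] := clz _ d0.
  have myz : measurable_fun I01 (z - y) by exact: measurable_funB.
  have lzy := luxemburgB_lty hM.1 mz my lz ly.
  have [l ml ld] : exists2 l : R, modular_le1 M (z - y) l & l < d.
    have l0 : (0 <= luxemburg M (z - y)%R)%E.
      by apply: le_ereal_inf_tmp => _ [l [/ltW l0 _] <-]; rewrite lee_fin.
    have : (luxemburg M (z - y)%R < d%:E)%E.
      by rewrite -(@fineK _ (luxemburg M _)) ?lte_fin// ge0_fin_numE.
    by move=> /luxemburg_lt[l h1 h2]; exists l => //; rewrite -lte_fin.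
  have tail := hL _ _ myz ml.
  have l0 := ml.1.
  have [B hB] : exists B : R, {ae mu, forall t, I01 t -> `|y t| <= B}.
    move: yoo; rewrite unlock /Lnorm.
    rewrite mu_setT_gt0.
    move=> hoo; pose S := ess_sup mu (abse \o (EFin \o (y \_ I01))).
    have S0 : S \is a fin_num.
      rewrite fin_numE -ltey hoo andbT.
      have : (0 <= S)%E.
        by apply: ess_sup_gee; [exact: mu_setT_gt0|apply: leb_ae_all => t; exact: abse_ge0].
      by case: (S).
    exists (fine S); have := @ess_sup_ge _ _ _ mu (abse \o (EFin \o (y \_ I01))).
    apply: leb_ae_mono => t /= h It; rewrite -lee_fin fineK//.
    by move: h; rewrite patchE mem_set.
  pose N := (Num.truncn (2 * B)).+1.
  have BN : 2 * B <= N%:R by exact: ltW (truncnS_gt _).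
  exists N => m n Nm Nn; pose u := zn m - zn n.
  have mu_ : measurable_fun I01 u by exact: measurable_funB.
  have uK t : I01 t -> `|u t| <= m%:R + n%:R.
    move=> It; rewrite /u !fctE; apply: le_trans (ler_normB _ _) _.
    by rewrite lerD// znb.
  have k0 : 0 < 2 * (L * l) by rewrite !mulr_gt0.
  have ule t : I01 t -> `|y t| <= B -> `|u t| <= 2 * `|(z - y) t|.
    move=> It yB; rewrite /u !fctE /zn /=.
    have [TN|TN] := pselect (T N t); last first.
      have Tk k : (N <= k)%N -> ~ T k t.
        move=> Nk [_ /= h]; apply: TN; split=> //=; apply: le_lt_trans h.
        by rewrite ler_nat.
      have Tm := Tk _ Nm; have Tn := Tk _ Nn.
      rewrite (@indic_in _ _ (~` T m))// (@indic_in _ _ (~` T n))// subrr normr0.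
      by rewrite mulr_ge0.
    have zB : 2 * B <= `|z t| by apply: le_trans BN (ltW TN.2).
    have : `|z t * \1_(~` T m) t - z t * \1_(~` T n) t| <= `|z t|.
      rewrite -mulrBr normrM ler_piMr// !indicE.
      by case: (_ \in _); case: (_ \in _);
        rewrite ?subrr ?subr0 ?sub0r ?normrN ?normr0 ?normr1.
    have := ler_distD 0 (z t) (y t); rewrite !subr0 sub0r normrN.
    have := ler_distD (y t) (z t) 0; rewrite !subr0; lra.
  apply: le_lt_trans (ri_gauss_tail b0 b1 hC k0 mu_ uK _) _.
    move=> q; apply: le_trans (tail q).
    apply: leb_le_ae; [exact: measurable_superlevel|exact: measurable_superlevel|].
    apply: leb_ae_mono hB => t h [It /= hu]; split=> //=.
    have := ule t It (h It); move: hu; rewrite -mulrA; lra.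
  have C1 : 0 < 1 + C by rewrite ltr_wpDr.
  have -> : e = 2 * (L * d) * (1 + C) * 2 by rewrite /d; field; rewrite !gt_eqF.
  have h : 2 * (L * l) * (1 + C) <= 2 * (L * d) * (1 + C).
    by rewrite ler_pM2r// ler_pM2l// ler_pM2l// ltW.
  have : 0 < 2 * (L * d) * (1 + C) by apply: mulr_gt0 => //; apply: mulr_gt0 => //; apply: mulr_gt0.
  lra.
have [w [hw wcv]] := carrier_complete (ri_banach (ri01_ri hE)) hzn cauchy.
(* Completeness only provides some limit [w]. Off [T n] all truncations from the [n]-th on equal
   [z], so [w] agrees with [z] there almost everywhere, and the sets [T n] have empty
   intersection. *)
suff zw : ae_eq_on I01 z w by have [] := ri_eq_ae hE mz hw zw.
have h n : {ae mu, forall t, I01 t -> ((w - z) \* \1_(~` T n)) t = 0}.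
  have mC : measurable (~` T n) by exact: measurableC.
  have hwz k : carrier E (w - zn k) by exact: (ri_carrierB hE).
  have hc : carrier E ((w - zn n) \* \1_(~` T n)) := (ri_restr hE mC (hwz n)).1.
  have e1 t : ((w - z) \* \1_(~` T n)) t = ((w - zn n) \* \1_(~` T n)) t.
    rewrite /zn !fctE /=; have [Tt|Tt] := pselect (T n t).
      by rewrite !(@indic_notin _ _ (~` T n)) ?mulr0//; apply.
    by rewrite !(@indic_in _ _ (~` T n))// !mulr1.
  suff h0 : nE ((w - zn n) \* \1_(~` T n)) = 0.
    by apply: leb_ae_mono (ri_norm_eq0 hE hc h0) => t ht It; rewrite e1; exact: ht.
  apply/le_anti/andP; split; last exact: (ri_norm_ge0 hE).
  apply/ler_addgt0Pr => e e0; rewrite add0r.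
  have /cvgr0Pnorm_lt/(_ _ e0)[N _ hN] := wcv.
  have := hN (maxn N n) (leq_maxl _ _) => /=.
  rewrite (ri_distC hE)// => /ltW; apply: le_trans.
  apply: le_trans (ler_norm _).
  apply: (ri_le hE (ri_measurable hE hc) (hwz _) _).2 => t It.
  rewrite /zn !fctE /=; have [Tt|Tt] := pselect (T n t).
    by rewrite !(@indic_notin _ _ (~` T n)) ?mulr0 ?normr0//; apply.
  have Tt' : ~ T (maxn N n) t.
    move=> [_ /= hT]; apply: Tt; split=> //=; apply: le_lt_trans hT.
    by rewrite ler_nat leq_maxr.
  by rewrite !(@indic_in _ _ (~` T _))// !mulr1.
apply: leb_ae_mono (ae_foralln h) => t ht It.
have /= := ht (Num.truncn `|z t|).+1 It.
rewrite !fctE (@indic_in _ _ (~` T _)) ?mulr1; last first.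
  by move=> [_ /=]; apply/negP; rewrite -leNgt ltW// truncnS_gt.
by move/eqP; rewrite subr_eq0 => /eqP.
Qed.

End Closing.

(** * The case of a fundamental function of order sqrt(d) *)

Section SqrtFundamental.
Context {R : realType}.
Variables (E : fun_space R) (hE : ri_space01 E).
Local Notation nE := (fnorm E).

Lemma ri_chain_norm_le (c : nat -> R) (Y : nat -> set R) (p : nat) :
  (forall q, 0 <= c q) -> (forall q, measurable (Y q)) ->
  nE (chain_fun c Y p) <= \sum_(q < p) c q * nE \1_(Y q).
Proof.
move=> c0 mY.
have -> : chain_fun c Y p = \sum_(q < p) c q *: \1_(Y q).
  by apply/funext => t; rewrite fct_sumE.
apply: le_trans (ri_norm_sum hE _ _) _.
  by move=> q _; apply: (ri_carrierZ hE); exact: ri_indic.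
apply: ler_sum => q _; rewrite (ri_normZ hE); last exact: ri_indic.
by rewrite ger0_norm.
Qed.

(** The base is written as a square so that the square root of its power is [4^-1 ^+ (4 ^ q)], which
    is at most [4^-1 ^+ q]. Against the weight [2 ^+ q] this leaves [2^-1 ^+ q], with sum at most
    2. *)
Lemma sqrt_fundamental_gauss_bounded (K : R) :
  (forall d : R, 0 < d <= 1 -> fundamental E d <= K * Num.sqrt d) ->
  gauss_bounded E (4^-1 ^+ 2) (2 * K).
Proof.
move=> hK p.
have K0 : 0 <= K.
  have := hK 1; rewrite ltr01 lexx sqrtr1 mulr1 => /(_ isT).
  exact: le_trans (fundamental_ge0 hE 1).
apply: le_trans (ri_chain_norm_le p _ _) _.
- by move=> q; rewrite exprn_ge0.
- by move=> q; exact: measurable_itv.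
apply: (@le_trans _ _ (\sum_(q < p) K * 2^-1 ^+ q)).
  apply: ler_sum => q _.
  have h4 : 0 <= (4 : R)^-1 <= 1 by rewrite invr_ge0 ler0n /= invf_le1 ?ler1n.
  case/andP: h4 => h40 h41.
  have := hK ((4^-1 ^+ 2) ^+ (4 ^ q)).
  rewrite !exprn_gt0 ?invr_gt0//= exprAC sqrtr_sqr ger0_norm ?exprn_ge0// => h.
  apply: le_trans (ler_wpM2l (exprn_ge0 _ _) (h _)) _ => //.
    by rewrite exprn_ile1 ?exprn_ge0// exprn_ile1.
  rewrite mulrCA ler_wpM2l//.
  apply: (@le_trans _ _ (2 ^+ q * 4^-1 ^+ q)).
    rewrite ler_wpM2l ?exprn_ge0// ler_wiXn2l//.
    by rewrite ltnW// ltn_expl.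
  rewrite -exprMn (_ : 2 * 4^-1 = 2^-1 :> R)//; lra.
rewrite -big_distrr /= mulrC ler_wpM2r//.
have h2 : (1 - 2^-1) * \sum_(q < p) 2^-1 ^+ q = 1 - 2^-1 ^+ p :> R.
  by rewrite -opprB mulNr -subrX1 opprB.
have : 0 <= 2^-1 ^+ p :> R by rewrite exprn_ge0// invr_ge0.
lra.
Qed.

End SqrtFundamental.

(** * Tails of sums of signs *)

Section SignWalk.
Context {R : realType}.
Implicit Types (F G : R -> R) (s t x y z : R).

(* [walk_mean n F x] is the expectation of [F (x + e_1 + ... + e_n)] for
   independent uniform signs [e_i]. *)
Fixpoint walk_mean (n : nat) F : R -> R :=
  if n is m.+1 then
    fun x => (walk_mean m F (x + 1) + walk_mean m F (x - 1)) / 2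
  else F.

Lemma walk_mean_le n F G x : (forall y, F y <= G y) ->
  walk_mean n F x <= walk_mean n G x.
Proof.
move=> FG; elim: n x => [|n IH] x //=.
by rewrite ler_pM2r ?invr_gt0// lerD.
Qed.

Lemma walk_meanD n F G x :
  walk_mean n (fun y => F y + G y) x = walk_mean n F x + walk_mean n G x.
Proof. by elim: n x => [|n IH] x //=; rewrite !IH; lra. Qed.

Lemma walk_meanZ n (a : R) F x :
  walk_mean n (fun y => a * F y) x = a * walk_mean n F x.
Proof. by elim: n x => [|n IH] x //=; rewrite !IH; lra. Qed.

Lemma walk_mean_cst n (a : R) x : walk_mean n (fun=> a) x = a.
Proof. by elim: n x => [|n IH] x //=; rewrite !IH; lra. Qed.

Lemma walk_mean_translate n F x y :
  walk_mean n (fun z => F (z + y)) x = walk_mean n F (x + y).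
Proof.
elim: n x => [|n IH] x //=.
by rewrite !IH; congr ((walk_mean n F _ + walk_mean n F _) / 2); ring.
Qed.

Lemma walk_mean_opp n F x : walk_mean n (fun z => F (- z)) x = walk_mean n F (- x).
Proof.
elim: n x => [|n IH] x //=.
by rewrite !IH addrC; congr ((walk_mean n F _ + walk_mean n F _) / 2); ring.
Qed.

Lemma walk_mean2 n x : walk_mean n (fun y => y ^+ 2) x = x ^+ 2 + n%:R.
Proof. by elim: n x => [|n IH] x /=; [rewrite addr0|rewrite !IH -natr1; field]. Qed.

Lemma walk_mean4 n x : walk_mean n (fun y => y ^+ 4) x =
  x ^+ 4 + 6 * n%:R * x ^+ 2 + 3 * n%:R ^+ 2 - 2 * n%:R.
Proof. by elim: n x => [|n IH] x /=; [ring|rewrite !IH -natr1; field]. Qed.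

Definition walk_tail (n : nat) s x : R := walk_mean n (fun y => (s <= y)%R%:R) x.

Lemma walk_tail_ge0 n s x : 0 <= walk_tail n s x.
Proof. by rewrite -(walk_mean_cst n 0 x); apply: walk_mean_le => y; rewrite ler0n. Qed.

(** A walk of length [n + m] is the sum of two independent walks, and it reaches [s + t] as soon as
    they reach [s] and [t]. *)
Lemma walk_tail_super n m s t y z :
  walk_tail n s y * walk_tail m t z <= walk_tail (n + m) (s + t) (y + z).
Proof.
elim: m z => [|m IH] z.
  rewrite addn0 /walk_tail /=; have [tz|tz] := leP t z; last first.
    by rewrite mulr0; exact: walk_tail_ge0.
  rewrite mulr1 -walk_mean_translate; apply: walk_mean_le => w.
  by rewrite ler_nat; case: (leP s w) => // sw; rewrite lerD.
rewrite addnS; rewrite /walk_tail /= -/(walk_tail _ _ _) in IH *.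
have h1 := IH (z + 1); have h2 := IH (z - 1); rewrite !addrA in h1 h2.
rewrite mulrA ler_pM2r ?invr_gt0// mulrDr; exact: lerD.
Qed.

Lemma walk_tail_pow n k s : walk_tail n s 0 ^+ k <= walk_tail (k * n) (k%:R * s) 0.
Proof.
elim: k => [|k IH]; first by rewrite mul0n mul0r expr0 /walk_tail /= lexx.
rewrite mulSn exprS -nat1r mulrDl mul1r.
have := walk_tail_super n (k * n) s (k%:R * s) 0 0.
rewrite addr0 => /(le_trans _); apply.
by rewrite ler_wpM2l// walk_tail_ge0.
Qed.

(* Paley-Zygmund, from the second and fourth moments. *)
Lemma walk_tail_sqrt n r : (0 < n)%N -> 0 <= r -> 4 * r ^+ 2 = n%:R ->
  12^-1 <= walk_tail n r 0.
Proof.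
move=> n0 r0 hr; have n0' : 1 <= n%:R :> R by rewrite ler1n.
pose T x : R := (r <= x)%R%:R.
(* Where [|x|] is below [r], the first term suffices; elsewhere this is the inequality of arithmetic
   and geometric means. As the fourth moment is at most $3n^2$, taking means gives $n \le n/4 + n/4
   + 6nP$ for the tail $P$, whence 1/12. *)
have key x : x ^+ 2 <= n%:R / 4 + ((12 * n%:R)^-1 * x ^+ 4 +
    (3 * n%:R * T x + 3 * n%:R * T (- x))).
  have h4 : 0 <= (12 * n%:R)^-1 * x ^+ 4.
    have -> : x ^+ 4 = (x ^+ 2) ^+ 2 by rewrite -exprM.
    by rewrite mulr_ge0 ?sqr_ge0// invr_ge0 mulr_ge0.
  have hT y : 0 <= 3 * n%:R * T y by rewrite !mulr_ge0// ler0n.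
  have [h|h] := ltP `|x| r.
    have : `|x| ^+ 2 <= r ^+ 2 by rewrite lerXn2r ?nnegrE// ltW.
    rewrite real_normK ?num_real// => h5.
    have := hT x; have := hT (- x); lra.
  have hh : 1 <= T x + T (- x).
    rewrite /T; have [h1|h1] := leP r x; first by rewrite lerDl ler0n.
    by move: h; rewrite ler_normr leNgt h1 /= => ->; rewrite add0r.
  have amgm : x ^+ 2 <= (12 * n%:R)^-1 * x ^+ 4 + 3 * n%:R.
    have n12 : 0 < 12 * n%:R :> R by rewrite mulr_gt0// ltr0n.
    rewrite -(ler_pM2l n12) mulrDr mulVKf ?gt_eqF// -subr_ge0.
    have -> : x ^+ 4 + 12 * n%:R * (3 * n%:R) - 12 * n%:R * x ^+ 2 =
      (x ^+ 2 - 6 * n%:R) ^+ 2 by ring.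
    exact: sqr_ge0.
  have : 3 * n%:R * 1 <= 3 * n%:R * (T x + T (- x)) by rewrite ler_wpM2l.
  have : 0 <= n%:R / 4 :> R by rewrite divr_ge0.
  lra.
have := walk_mean_le n 0 key.
rewrite walk_mean2 !walk_meanD walk_mean_cst !walk_meanZ walk_mean4.
rewrite walk_mean_opp oppr0 -/(walk_tail n r 0) expr0n /= add0r.
rewrite !expr0n /= mulr0 !add0r => h.
have e1 : (12 * n%:R)^-1 * (3 * n%:R ^+ 2 - 2 * n%:R) <= n%:R / 4 :> R.
  rewrite ler_pdivrMl; last by rewrite mulr_gt0// ltr0n.
  have -> : 12 * n%:R * (n%:R / 4) = 3 * n%:R ^+ 2 :> R by field.
  lra.
rewrite -(ler_pM2l (_ : 0 < 6 * n%:R)); last by rewrite mulr_gt0// ltr0n.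
lra.
Qed.

(** The walk is cut into [4 ^ q] walks of [4 ^ (p - q)] steps, each of which reaches half the square
    root of its length with probability at least 1/12. This is the origin of the base [12^-1]. *)
Lemma walk_tail_gauss p q : (q <= p)%N ->
  12^-1 ^+ (4 ^ q) <= walk_tail (4 ^ p) (2 ^+ q * 2 ^+ p / 2) 0.
Proof.
move=> qp; pose L := (4 ^ (p - q))%N.
have h : 12^-1 <= walk_tail L (2 ^+ (p - q) / 2) 0.
  apply: walk_tail_sqrt; rewrite ?expn_gt0 ?divr_ge0 ?exprn_ge0//.
  rewrite exprMn -exprM mulnC exprM natrX.
  have -> : (2 ^+ 2 : R) = 4 by rewrite expr2 -natrM.
  by rewrite exprVn expr2 -natrM mulrC divfK.
have -> : (4 ^ p = 4 ^ q * L)%N by rewrite -expnD subnKC.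
have -> : 2 ^+ q * 2 ^+ p / 2 = (4 ^ q)%:R * (2 ^+ (p - q) / 2) :> R.
  rewrite mulrA; congr (_ / 2); rewrite -{1}(subnKC qp) exprD mulrA; congr (_ * _).
  by rewrite natrX -exprMn -natrM.
apply: le_trans (walk_tail_pow _ _ _).
by rewrite lerXn2r// nnegrE ?walk_tail_ge0// invr_ge0.
Qed.

End SignWalk.

(** * Independent signs correlated with a sequence bounded below in L^1 *)

Section BalancedSigns.
Context {R : realType}.

(** [true] stands for -1, so that exclusive or becomes multiplication of signs. *)
Definition sg (b : bool) : R := (-1) ^+ b.

Lemma top_subset (T : finType) (w : T -> R) (k : nat) : (k <= #|T|)%N ->
  exists H : {set T}, #|H| = k /\
    forall i j, i \in H -> j \notin H -> w j <= w i.
Proof.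
elim: k => [|k IH] kT; first by exists finset.set0; rewrite cards0; split=> // i j; rewrite inE.
have [H [cH hH]] := IH (ltnW kT).
have [i0 i0H] : exists i0, i0 \notin H.
  apply/existsP; rewrite -negb_forall; apply: contraTN kT => /forallP h.
  rewrite -leqNgt -cH; apply: subset_leq_card; apply/fintype.subsetP => i _.
  exact: h.
have [i1 i1H max1] := Order.TotalTheory.arg_maxP (P := [pred i | i \notin H]) w i0H.
have i1H' : i1 \notin H := i1H.
exists (i1 |: H)%SET; split; first by rewrite cardsU1 i1H' cH.
move=> i j; rewrite !inE => /orP[/eqP->|iH]; rewrite negb_or => /andP[_ jH].
  exact: max1.
exact: hH.
Qed.

(* Take the sign [+1] on the larger half: after subtracting a median [c], all
   the terms [sg * (w - c)] are nonnegative. *)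
Lemma balanced_signs (m : nat) (w : nat -> R) : exists rho : nat -> bool,
  (\sum_(i < m * 2) rho i)%N = m /\
  (\sum_(i < m * 2) `|w i| - `|\sum_(i < m * 2) w i|) / 2 <=
    \sum_(i < m * 2) sg (rho i) * w i.
Proof.
have [->|m0] := posnP m.
  by exists (fun=> false); rewrite mul0n !big_ord0 normr0 subr0 mul0r.
have mm : (m <= #|'I_(m * 2)|)%N by rewrite card_ord leq_pmulr.
have [H [cH hH]] := top_subset (fun i : 'I_(m * 2) => w i) mm.
have [i0 i0H] : exists i0, i0 \in H by apply/set0Pn; rewrite -card_gt0 cH.
have [i1 i1H min1] := Order.TotalTheory.arg_minP
  (P := [pred i | i \in H]) (fun i : 'I_(m * 2) => w i) i0H.
pose c := w i1.
pose rho i := if insub i is Some j then (j : 'I_(m * 2)) \notin H else false.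
have rhoE (i : 'I_(m * 2)) : rho i = (i \notin H) by rewrite /rho valK.
have srho : (\sum_(i < m * 2) rho i)%N = m.
  under eq_bigr do rewrite rhoE.
  rewrite -big_mkcond /= sum1_card.
  have := cardC H; rewrite card_ord cH => h.
  transitivity #|[predC H]|; last by lia.
  by apply: eq_card => i; rewrite !inE.
exists rho; split=> //.
have sbal : \sum_(i < m * 2) sg (rho i) = 0.
  have e (b : bool) : sg b = 1 - 2 * b%:R by case: b; rewrite /sg ?expr1 ?expr0 /=; lra.
  under eq_bigr do rewrite e.
  rewrite sumrB sumr_const card_ord -big_distrr /= -natr_sum srho natrM; lra.
have key : \sum_(i < m * 2) sg (rho i) * w i = \sum_(i < m * 2) `|w i - c|.
  transitivity (\sum_(i < m * 2) sg (rho i) * (w i - c)).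
    under [RHS]eq_bigr do rewrite mulrBr.
    by rewrite sumrB -big_distrl /= sbal mul0r subr0.
  apply: eq_bigr => i _; rewrite rhoE; have [iH|iH] := boolP (i \in H).
    by rewrite /sg expr0 mul1r ger0_norm// subr_ge0; exact: min1.
  by rewrite /sg expr1 mulN1r ler0_norm// subr_le0; exact: hH.
rewrite key.
set S := \sum_(i < _) `|w i - c|.
have cst_sum (a : R) : \sum_(i < m * 2) a = (m * 2)%:R * a.
  by rewrite sumr_const card_ord mulr_natl.
(* The median is eliminated: its contribution is at most [S] plus the modulus of the sum of the
   [w i], by [h2], and inserting this bound makes [S] appear twice. *)
have h1 : \sum_(i < m * 2) `|w i| <= S + (m * 2)%:R * `|c|.
  rewrite -cst_sum -big_split /=; apply: ler_sum => i _.
  by rewrite -{1}(subrK c (w i)) ler_normD.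
have h2 : (m * 2)%:R * `|c| <= S + `|\sum_(i < m * 2) w i|.
  rewrite -[X in X * _](ger0_norm (ler0n R _)) -normrM -cst_sum.
  have -> : \sum_(i < m * 2) c = \sum_(i < m * 2) w i - \sum_(i < m * 2) (w i - c).
    by rewrite -sumrB; apply: eq_bigr => i _; ring.
  apply: le_trans (ler_normB _ _) _; rewrite addrC lerD2r.
  exact: ler_norm_sum.
lra.
Qed.

End BalancedSigns.

Section BlockSums.
Context {R : realType}.

Lemma big_ord_mul (V : nmodType) (L d : nat) (G : nat -> V) :
  \sum_(i < L * d) G i = \sum_(j < L) \sum_(k < d) G (j * d + k)%N.
Proof.
elim: L => [|L IH]; first by rewrite mul0n !big_ord0.
rewrite big_ord_recr /= -IH mulSn addnC -(big_mkord xpredT G).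
rewrite -(big_mkord xpredT G) (big_cat_nat (n := (L * d)%N))//= ?leq_addr//.
congr (_ + _); rewrite -{1}[(L * d)%N]add0n big_addn addnC addnK big_mkord.
by apply: eq_bigr => k _; rewrite addnC.
Qed.

Lemma smean_refine (L d : nat) (f : nat -> R) : (0 < d)%N ->
  smean (L * d) (fun i => f (i %/ d)%N) = smean L f.
Proof.
move=> d0; have d0' : d%:R != 0 :> R by rewrite pnatr_eq0 -lt0n.
rewrite /smean (@big_ord_mul _ L d (fun i => f (i %/ d)%N)) natrM invfM -mulrA; congr (_ * _).
have -> : \sum_(j < L) \sum_(k < d) f ((j * d + k) %/ d)%N =
    \sum_(j < L) d%:R * f j.
  apply: eq_bigr => j _; rewrite (eq_bigr (fun=> f j)) => [|k _].
    by rewrite sumr_const card_ord mulr_natl.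
  by rewrite divnMDl// divn_small ?addn0.
by rewrite -big_distrr mulKf.
Qed.

Lemma stepf_refine (D d : nat) (v : nat -> R) (t : R) : (0 < D)%N -> (0 < d)%N ->
  0 <= t -> stepf D v t = stepf (D * d) (fun i => v (i %/ d)%N) t.
Proof.
move=> D0 d0 t0; rewrite /stepf; congr (v _).
have d0' : 0 < d%:R :> R by rewrite ltr0n.
have t0' : 0 <= (D * d)%:R * t by rewrite mulr_ge0.
apply: truncn_def; have /andP[h1 h2] := truncn_itv t0'.
set m := Num.truncn _ in h1 h2 *.
have e : (D * d)%:R * t = (D%:R * t) * d%:R by rewrite natrM; ring.
rewrite e in h1 h2.
apply/andP; split.
  rewrite -(ler_pM2r d0') -natrM; apply: le_trans h1; rewrite ler_nat.
  exact: leq_trunc_div.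
rewrite -(ltr_pM2r d0') -natrM; apply: lt_le_trans h2 _; rewrite ler_nat.
exact: ltn_ceil.
Qed.

End BlockSums.

(** * Integrals of a sequence over fixed intervals *)

Section SmallBlocks.
Context {R : realType}.
Variables (E : fun_space R) (hE : ri_space01 E).
Local Notation I01 := (`[0, 1]%classic : set R).
Local Notation nE := (fnorm E).
Variables (D : nat -> nat) (v : nat -> nat -> R) (C1 : R).
Hypothesis D0 : forall k, (0 < D k)%N.

Definition upper_l2 := forall (n : nat) (K : nat -> nat) (a : nat -> R),
  (forall i j, (i < j < n)%N -> (K i < K j)%N) ->
  nE (\sum_(j < n) a j *: stepf (D (K j)) (v (K j))) <=
    C1 * Num.sqrt (\sum_(j < n) a j ^+ 2).

Hypothesis hup : upper_l2.

(* The integral of the [k]-th step function over [[j / N, (j + 1) / N]], computed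
   on a grid with an even number of points in that interval. *)
Definition block_int (k N j : nat) : R :=
  (N * (D k * 2))%:R^-1 *
  \sum_(i < D k * 2) v k ((j * (D k * 2) + i) %/ (N * 2))%N.

Lemma block_int_refine (k N j e : nat) : (0 < N)%N -> (0 < e)%N ->
  block_int k N j = (N * (D k * 2 * e))%:R^-1 *
  \sum_(i < D k * 2 * e) v k ((j * (D k * 2 * e) + i) %/ (N * 2 * e))%N.
Proof.
move=> N0 e0; have e0' : e%:R != 0 :> R by rewrite pnatr_eq0 -lt0n.
have -> : (N * (D k * 2 * e) = N * (D k * 2) * e)%N by rewrite mulnA.
rewrite /block_int (natrM _ (N * (D k * 2))) invfM -mulrA; congr (_ * _).
have -> : \sum_(i < D k * 2 * e) v k ((j * (D k * 2 * e) + i) %/ (N * 2 * e))%N =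
   \sum_(a < D k * 2) e%:R * v k ((j * (D k * 2) + a) %/ (N * 2))%N.
  rewrite (@big_ord_mul _ (D k * 2) e
    (fun i => v k ((j * (D k * 2 * e) + i) %/ (N * 2 * e))%N)).
  apply: eq_bigr => a _.
  rewrite (eq_bigr (fun=> v k ((j * (D k * 2) + a) %/ (N * 2))%N)) => [|c _].
    by rewrite sumr_const card_ord mulr_natl.
  rewrite (mulnC (N * 2)%N) divnMA; congr (v k (_ %/ _)%N).
  by rewrite mulnA addnA -mulnDl divnMDl// divn_small ?addn0.
by rewrite -big_distrr mulKf.
Qed.

(** The sum is the integral over one interval of a combination of the step functions, so it is
    bounded by the L^1-norm of the combination, then by its norm in [E]. The product [P] of the
    [D k] gives a common grid. *)
Lemma block_int_functional (N j n : nat) (b : nat -> R) : (j < N)%N ->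
  `|\sum_(k < n) b k * block_int k N j| <= C1 * Num.sqrt (\sum_(k < n) b k ^+ 2).
Proof.
move=> jN; have N0 : (0 < N)%N by apply: leq_ltn_trans jN.
pose P := (\prod_(k < n) D k)%N.
have P0 : (0 < P)%N by apply: prodn_gt0 => k; exact: D0.
have Pk (k : 'I_n) : (P = D k * (P %/ D k))%N.
  by rewrite mulnC divnK// /P (bigD1 k)//= dvdn_mulr.
have ek (k : 'I_n) : (0 < P %/ D k)%N.
  by rewrite divn_gt0// dvdn_leq// (Pk k) dvdn_mulr.
pose W i : R := \sum_(k < n) b k * v k (i %/ (N * 2 * (P %/ D k)))%N.
have L0 : (0 < N * (P * 2))%N by rewrite !muln_gt0 N0 P0.
have e1 : \sum_(k < n) b k * block_int k N j =
    (N * (P * 2))%:R^-1 * \sum_(i < P * 2) W (j * (P * 2) + i)%N.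
  rewrite /W exchange_big big_distrr /=; apply: eq_bigr => k _.
  rewrite (block_int_refine _ _ N0 (ek k)) -big_distrr /= mulrCA.
  by rewrite mulnAC -Pk.
rewrite e1 normrM ger0_norm ?invr_ge0//.
apply: (@le_trans _ _ (smean (N * (P * 2)) (fun i => `|W i|))).
  rewrite /smean ler_pM2l ?invr_gt0 ?ltr0n//.
  apply: le_trans (ler_norm_sum _ _ _) _.
  rewrite (@big_ord_mul _ N (P * 2) (fun i => `|W i|)) (bigD1 (Ordinal jN))//=.
  by rewrite lerDl; apply: sumr_ge0 => a _; apply: sumr_ge0.
apply: le_trans (ri_smean_le hE W L0) _.
have := hup (n := n) (K := id) b (fun i j h => proj1 (andP h)).
congr (_ <= _); symmetry; apply: (ri_eqfun hE _ _).2.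
  apply: (ri_carrier_sum hE) => k _; apply: (ri_carrierZ hE); exact: ri_stepf.
move=> t; rewrite /= in_itv /= => /andP[t0 _].
rewrite fct_sumE /stepf /W; apply: eq_bigr => k _; congr (_ * _).
have := @stepf_refine _ (D k) (N * 2 * (P %/ D k)) (v k) t (D0 k) _ t0.
rewrite /stepf => -> //; last by rewrite !muln_gt0 N0 ek.
congr (v k (Num.truncn (_%:R * t) %/ _)%N).
rewrite {1}(Pk k); lia.
Qed.

(** Testing the functional on its own coefficients bounds the sum of squares by [C1] times its
    square root. *)
Lemma block_int_sqr (N j n : nat) : (j < N)%N -> 0 <= C1 ->
  \sum_(k < n) block_int k N j ^+ 2 <= C1 ^+ 2.
Proof.
move=> jN C10; have := block_int_functional n (fun k => block_int k N j) jN => /=.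
under eq_bigr do rewrite -expr2.
set s := \sum_(k < n) block_int k N j ^+ 2.
have s0 : 0 <= s by apply: sumr_ge0 => k _; exact: sqr_ge0.
rewrite ger0_norm// => h; have ss := sqr_sqrtr s0.
have [r0|r0] := leP (Num.sqrt s) 0.
  have e0 : Num.sqrt s = 0 by apply/le_anti; rewrite r0 sqrtr_ge0.
  by rewrite -ss e0 expr0n /= sqr_ge0.
have hC : Num.sqrt s <= C1 by rewrite -(ler_pM2r r0) -expr2 ss.
by rewrite -ss lerXn2r// nnegrE ltW.
Qed.

(** Otherwise every index from [B] on contributes at least [eta ^+ 2] to a double sum that square
    summability on each of the [N] intervals bounds by [N * C1 ^+ 2]. *)
Lemma block_int_small (N B : nat) (eta : R) : 0 <= C1 -> 0 < eta ->
  exists2 k, (B <= k)%N & forall j, (j < N)%N -> `|block_int k N j| <= eta.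
Proof.
move=> C10 eta0; apply/not_exists2P => h.
have {}h k : (B <= k)%N -> eta ^+ 2 <= \sum_(j < N) block_int k N j ^+ 2.
  move=> Bk; have [|/existsNP[j /not_implyP[jN /negP]]] := h k; first by [].
  rewrite -ltNge => hj; rewrite (bigD1 (Ordinal jN))//=.
  apply: (@le_trans _ _ (block_int k N j ^+ 2)).
    rewrite -[leRHS]real_normK ?num_real//; apply: lerXn2r; last exact: ltW.
      by rewrite nnegrE ltW.
    by rewrite nnegrE.
  by rewrite lerDl; apply: sumr_ge0 => i _; exact: sqr_ge0.
pose m := (Num.truncn (N%:R * C1 ^+ 2 / eta ^+ 2)).+1.
have e2 : 0 < eta ^+ 2 by rewrite exprn_gt0.
have hm : N%:R * C1 ^+ 2 < m%:R * eta ^+ 2.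
  by rewrite -ltr_pdivrMr//; exact: truncnS_gt.
have h1 : \sum_(k < B + m) \sum_(j < N) block_int k N j ^+ 2 <= N%:R * C1 ^+ 2.
  rewrite exchange_big /=; apply: le_trans (ler_sum _ (fun j _ => block_int_sqr _ (ltn_ord j) C10)) _.
  by rewrite sumr_const card_ord mulr_natl.
have h2 : m%:R * eta ^+ 2 <= \sum_(k < B + m) \sum_(j < N) block_int k N j ^+ 2.
  rewrite big_split_ord /=; apply: (@le_trans _ _ (\sum_(k < m) eta ^+ 2)).
    by rewrite sumr_const card_ord mulr_natl.
  rewrite -[leLHS]add0r lerD//.
    by apply: sumr_ge0 => i _; apply: sumr_ge0 => j _; exact: sqr_ge0.
  by apply: ler_sum => i _; apply: h; rewrite leq_addr.
by have := le_lt_trans (le_trans h2 h1) hm; rewrite ltxx.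
Qed.

End SmallBlocks.

(** * Inductive construction of the signs *)

Section SignSelection.
Context {R : realType}.
Variables (E : fun_space R) (hE : ri_space01 E).
Variables (D : nat -> nat) (v : nat -> nat -> R) (C1 c0 : R).
Hypothesis D0 : forall k, (0 < D k)%N.
Hypothesis hup : upper_l2 E D v C1.
Hypothesis C10 : 0 <= C1.
Hypothesis c00 : 0 < c0.
Hypothesis hc0 : forall k, c0 <= smean (D k) (fun i => `|v k i|).

Lemma balanced_sum (m : nat) (r : nat -> bool) (G : bool -> R) :
  (\sum_(i < m * 2) r i)%N = m ->
  \sum_(b < m * 2) G (r b) = m%:R * (G true + G false).
Proof.
move=> hr; have e (b : bool) : G b = G false + b%:R * (G true - G false).
  by case: b; rewrite /=; ring.
under eq_bigr do rewrite e.
rewrite big_split /= sumr_const card_ord -big_distrl /= -natr_sum hr.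
by rewrite -[G false *+ _]mulr_natl natrM; ring.
Qed.

(** A sign that is balanced on every block behaves as a fair coin independent of all that is
    constant on the blocks. *)
Lemma balanced_blocks (L m : nat) (r : nat -> nat -> bool) (G : nat -> bool -> R) :
  (0 < m)%N -> (forall j, (\sum_(i < m * 2) r j i)%N = m) ->
  \sum_(i < L * (m * 2)) G (i %/ (m * 2))%N (r (i %/ (m * 2))%N (i %% (m * 2))%N) =
  m%:R * \sum_(j < L) (G j true + G j false).
Proof.
move=> m0 hr; have m20 : (0 < m * 2)%N by rewrite muln_gt0 m0.
rewrite (@big_ord_mul _ L (m * 2)
  (fun i => G (i %/ (m * 2))%N (r (i %/ (m * 2))%N (i %% (m * 2))%N))).
rewrite big_distrr /=; apply: eq_bigr => j _.
rewrite -(@balanced_sum m (r j) (G j))//; apply: eq_bigr => b _.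
by rewrite divnMDl// modnMDl divn_small// modn_small// addn0.
Qed.

(** Cell [i] of the common grid lies in cell [i %/ d j] of the grid of the selected term [K j].
    [ss_fibre] expresses independence: each sign pattern fills the same number of cells. [ss_law]
    has a starting point [x] because the recursion of [walk_mean] moves it. *)
Record sign_system (n L : nat) (K d : nat -> nat) (rho : nat -> nat -> bool) : Prop := {
  ss_pos : (0 < L)%N ;
  ss_level : forall j, (j < n)%N -> (0 < d j)%N /\ L = (D (K j) * d j)%N ;
  ss_incr : forall i j, (i < j < n)%N -> (K i < K j)%N ;
  ss_corr : forall j, (j < n)%N ->
    c0 / 4 <= smean L (fun i => sg (rho j i) * v (K j) (i %/ d j)%N) ;
  ss_fibre : forall om : nat -> bool,
    \sum_(i < L) [forall j : 'I_n, rho j i == om j]%:R * 2 ^+ n = L%:R :> R ;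
  ss_law : forall (F : R -> R) x,
    L%:R^-1 * \sum_(i < L) F (x + \sum_(j < n) sg (rho j i)) = walk_mean n F x }.

(* A later term has small integral on each of the [L] intervals of the current
   partition, hence correlates with signs that are balanced on each of them and
   therefore independent of the previous ones. *)
Lemma sign_system_exists (n : nat) : exists L K d rho, sign_system n L K d rho.
Proof.
elim: n => [|n [L [K [d [rho [L0 lvl incr corr fibre law]]]]]].
  exists 1%N, (fun=> 0%N), (fun=> 0%N), (fun _ _ => false); split=> //.
  - by move=> i j; rewrite ltn0 andbF.
  - move=> om; rewrite big_ord1 expr0 mulr1.
    by have -> : [forall j : 'I_0, false == om j] by apply/forallP => -[].
  - by move=> F x; rewrite big_ord1 big_ord0 addr0 invr1 mul1r.
have L0' : 0 < L%:R :> R by rewrite ltr0n.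
pose B := (\sum_(j < n) (K j).+1)%N.
have KB j : (j < n)%N -> (K j < B)%N.
  by move=> jn; rewrite /B (bigD1 (Ordinal jn))//= leq_addr.
(* The [L] block integrals then have moduli adding up to at most [c0 / 2], and balanced signs keep a
   correlation of at least [(c0 - c0 / 2) / 2], which is [c0 / 4]. *)
have eta0 : 0 < c0 / (2 * L%:R) by rewrite divr_gt0// mulr_gt0.
have [k Bk small] := block_int_small hE D0 hup L B C10 eta0.
pose m := D k; have m0 : (0 < m)%N by exact: D0.
have m20 : (0 < m * 2)%N by rewrite muln_gt0 m0.
have m0' : 0 < m%:R :> R by rewrite ltr0n.
have hr j := balanced_signs m (fun i => v k ((j * (m * 2) + i) %/ (L * 2))%N).
have /choice[r {}hr] := hr.
have rbal j : (\sum_(i < m * 2) r j i)%N = m by have [] := hr j.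
(* Old signs are pulled back to the refined grid, the new one is chosen block by block. Each old
   cell is cut into [m * 2] cells: an even number, so that signs can balance, and a multiple of
   [D k], so that the grid of the new term is refined too. *)
pose rho' j i := if (j < n)%N then rho j (i %/ (m * 2))%N
                 else r (i %/ (m * 2))%N (i %% (m * 2))%N.
have rho'lt (j : 'I_n) i : rho' j i = rho j (i %/ (m * 2))%N by rewrite /rho' ltn_ord.
have rho'n i : rho' n i = r (i %/ (m * 2))%N (i %% (m * 2))%N by rewrite /rho' ltnn.
exists (L * (m * 2))%N, (fun j => if (j < n)%N then K j else k),
  (fun j => if (j < n)%N then (d j * (m * 2))%N else (L * 2)%N), rho'; split.
- by rewrite muln_gt0 L0.
- move=> j _; case: ifP => [jn|_].
    have [d0 eL] := lvl j jn; split; first by rewrite muln_gt0 d0 m20.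
    by rewrite [in LHS]eL -!mulnA.
  by rewrite muln_gt0 L0 /m; split=> //; lia.
- move=> i j /andP[ij]; rewrite ltnS leq_eqVlt => /orP[/eqP jn|jn].
    by rewrite jn ltnn -jn ij; apply: leq_trans Bk; apply: KB; rewrite -jn.
  by rewrite jn (ltn_trans ij jn); apply: incr; rewrite ij.
- move=> j; rewrite ltnS leq_eqVlt => /orP[/eqP ->|jn].
    rewrite ltnn.
    have h1 : smean (L * (m * 2)) (fun i => `|v k (i %/ (L * 2))%N|) =
        smean (D k) (fun i => `|v k i|).
      rewrite -(@smean_refine _ (D k) (L * 2) (fun i => `|v k i|)) ?muln_gt0 ?L0//.
      by congr (smean _ _); rewrite /m; lia.
    have h2 : smean (L * (m * 2)) (fun i => `|v k (i %/ (L * 2))%N|) / 2 -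
        (\sum_(j < L) `|block_int D v k L j|) / 2 <=
        smean (L * (m * 2)) (fun i => sg (rho' n i) * v k (i %/ (L * 2))%N).
      rewrite /smean (@big_ord_mul _ L (m * 2) (fun i => `|v k (i %/ (L * 2))%N|)).
      rewrite (@big_ord_mul _ L (m * 2) (fun i => sg (rho' n i) * v k (i %/ (L * 2))%N)).
      rewrite !big_distrr -mulrBl /= -sumrB big_distrl /=.
      apply: ler_sum => a _; rewrite /block_int normrM ger0_norm ?invr_ge0//.
      rewrite -mulrBr -mulrA ler_pM2l; last by rewrite invr_gt0 ltr0n muln_gt0 L0.
      apply: le_trans (hr a).2 _; rewrite le_eqVlt; apply/orP; left; apply/eqP.
      apply: eq_bigr => b _; rewrite rho'n.
      by rewrite divnMDl// modnMDl (divn_small (ltn_ord b)) (modn_small (ltn_ord b)) addn0.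
    have h3 : \sum_(j < L) `|block_int D v k L j| <= c0 / 2.
      apply: (@le_trans _ _ (\sum_(j < L) c0 / (2 * L%:R))).
        by apply: ler_sum => a _; exact: small.
      rewrite sumr_const card_ord -mulr_natl le_eqVlt; apply/orP; left; apply/eqP.
      by field; rewrite gt_eqF.
    have := hc0 k; rewrite h1 in h2; lra.
  rewrite jn; apply: le_trans (corr j jn) _; rewrite -(smean_refine _ _ m20).
  rewrite le_eqVlt; apply/orP; left; apply/eqP; congr (_ * _).
  apply: eq_bigr => i _; rewrite /rho' jn; congr (_ * v _ _).
  by rewrite (mulnC (d j)) -divnMA.
- move=> om; have := fibre om; rewrite -!big_distrl /= => hf.
  have e (i : 'I_(L * (m * 2))) : [forall j : 'I_n.+1, rho' j i == om j] =
      [forall j : 'I_n, rho j (i %/ (m * 2))%N == om j] &&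
      (r (i %/ (m * 2))%N (i %% (m * 2))%N == om n).
    apply/forallP/andP => [h|[/forallP h1 h2] j].
      split; last by have := h ord_max; rewrite /= rho'n.
      apply/forallP => j; have := h (widen_ord (leqnSn n) j).
      by rewrite /= rho'lt.
    have [jn|jn] := ltnP j n; first by have := h1 (Ordinal jn); rewrite -rho'lt.
    have -> : j = n :> nat by apply/eqP; rewrite eqn_leq jn -ltnS ltn_ord.
    by rewrite rho'n.
  under eq_bigr do rewrite e.
  have := @balanced_blocks L m r (fun a b => ([forall j : 'I_n, rho j a == om j] && (b == om n))%:R) m0 rbal.
  move=> ->; rewrite exprS natrM -hf natrM.
  have -> : \sum_(j < L) (([forall j0 : 'I_n, rho j0 j == om j0] && (true == om n))%:R +
     ([forall j0 : 'I_n, rho j0 j == om j0] && (false == om n))%:R) =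
     \sum_(j < L) [forall j0 : 'I_n, rho j0 j == om j0]%:R :> R.
    by apply: eq_bigr => a _; case: (om n); rewrite andbT andbF ?addr0 ?add0r.
  by ring.
- move=> F x; rewrite /= -!law.
  have e (i : 'I_(L * (m * 2))) : \sum_(j < n.+1) sg (rho' j i) =
      \sum_(j < n) sg (rho j (i %/ (m * 2))%N) + sg (r (i %/ (m * 2))%N (i %% (m * 2))%N) :> R.
    by rewrite big_ord_recr /= rho'n; congr (_ + _); apply: eq_bigr => j _; rewrite rho'lt.
  under eq_bigr do rewrite e.
  have := @balanced_blocks L m r (fun a b => F (x + (\sum_(j < n) sg (rho j a) + sg b))) m0 rbal.
  move=> ->; rewrite big_split /= natrM natrM.
  have e1 : \sum_(i < L) F (x + (\sum_(j < n) sg (rho j i) + sg true)) =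
     \sum_(i < L) F (x - 1 + \sum_(j < n) sg (rho j i)).
    by apply: eq_bigr => i _; congr F; rewrite /sg expr1; ring.
  have e2 : \sum_(i < L) F (x + (\sum_(j < n) sg (rho j i) + sg false)) =
     \sum_(i < L) F (x + 1 + \sum_(j < n) sg (rho j i)).
    by apply: eq_bigr => i _; congr F; rewrite /sg expr0; ring.
  by rewrite e1 e2; field; rewrite !gt_eqF.
Qed.

End SignSelection.

(** * Averaging over sign changes *)

Section SignAverage.
Context {R : realType}.
Variables (E : fun_space R) (hE : ri_space01 E).
Local Notation mu := (@lebesgue_measure R).
Local Notation I01 := (`[0, 1]%classic : set R).
Local Notation nE := (fnorm E).
Variables (D : nat -> nat) (v : nat -> nat -> R) (C1 c0 : R).
Hypothesis D0 : forall k, (0 < D k)%N.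
Hypothesis hup : upper_l2 E D v C1.
Hypothesis C10 : 0 <= C1.
Hypothesis c00 : 0 < c0.

Section System.
Variables (n L : nat) (K d : nat -> nat) (rho : nat -> nat -> bool).
Hypothesis hS : sign_system D v c0 n L K d rho.

Let fib (om : {ffun 'I_n -> bool}) : {set 'I_L} :=
  [set i : 'I_L | [forall j : 'I_n, rho j i == om j]].

Let card_fib om : (#|fib om| * 2 ^ n = L)%N.
Proof.
pose om' j := if insub j is Some j' then om (j' : 'I_n) else false.
have := ss_fibre hS om'; rewrite -big_distrl /= => h.
apply/eqP; rewrite -(eqr_nat R) natrM natrX -h; apply/eqP; congr (_ * _).
rewrite -sum1_card natr_sum big_mkcond /=; apply: eq_bigr => i _.
rewrite inE.
have -> : [forall j : 'I_n, rho j i == om' j] = [forall j : 'I_n, rho j i == om j].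
  by apply: eq_forallb => j; rewrite /om' valK.
by case: ifP.
Qed.

Let M := #|fib [ffun=> false]|.

Let card_fibM om : M = #|fib om|.
Proof.
have h1 := card_fib om; have h2 := card_fib [ffun=> false].
have : (M * 2 ^ n == #|fib om| * 2 ^ n)%N by apply/eqP; rewrite h1 -h2.
by rewrite eqn_mul2r expn_eq0 /= => /eqP.
Qed.

Let M0 : (0 < M)%N.
Proof.
have h : (M * 2 ^ n = L)%N := card_fib [ffun=> false].
by have := ss_pos hS; rewrite -{1}h muln_gt0 => /andP[].
Qed.

(** Cells are labelled by a sign pattern and a position in its fibre. With addition modulo [M] on
    positions the labels form a group acting simply transitively on itself, so that means over the
    group are means over cells. *)
Let T : finType := ({ffun 'I_n -> bool} * 'I_M)%type.

Let e (x : T) : 'I_L := enum_val (cast_ord (card_fibM x.1) x.2).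

Let rho_e (x : T) (j : 'I_n) : rho j (e x) = x.1 j.
Proof.
have := enum_valP (cast_ord (card_fibM x.1) x.2); rewrite inE => /forallP/(_ j)/eqP.
by [].
Qed.

Let e_inj : injective e.
Proof.
move=> [w a] [w' b] h; have ww : w = w'.
  by apply/ffunP => j; have := rho_e (w, a) j; rewrite h rho_e.
rewrite -{}ww in h *; congr pair; move: h; rewrite /e /= => /enum_val_inj.
exact: cast_ord_inj.
Qed.

Let cardT : #|T| = L.
Proof.
rewrite card_prod card_ffun card_bool !card_ord mulnC.
exact: card_fib [ffun=> false].
Qed.

Let addM (a b : 'I_M) : 'I_M := Ordinal (ltn_pmod (a + b) M0).

Let addMI a : injective (addM a).
Proof.
move=> b b' /(congr1 val) /= /eqP; rewrite eqn_modDl => /eqP.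
by rewrite !modn_small// => /val_inj.
Qed.

Let addMI' a : injective (addM^~ a).
Proof.
move=> b b' /(congr1 val) /= /eqP; rewrite eqn_modDr => /eqP.
by rewrite !modn_small// => /val_inj.
Qed.

Let act (g x : T) : T := ([ffun j => g.1 j (+) x.1 j], addM g.2 x.2).

Let chi (k : 'I_n) (x : T) : R := sg (x.1 k).

Let sum_e (f : nat -> R) : \sum_(x : T) f (e x) = \sum_(i < L) f i.
Proof.
have be : bijective e by apply: inj_card_bij => //; rewrite cardT card_ord.
by rewrite [RHS](reindex e) //=; exact: onW_bij.
Qed.

Let nE_stepf_e (h : nat -> R) : nE (stepf L h) = nE (fstep (fun x : T => h (e x))).
Proof.
rewrite -{1}cardT; apply: (@ri_stepf_fstep _ _ hE T h (fun x => e x)).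
- by rewrite cardT (ss_pos hS).
- by move=> x y /val_inj/e_inj.
- by move=> x; rewrite cardT.
Qed.

(** Weighting by the inverse of the correlation [c k] makes the average exactly the sum of the
    signs. Before averaging, the coefficients are plus or minus the inverse of [c k], at most
    [4 / c0] in modulus, and the upper estimate applies. *)
Lemma sign_sum_bound :
  nE (stepf L (fun i => \sum_(j < n) sg (rho j i))) <=
  C1 * (Num.sqrt n%:R / (c0 / 4)).
Proof.
have c40 : 0 < c0 / 4 by rewrite divr_gt0.
pose c (k : 'I_n) := smean L (fun i => sg (rho k i) * v (K k) (i %/ d k)%N).
have cc (k : 'I_n) : c0 / 4 <= c k := ss_corr hS (ltn_ord k).
have cp (k : 'I_n) : 0 < c k := lt_le_trans c40 (cc k).
pose y (k : 'I_n) (x : T) := v (K k) (e x %/ d k)%N.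
have T0 : (0 < #|T|)%N by rewrite cardT (ss_pos hS).
rewrite nE_stepf_e.
have hc (k : 'I_n) : #|T|%:R^-1 * (\sum_g chi k g * y k g) = c k.
  rewrite cardT /c /smean; congr (_ * _).
  rewrite -(sum_e (fun i => sg (rho k i) * v (K k) (i %/ d k)%N)).
  by apply: eq_bigr => x _; rewrite rho_e.
have := @ri_group_average R E hE T act n chi y (fun k => (c k)^-1)
  (C1 * (Num.sqrt n%:R / (c0 / 4))) T0.
have -> : (fun x => \sum_k (c k)^-1 * (#|T|%:R^-1 * \sum_g chi k g * y k g) * chi k x) =
    (fun x : T => \sum_(j < n) sg (rho j (e x))).
  apply/funext => x; apply: eq_bigr => k _.
  by rewrite hc mulVf ?gt_eqF// mul1r rho_e.
apply.
- move=> g [w a] [w' b] hh; have h2 := addMI (congr1 snd hh); congr pair; last exact: h2.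
  by apply/ffunP => j; have /ffunP/(_ j) := congr1 fst hh; rewrite !ffunE => /addbI.
- move=> g [w a] [w' b] hh; have h2 := addMI' (congr1 snd hh); congr pair; last exact: h2.
  by apply/ffunP => j; have /ffunP/(_ j) := congr1 fst hh; rewrite !ffunE => /addIb.
- by move=> k g x; rewrite /chi /sg ffunE signr_addb.
- by move=> k x; rewrite /chi /sg -signr_addb addbb.
move=> g.
rewrite -(nE_stepf_e (fun i => \sum_k (c k)^-1 * chi k g * v (K k) (i %/ d k)%N)).
pose a j := if insub j is Some k then (c (k : 'I_n))^-1 * chi k g else 0.
have aE (k : 'I_n) : a k = (c k)^-1 * chi k g by rewrite /a valK.
apply: (@le_trans _ _ (nE (\sum_(j < n) a j *: stepf (D (K j)) (v (K j))))).
  rewrite le_eqVlt; apply/orP; left; apply/eqP; apply: (ri_eqfun hE _ _).2.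
    apply: (ri_carrier_sum hE) => k _; apply: (ri_carrierZ hE); exact: ri_stepf.
  move=> t; rewrite /= in_itv /= => /andP[t0 _].
  rewrite fct_sumE [LHS]/stepf; apply: eq_bigr => k _; rewrite aE; congr (_ * _).
  have [d0 eL] := ss_level hS (ltn_ord k).
  by rewrite (stepf_refine _ (D0 _) d0 t0) -eL.
apply: le_trans (hup _ (ss_incr hS)) _; rewrite ler_wpM2l//.
rewrite -[c0 / 4]gtr0_norm// -sqrtr_sqr -sqrtrV ?sqr_ge0// -sqrtrM//.
rewrite ler_sqrt; last by rewrite mulr_ge0// invr_ge0 sqr_ge0.
apply: (@le_trans _ _ (\sum_(j < n) ((c0 / 4) ^+ 2)^-1)); last first.
  by rewrite sumr_const card_ord mulr_natl.
apply: ler_sum => k _; rewrite aE exprMn /chi /sg sqrr_sign mulr1 exprVn.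
rewrite lef_pV2 ?posrE ?exprn_gt0//; apply: lerXn2r; rewrite ?nnegrE; [exact: ltW|exact: ltW|exact: cc].
Qed.

Lemma sign_sum_law (s : R) :
  mu (I01 `&` [set t | s <= stepf L (fun i => \sum_(j < n) sg (rho j i)) t]) =
  (walk_tail n s 0)%:E.
Proof.
have := mu_stepf (fun i => s <= \sum_(j < n) sg (rho j i)) (ss_pos hS).
rewrite /stepf => ->; congr EFin; rewrite /walk_tail -(ss_law hS) mulrC natr_sum.
by congr (_ * _); apply: eq_bigr => i _; rewrite add0r.
Qed.

End System.

Lemma chain_fun_le_level (a t : R) (W : nat -> set R) (p : nat) : 0 <= a ->
  (forall q, W q t -> 2 ^+ q <= 2 * a) ->
  chain_fun (fun q => 2 ^+ q) W p t <= 4 * a.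
Proof.
move=> a0 hW; elim: p => [|p IH]; first by rewrite /chain_fun big_ord0 mulr_ge0.
have [Wt|Wt] := pselect (W p t); last first.
  by rewrite /chain_fun big_ord_recr /= (indic_notin Wt) mulr0 addr0.
apply: (@le_trans _ _ (\sum_(q < p.+1) 2 ^+ q)).
  apply: ler_sum => q _; by rewrite ler_piMr ?exprn_ge0.
have h2 : (2 - 1) * \sum_(q < p.+1) 2 ^+ q = 2 ^+ p.+1 - 1 :> R by rewrite subrX1.
have e1 : 2 - 1 = 1 :> R by lra.
rewrite e1 mul1r in h2; rewrite h2 exprS; have := hW p Wt; lra.
Qed.

Hypothesis hc0 : forall k, c0 <= smean (D k) (fun i => `|v k i|).

(** For [n = 4 ^ p] the level set of the sum of signs at [2 ^+ q * 2 ^+ p / 2] has measure at least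
    [12^-1 ^+ (4 ^ q)]. The chain over these sets dominates in norm the chain over intervals, and it
    is pointwise at most [4 / 2 ^+ p] times the modulus of the sum, whose norm is of order at most
    [2 ^+ p]. *)
Lemma nonnull_gauss_bounded : gauss_bounded E 12^-1 (4 * (C1 / (c0 / 4))).
Proof.
move=> p; pose n := (4 ^ p)%N.
have [L [K [d [rho hS]]]] := sign_system_exists hE D0 hup C10 c00 hc0 n.
pose h i : R := \sum_(j < n) sg (rho j i).
have L0 := ss_pos hS.
have hH := ri_stepf hE h L0.
have p2 : 0 < 2 ^+ p :> R by rewrite exprn_gt0.
have nsqr : n%:R = (2 ^+ p) ^+ 2 :> R.
  by rewrite /n natrX -exprM mulnC exprM; congr (_ ^+ _); rewrite expr2 -natrM.
have sqn : Num.sqrt n%:R = 2 ^+ p :> R by rewrite nsqr sqrtr_sqr gtr0_norm.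
have bound : nE (stepf L h) <= C1 * (2 ^+ p / (c0 / 4)).
  by rewrite -sqn; exact: sign_sum_bound hS.
pose W q := I01 `&` [set t | 2 ^+ q * 2 ^+ p / 2 <= stepf L h t].
have mW q : measurable (W q).
  have -> : W q = I01 `&` stepf L h @^-1` `[2 ^+ q * 2 ^+ p / 2, +oo[.
    by rewrite /W; congr (_ `&` _); apply/seteqP; split=> t /=; rewrite in_itv /= andbT.
  by apply: (measurable_stepf h L0).
apply: (@le_trans _ _ (nE (chain_fun (fun q => 2 ^+ q) W p))).
  apply: (ri_chain_le hE) => //.
  - move=> q r t qr /=; rewrite !in_itv /= => /andP[-> /le_trans]; apply.
    rewrite ler_wiXn2l ?invr_ge0 ?invf_le1 ?ler1n// leq_pexp2l//.
  - move=> q r t qr [It /= hr]; split=> //=; apply: le_trans hr.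
    by rewrite ler_pM2r ?invr_gt0// ler_pM2r// ler_weXn2l// ler1n.
  - move=> q qp; rewrite mu_I01_itv; last first.
      by rewrite exprn_ge0 ?invr_ge0//= exprn_ile1 ?invr_ge0// invf_le1 ?ler1n.
    rewrite /W setIA setIid (sign_sum_law hS) lee_fin.
    exact: walk_tail_gauss (ltnW qp).
have hZ := ri_carrierZ hE (4 * (2 ^+ p)^-1) hH.
apply: (@le_trans _ _ (nE ((4 * (2 ^+ p)^-1) *: stepf L h))).
  apply: (ri_le hE _ hZ _).2.
    by apply: measurable_chain_fun.
  move=> t It; rewrite ger0_norm; last by apply: chain_fun_ge0 => q; rewrite exprn_ge0.
  have -> : `|((4 * (2 ^+ p)^-1) *: stepf L h) t| = 4 * (`|stepf L h t| / 2 ^+ p).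
    by rewrite !fctE normrM ger0_norm ?mulr_ge0// ?invr_ge0 ?exprn_ge0//; rewrite -mulrA (mulrC _^-1).
  apply: chain_fun_le_level; first by rewrite divr_ge0// exprn_ge0.
  move=> q [_ /= hq]; rewrite mulrA ler_pdivlMr//.
  have := ler_norm (stepf L h t); lra.
rewrite (ri_normZ hE)// ger0_norm ?mulr_ge0 ?invr_ge0 ?exprn_ge0//.
apply: le_trans (ler_wpM2l _ bound) _; first by rewrite mulr_ge0// invr_ge0 exprn_ge0.
rewrite le_eqVlt; apply/orP; left; apply/eqP; field.
by rewrite !gt_eqF.
Qed.

End SignAverage.

(** * Almost disjoint subsequences *)

Section AlmostDisjoint.
Context {R : realType}.
Variables (E : fun_space R) (hE : ri_space01 E) (hsep : separable_space E).
Local Notation mu := (@lebesgue_measure R).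
Local Notation I01 := (`[0, 1]%classic : set R).
Local Notation nE := (fnorm E).
Variables (D : nat -> nat) (v : nat -> nat -> R).
Hypothesis D0 : forall k, (0 < D k)%N.

Let y k := stepf (D k) (v k).
Let vmax k := \sum_(i < (D k).+1) `|v k i|.

Let y_le k t : I01 t -> `|y k t| <= vmax k.
Proof.
move=> It; rewrite /y stepf_sum//; apply: le_trans (ler_norm_sum _ _ _) _.
apply: ler_sum => i _; rewrite normrM ler_piMr//.
by rewrite indicE; case: (_ \in _); rewrite ?normr0 ?normr1.
Qed.

Let T k s := I01 `&` [set t | s < `|y k t|].

Let mT k s : measurable (T k s).
Proof. by apply: measurable_superlevel; exact: measurable_stepf. Qed.

Let mu_T k s : 0 < s ->
  (mu (T k s) <= (smean (D k) (fun i => `|v k i|) / s)%:E)%E.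
Proof.
move=> s0; have := mu_stepf (fun i => s < `|v k i|) (D0 k).
rewrite -/(stepf _ _) => -> //; rewrite lee_fin /smean.
rewrite mulrC -mulrA ler_wpM2l ?invr_ge0// ler_pdivlMr// natr_sum big_distrl /=.
apply: ler_sum => i _; case: ltP => h; first by rewrite mul1r ltW.
by rewrite mul0r.
Qed.

(* Kadec-Pelczynski: [T' j] is the set where the [j]-th selected term exceeds a
   small threshold; each new term is selected so that its set is tiny compared
   with what the earlier terms tolerate. *)
Lemma almost_disjoint_subsequence (eps : R) : 0 < eps ->
  (forall (B : nat) (e : R), 0 < e -> exists2 k, (B <= k)%N &
     smean (D k) (fun i => `|v k i|) <= e) ->
  exists (K : nat -> nat) (h : nat -> R -> R),
    [/\ {homo K : m n / (m < n)%N}, (forall j, carrier E (h j)),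
        disjoint_seq E h & forall j, nE (y (K j) - h j) <= eps / 2 ^+ j.+1].
Proof.
move=> eps0 hnull; pose th j := eps / 2 ^+ j.+2.
have th0 j : 0 < th j by rewrite divr_gt0// exprn_gt0.
have vmax0 k : 0 <= vmax k by apply: sumr_ge0.
have hkap (kj : nat * nat) : exists s : R, 0 < s <= 1 /\
    fundamental E s <= th kj.2 / (vmax kj.1 + 1).
  have h0 : 0 < th kj.2 / (vmax kj.1 + 1) by rewrite divr_gt0// ltr_wpDl.
  by have [s [s01 /ltW hs]] := fundamental_cvg0 hE hsep h0; exists s.
have /choice[kap {}hkap] := hkap.
(* The triple holds the stage, the least admissible index and a measure budget; the guard on the
   budget makes the choice function total. *)
have hpick (x : nat * (nat * R)) : exists k, 0 < x.2.2 -> (x.2.1 <= k)%N /\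
    smean (D k) (fun i => `|v k i|) <= th x.1 * (x.2.2 / 2 ^+ x.1.+1).
  have [x0|x0] := ltP 0 x.2.2; last by exists 0%N.
  have [|k k1 k2] := hnull x.2.1 (th x.1 * (x.2.2 / 2 ^+ x.1.+1)).
    by rewrite mulr_gt0// divr_gt0// exprn_gt0.
  by exists k.
have /choice[pick {}hpick] := hpick.
(* The state before stage [j]: the least admissible index, and the smallest tolerance of the terms
   selected so far, initially 1. *)
pose St := fix St j : nat * R := if j is i.+1 then
   ((pick (i, St i)).+1, Num.min (St i).2 (kap (pick (i, St i), i))) else (0%N, 1).
pose K j := pick (j, St j).
have StS j : St j.+1 = ((K j).+1, Num.min (St j).2 (kap (K j, j))) by [].
have St0 j : 0 < (St j).2.
  elim: j => [|j IH]; first exact: ltr01.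
  by rewrite StS /= lt_min IH /=; have [/andP[]] := hkap (K j, j).
have K1 j : ((St j).1 <= K j)%N by have [] := hpick (j, St j) (St0 j).
have K2 j : smean (D (K j)) (fun i => `|v (K j) i|) <= th j * ((St j).2 / 2 ^+ j.+1).
  by have [] := hpick (j, St j) (St0 j).
have KS j : (K j < K j.+1)%N by have := K1 j.+1; rewrite StS.
have Kh : {homo K : m n / (m < n)%N} by apply: homo_ltn => //; exact: ltn_trans.
have Stle i j : (i < j)%N -> (St j).2 <= kap (K i, i).
  elim: j => // j IH; rewrite ltnS leq_eqVlt => /orP[/eqP->|ij].
    by rewrite StS /= ge_min lexx orbT.
  by rewrite StS /= ge_min IH.
pose T' j := T (K j) (th j).
have muT j : (mu (T' j) <= ((St j).2 / 2 ^+ j.+1)%:E)%E.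
  apply: le_trans (mu_T _ (th0 j)) _; rewrite lee_fin ler_pdivrMr// mulrC.
  exact: K2.
(* For [i > j] the measure of [T' i] is at most the tolerance of the [j]-th term over [2 ^+ i.+1],
   so all later sets together stay within that tolerance. *)
pose U j := \bigcup_i (if (j < i)%N then T' i else set0).
have mU j : measurable (U j).
  by apply: bigcup_measurable => i _; case: ifP => _ //; exact: mT.
have muU j : (mu (U j) <= (kap (K j, j))%:E)%E.
  have kap0 : 0 <= kap (K j, j) by have [/andP[/ltW]] := hkap (K j, j).
  apply: le_trans (measure_sigma_subadditive mu (F := fun i => if (j < i)%N then T' i else set0) _ (mU j) _) _.
  - by move=> i; case: ifP => _ //; exact: mT.
  - by [].
  apply: le_trans (epsilon_trick0 xpredT kap0).
  apply: lee_nneseries => i _ //; case: ifP => ji; last first.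
    by rewrite measure0 lee_fin divr_ge0.
  apply: le_trans (muT i) _; rewrite lee_fin natrX ler_pM2r ?invr_gt0 ?exprn_gt0//.
  exact: Stle.
pose G j := T' j `\` U j.
have mG j : measurable (G j) by apply: measurableD => //; exact: mT.
have hy k : carrier E (y k) := ri_stepf hE (v k) (D0 k).
exists K, (fun j => y (K j) \* \1_(G j)); split=> //.
- by move=> j; exact: (ri_restr hE (mG j) (hy _)).1.
- have H m n t : (m < n)%N -> ~ (G m t /\ G n t).
    move=> mn [[_ Um] [Tn _]]; apply: Um; exists n => //; by rewrite mn.
  move=> m n mn; rewrite /ae_eq_on; apply: leb_ae_all => t _ /=.
  have [Gm|Gm] := pselect (G m t); last first.
    by rewrite (indic_notin Gm) mulr0 normr0; apply/min_idPl.
  have Gn : ~ G n t.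
    move=> Gn; move: mn; rewrite neq_ltn => /orP[mn|mn].
      exact: H mn (conj Gm Gn).
    exact: H mn (conj Gn Gm).
  by rewrite (indic_notin Gn) mulr0 normr0; apply/min_idPr.
move=> j.
have [hk1 hk2] := hkap (K j, j); rewrite /= in hk1 hk2.
have [c1 n1] := ri_carrier1 hE.
have hUc := ri_indic hE (mU j).
have h1 := ri_carrierZ hE (th j) c1.
have h2 := ri_carrierZ hE (vmax (K j)) hUc.
have hd : carrier E (y (K j) - y (K j) \* \1_(G j)).
  by apply: (ri_carrierB hE) => //; exact: (ri_restr hE (mG j) (hy _)).1.
(* Off [G j] either the term is at most [th j], or the point lies in [U j]; each part costs [th j],
   half of the allowed error. *)
apply: (@le_trans _ _ (nE (th j *: cst 1 + vmax (K j) *: \1_(U j)))).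
  apply: (ri_le hE (ri_measurable hE hd) (ri_carrierD hE h1 h2) _).2 => t It.
  have -> : (th j *: (cst 1 : R -> R) + vmax (K j) *: \1_(U j)) t =
      th j + vmax (K j) * \1_(U j) t by rewrite !fctE; congr (_ + _); exact: mulr1.
  rewrite [leRHS]ger0_norm; last first.
    by rewrite addr_ge0 ?mulr_ge0// ?indicE ?ler0n//; exact: ltW.
  rewrite !fctE /=; have [Gt|Gt] := pselect (G j t).
    rewrite (indic_in Gt) mulr1 subrr normr0 addr_ge0 ?mulr_ge0// ?indicE ?ler0n//.
    exact: ltW.
  rewrite (indic_notin Gt) mulr0 subr0.
  have [Ut|Ut] := pselect (U j t).
    rewrite (indic_in Ut) mulr1; apply: le_trans (y_le _ It) _.
    by rewrite lerDr ltW.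
  rewrite (indic_notin Ut) mulr0 addr0 leNgt; apply/negP => h; apply: Gt.
  by split=> //; split.
apply: le_trans (ri_normD hE h1 h2) _.
rewrite !(ri_normZ hE)// n1 mulr1 (gtr0_norm (th0 j)) ger0_norm//.
have -> : eps / 2 ^+ j.+1 = th j + th j.
  by rewrite /th [X in _ / X + _]exprS [X in _ + _ / X]exprS; field; rewrite gt_eqF// exprn_gt0.
rewrite lerD2l.
have hU : nE \1_(U j) <= fundamental E (kap (K j, j)).
  apply: (ri_indic_fundamental hE) => //; first by case/andP: hk1 => /ltW -> ->.
  apply: le_trans (muU j); apply: le_measure; rewrite ?inE//.
    by apply: measurableI; [exact: measurable_I01|exact: mU].
    exact: mU.
apply: (@le_trans _ _ ((vmax (K j) + 1) * fundamental E (kap (K j, j)))).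
  by apply: ler_pM => //; [exact: (ri_norm_ge0 hE)|rewrite lerDl].
by rewrite mulrC -ler_pdivlMr// ltr_wpDl.
Qed.

End AlmostDisjoint.

(** * Sums of disjoint indicators in Z_E *)

Section FiniteUnions.
Context {R : realType}.
Local Notation mu := (@lebesgue_measure R).

Lemma leb_bigcup_disj (n : nat) (F : nat -> set R) (r : nat -> R) :
  (forall k, (k < n)%N -> measurable (F k)) ->
  (forall i j t, (i < n)%N -> (j < n)%N -> i != j -> F i t -> ~ F j t) ->
  (forall k, (k < n)%N -> mu (F k) = (r k)%:E) ->
  measurable (\bigcup_(k < n) F k) /\
  mu (\bigcup_(k < n) F k) = (\sum_(k < n) r k)%:E.
Proof.
elim: n => [|n IH] mF dF rF.
  by rewrite bigcup_mkord !big_ord0 measure0.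
have [m1 e1] : measurable (\bigcup_(k < n) F k) /\
    mu (\bigcup_(k < n) F k) = (\sum_(k < n) r k)%:E.
  apply: IH => [k kn|i j t iN jN|k kn]; [apply: mF; exact: ltnW|exact: dF (ltnW iN) (ltnW jN)|].
  by apply: rF; exact: ltnW.
rewrite bigcup_mkord big_ord_recr -bigcup_mkord /=; split.
  by apply: measurableU => //; exact: mF.
rewrite leb_measureU ?e1 ?rF ?big_ord_recr//; first exact: mF.
apply/seteqP; split=> t // [[i /= iN Fi] Fn].
by apply: (dF i n t (ltnW iN) (ltnSn n) _ Fi Fn); rewrite ltn_eqF.
Qed.

End FiniteUnions.

Section SortedSums.
Context {R : realType}.
Local Notation mu := (@lebesgue_measure R).
Local Notation halfline := (`]0, +oo[%classic : set R).
Variables (n : nat) (U : nat -> set R) (m : nat -> R) (a : nat -> R).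
Hypothesis mU : forall k, (k < n)%N -> measurable (U k).
Hypothesis Uhalf : forall k, (k < n)%N -> U k `<=` halfline.
Hypothesis Udisj : forall i j t, (i < n)%N -> (j < n)%N -> i != j ->
  U i t -> ~ U j t.
Hypothesis muU : forall k, (k < n)%N -> mu (U k) = (m k)%:E.

Definition disj_sum : R -> R := \sum_(k < n) a k *: \1_(U k).

Lemma disj_sum_in k t : (k < n)%N -> U k t -> disj_sum t = a k.
Proof.
move=> kn Ut; rewrite /disj_sum fct_sumE (bigD1 (Ordinal kn))//=.
rewrite big1 ?addr0 => [|i ik]; first by rewrite fctE (indic_in Ut); exact: mulr1.
rewrite fctE indic_notin; first exact: mulr0.
by apply: (Udisj kn (ltn_ord i)) Ut; rewrite eq_sym -val_eqE in ik *.
Qed.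

Lemma disj_sum_notin t : (forall k, (k < n)%N -> ~ U k t) -> disj_sum t = 0.
Proof.
move=> h; rewrite /disj_sum fct_sumE big1// => i _.
by rewrite fctE indic_notin; [exact: mulr0|exact: h].
Qed.

Lemma measurable_disj_sum : measurable_fun halfline disj_sum.
Proof.
have -> : disj_sum = (fun t => \sum_(k < n) a k * \1_(U k) t).
  by apply/funext => t; rewrite /disj_sum fct_sumE.
apply: measurable_sum => k.
by apply: measurable_funM; [exact: measurable_cst|apply: measurable_indic; exact: mU].
Qed.

Lemma distr_disj_sum (s : R) : 0 <= s ->
  distr halfline disj_sum s = (\sum_(k < n) (s < `|a k|)%R%:R * m k)%:E.
Proof.
move=> s0; rewrite /distr.
pose V k := if s < `|a k| then U k else set0.
have -> : [set t | halfline t /\ s < `|disj_sum t|] = \bigcup_(k < n) V k.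
  apply/seteqP; split=> t.
    move=> [_ ht]; have [[k kn Ut]|hn] := pselect (exists2 k, (k < n)%N & U k t).
      by exists k => //; rewrite /V -(disj_sum_in kn Ut) ht.
    have e0 : disj_sum t = 0.
      by apply: disj_sum_notin => k kn Ut; apply: hn; exists k.
    by move: ht; rewrite e0 normr0 ltNge s0.
  move=> [k /= kn]; rewrite /V; case: ifP => // h Ut.
  by split; [exact: Uhalf kn _ Ut|rewrite (disj_sum_in kn Ut)].
apply: (leb_bigcup_disj (F := V) (r := fun k => (s < `|a k|)%R%:R * m k) _ _ _).2.
- by move=> k kn; rewrite /V; case: ifP => // _; exact: mU.
- move=> i j t iN jN ij; rewrite /V; case: ifP => // _ Ui; case: ifP => _; last by case.
  exact: Udisj iN jN ij Ui.
- move=> k kn; rewrite /V; case: ifP => _; first by rewrite mul1r muU.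
  by rewrite mul0r measure0.
Qed.

Hypothesis m0 : forall k, (k < n)%N -> 0 <= m k.
Hypothesis a_sorted : forall i j, (i <= j < n)%N -> `|a j| <= `|a i|.

Definition psum (k : nat) : R := \sum_(j < k) m j.

Lemma psumE k : (k <= n)%N -> psum k = \sum_(j < n) (j < k)%N%:R * m j.
Proof.
move=> kn; rewrite /psum (big_ord_widen n (fun j => m j) kn) big_mkcond /=.
by apply: eq_bigr => j _; case: ifP; rewrite ?mul1r ?mul0r.
Qed.

Lemma psum_le i j : (i <= j)%N -> (j <= n)%N -> psum i <= psum j.
Proof.
move=> ij jn; rewrite !psumE ?(leq_trans ij)//; apply: ler_sum => k _.
rewrite ler_wpM2r ?m0// ler_nat; case: (ltnP k i) => // ki.
by rewrite (leq_trans ki ij).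
Qed.

(** Heights are sorted: those above [|a k|] are among the first [k], while for [s < |a k|] all of
    the first [k.+1] exceed [s]. *)
Lemma rearr_sorted t k : (k < n)%N -> psum k <= t -> t < psum k.+1 ->
  rearr halfline disj_sum t = (`|a k|)%:E.
Proof.
move=> kn kt tk; apply/le_anti/andP; split.
  apply: ereal_inf_lbound; exists `|a k| => //; split=> //.
  rewrite distr_disj_sum// lee_fin; apply: le_trans kt.
  rewrite psumE ?(ltnW kn)//; apply: ler_sum => j _.
  rewrite ler_wpM2r ?m0// ler_nat; case: (ltnP j k) => // kj; first by case: (_ < _).
  by rewrite ltNge a_sorted// kj ltn_ord.
apply: le_ereal_inf_tmp => _ [s [s0 hs] <-]; rewrite lee_fin leNgt; apply/negP => sk.
move: hs; rewrite distr_disj_sum// lee_fin; apply/negP; rewrite -ltNge.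
apply: lt_le_trans tk _; rewrite psumE//; apply: ler_sum => j _.
rewrite ler_wpM2r ?m0// ler_nat; case: (ltnP j k.+1) => // jk.
by rewrite (lt_le_trans sk)// a_sorted// -ltnS jk.
Qed.

Lemma rearr_sorted_out t : psum n <= t -> rearr halfline disj_sum t = 0%E.
Proof.
move=> nt; apply/le_anti/andP; split.
  apply: ereal_inf_lbound; exists 0 => //; split=> //.
  rewrite distr_disj_sum// lee_fin; apply: le_trans nt.
  rewrite psumE//; apply: ler_sum => j _.
  by rewrite ler_wpM2r ?m0// ler_nat ltn_ord; case: (_ < _).
by apply: le_ereal_inf_tmp => _ [s [s0 _] <-]; rewrite lee_fin.
Qed.

Lemma psum_cases t : 0 <= t ->
  (exists k, [/\ (k < n)%N, psum k <= t & t < psum k.+1]) \/ psum n <= t.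
Proof.
move=> t0; have [h|h] := leP (psum n) t; [by right|left].
have H k : (k <= n)%N -> t < psum k -> exists j, [/\ (j < k)%N, psum j <= t & t < psum j.+1].
  elim: k => [|k IH] kn; first by rewrite /psum big_ord0 ltNge t0.
  have [hk|hk] := leP (psum k) t; first by exists k.
  by have [j [jk j1 j2]] := IH (ltnW kn) hk; exists j; split=> //; exact: ltnW.
by have [k [kn k1 k2]] := H n (leqnn n) h; exists k.
Qed.

Lemma sum_steps (c : nat -> R) t k : (k < n)%N -> psum k <= t -> t < psum k.+1 ->
  \sum_(j < n) c j * \1_(`[psum j, psum j.+1[%classic) t = c k.
Proof.
move=> kn kt tk; rewrite (bigD1 (Ordinal kn))//= indic_in ?mulr1; last first.
  by rewrite /= in_itv /= kt tk.
rewrite big1 ?addr0// => j; rewrite -val_eqE /= => jk.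
rewrite indic_notin ?mulr0//= in_itv /= => /andP[h1 h2].
move: jk; rewrite neq_ltn => /orP[jk|kj].
  by have := lt_le_trans h2 (le_trans (psum_le jk (ltnW kn)) kt); rewrite ltxx.
by have := lt_le_trans tk (le_trans (psum_le kj (ltnW (ltn_ord j))) h1); rewrite ltxx.
Qed.

Lemma sum_steps_out (c : nat -> R) t : psum n <= t ->
  \sum_(j < n) c j * \1_(`[psum j, psum j.+1[%classic) t = 0.
Proof.
move=> nt; rewrite big1// => j _.
rewrite indic_notin ?mulr0//= in_itv /= => /andP[_ h2].
by have := lt_le_trans h2 (le_trans (psum_le (ltn_ord j) (leqnn n)) nt); rewrite ltxx.
Qed.

Lemma rearr_steps t : 0 <= t -> rearr halfline disj_sum t =
  (\sum_(j < n) `|a j| * \1_(`[psum j, psum j.+1[%classic) t)%:E.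
Proof.
move=> t0; have [[k [kn k1 k2]]|nt] := psum_cases t0.
  by rewrite (rearr_sorted kn k1 k2) (sum_steps (fun j => `|a j|) kn k1 k2).
by rewrite rearr_sorted_out// (sum_steps_out (fun j => `|a j|)).
Qed.

(** The length of the part beyond 1 of the [j]-th step of the rearrangement. *)
Definition tail_len (j : nat) : R := Num.max (psum j.+1) 1 - Num.max (psum j) 1.

Lemma ZE_tail_sorted :
  ZE_tail disj_sum = (Num.sqrt (\sum_(j < n) a j ^+ 2 * tail_len j))%:E.
Proof.
rewrite /ZE_tail unlock /Lnorm.
have tl0 (j : 'I_n) : 0 <= tail_len j.
  rewrite /tail_len subr_ge0 ge_max !le_max lexx orbT andbT.
  by rewrite psum_le.
have -> : (\int[mu]_x (`|(rearr halfline disj_sum \_ `[1%R, +oo[) x| `^ 2))%E =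
    (\int[mu]_x (\sum_(j < n) ((a j ^+ 2)%:E *
      (\1_(`[Num.max (psum j) 1%R, Num.max (psum j.+1) 1%R[%classic) x)%:E)))%E.
  apply: eq_integral => x _; rewrite patchE.
  have [x1|x1] := ltP x 1.
    rewrite memNset; last by rewrite /= in_itv /= andbT => /(lt_le_trans x1); rewrite ltxx.
    rewrite abse0 poweR0r//; symmetry; apply: big1 => j _.
    rewrite indic_notin ?mule0//= in_itv /= => /andP[+ _].
    by rewrite ge_max => /andP[_ /(lt_le_trans x1)]; rewrite ltxx.
  have x0 : 0 <= x by apply: le_trans x1.
  rewrite mem_set; last by rewrite /= in_itv /= andbT.
  have e (j : 'I_n) : \1_(`[Num.max (psum j) 1, Num.max (psum j.+1) 1[%classic) x =
      \1_(`[psum j, psum j.+1[%classic) x :> R.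
    rewrite !indicE; congr ((nat_of_bool _)%:R); apply/idP/idP; rewrite !inE /= !in_itv /= ge_max lt_max x1 andbT.
      by rewrite (ltNge x 1) x1 orbF.
    by move=> /andP[-> ->].
  under eq_bigr do rewrite e -EFinM.
  rewrite sumEFin; have [[k [kn k1 k2]]|nt] := psum_cases x0.
    rewrite (rearr_sorted kn k1 k2) (sum_steps (fun j => a j ^+ 2) kn k1 k2).
    by rewrite /= normr_id powR_mulrn// real_normK// num_real.
  rewrite rearr_sorted_out// (sum_steps_out (fun j => a j ^+ 2))//.
  by rewrite abse0 poweR0r.
rewrite ge0_integral_sum//; last 2 first.
- move=> j; apply: measurable_funeM; apply/measurable_EFinP.
  by apply: measurable_indic.
- by move=> j x _; rewrite -EFinM lee_fin mulr_ge0 ?sqr_ge0// indicE.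
rewrite -powR12_sqrt ?sumr_ge0//; last by move=> j _; rewrite mulr_ge0 ?sqr_ge0.
rewrite -poweR_EFin -sumEFin; congr (_ `^ _)%E; apply: eq_bigr => j _.
rewrite ge0_integralZl_EFin ?sqr_ge0//; last first.
  by apply/measurable_EFinP; exact: measurable_indic.
rewrite integral_indic// setIT [RHS]EFinM; congr (_ * _)%E.
transitivity (mu (`[Num.max (psum j) 1, Num.max (psum j.+1) 1[%classic : set R)) => //.
rewrite lebesgue_measure_itv /= lte_fin /tail_len; case: ltP => h; first by rewrite EFinB.
by have := tl0 j; rewrite /tail_len => h2; congr EFin; apply/le_anti; rewrite h2 subr_le0 h.
Qed.

End SortedSums.

(** * Norm estimates in Z_E for disjoint families *)

Section DisjointFamilies.
Context {R : realType}.
Variables (E : fun_space R) (hE : ri_space01 E).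
Local Notation mu := (@lebesgue_measure R).
Local Notation I01 := (`[0, 1]%classic : set R).
Local Notation halfline := (`]0, +oo[%classic : set R).
Local Notation nE := (fnorm E).
Local Notation nZ := (fnorm (ZE E)).

Record disj_family (n : nat) (U : nat -> set R) (m : nat -> R) : Prop := {
  df_meas : forall k, (k < n)%N -> measurable (U k) ;
  df_half : forall k, (k < n)%N -> U k `<=` halfline ;
  df_disj : forall i j t, (i < n)%N -> (j < n)%N -> i != j -> U i t -> ~ U j t ;
  df_mu : forall k, (k < n)%N -> mu (U k) = (m k)%:E ;
  df_ge0 : forall k, (k < n)%N -> 0 <= m k }.

Section Sorted.
Variables (n : nat) (U : nat -> set R) (m : nat -> R) (a : nat -> R).
Hypothesis hF : disj_family n U m.
Hypothesis a_sorted : forall i j, (i <= j < n)%N -> `|a j| <= `|a i|.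

Let f := disj_sum n U a.
Let g t : R := \sum_(j < n) `|a j| * \1_(`[psum m j, psum m j.+1[%classic) t.

Let rearr_f t : 0 <= t -> rearr halfline f t = (g t)%:E.
Proof.
by apply: rearr_steps; [exact: df_meas hF|exact: df_half hF|exact: df_disj hF
  |exact: df_mu hF|exact: df_ge0 hF|exact: a_sorted].
Qed.

Let psum_mono i j : (i <= j)%N -> (j <= n)%N -> psum m i <= psum m j.
Proof. by move=> ij jn; apply: (psum_le (df_ge0 hF)). Qed.

Let mg D : measurable_fun D g.
Proof.
apply: measurable_sum => j.
by apply: measurable_funM; [exact: measurable_cst|exact: measurable_indic].
Qed.

Let g_ge0 t : 0 <= g t.
Proof. by apply: sumr_ge0 => j _; rewrite mulr_ge0// indicE ler0n. Qed.

Let g_le A t : 0 <= A -> (forall k, (k < n)%N -> `|a k| <= A) -> 0 <= t -> g t <= A.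
Proof.
move=> A0 hA t0; rewrite /g.
have [[k [kn k1 k2]]|nt] := psum_cases n m t0.
  by rewrite (sum_steps (df_ge0 hF) (fun j => `|a j|) kn k1 k2) hA.
by rewrite (sum_steps_out (df_ge0 hF) (fun j => `|a j|) nt).
Qed.

Let I01_ge0 t : I01 t -> 0 <= t.
Proof. by rewrite /= in_itv /= => /andP[]. Qed.

Let hg : carrier E g.
Proof.
have mgI : measurable_fun I01 g by exact: mg.
apply: (ri_bounded hE (K := \sum_(j < n) `|a j|) mgI _).1 => t It.
rewrite ger0_norm//; apply: g_le (I01_ge0 It); first exact: sumr_ge0.
by move=> k kn; rewrite (bigD1 (Ordinal kn))//= lerDl sumr_ge0.
Qed.

Let head_g t : I01 t -> ZE_head f t = g t.
Proof. by move=> It; rewrite /ZE_head patchE mem_set//= rearr_f ?I01_ge0. Qed.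

Let tail_f : ZE_tail f = (Num.sqrt (\sum_(j < n) a j ^+ 2 * tail_len m j))%:E.
Proof.
by apply: ZE_tail_sorted; [exact: df_meas hF|exact: df_half hF|exact: df_disj hF
  |exact: df_mu hF|exact: df_ge0 hF|exact: a_sorted].
Qed.

Lemma ZE_sorted_carrier : carrier (ZE E) f.
Proof.
split; first by apply: measurable_disj_sum; exact: df_meas hF.
  exact: (ri_eqfun hE hg head_g).1.
by rewrite tail_f ltry.
Qed.

Lemma ZE_sorted_norm : nZ f = nE g + Num.sqrt (\sum_(j < n) a j ^+ 2 * tail_len m j).
Proof. by rewrite /= tail_f (ri_eqfun hE hg head_g).2. Qed.

Let head_ge0 : 0 <= nE g. Proof. exact: ri_norm_ge0. Qed.

Let tail_len_ge0 j : (j < n)%N -> 0 <= tail_len m j.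
Proof.
move=> jn; rewrite /tail_len subr_ge0 ge_max !le_max lexx orbT andbT.
by rewrite psum_mono.
Qed.

(** This is the part of the [j]-th step inside [[0, 1]], in a form that telescopes. *)
Let len_sub_tail j : m j - tail_len m j = Num.min (psum m j.+1) 1 - Num.min (psum m j) 1.
Proof.
have h x : Num.max x 1 + Num.min x 1 = x + 1 :> R by exact: addr_max_min.
have e : psum m j.+1 = psum m j + m j by rewrite /psum big_ord_recr.
by rewrite /tail_len; have := h (psum m j); have := h (psum m j.+1); lra.
Qed.

Let tail_len_le j : (j < n)%N -> tail_len m j <= m j.
Proof.
move=> jn; rewrite -subr_ge0 len_sub_tail subr_ge0 le_min ge_min psum_mono//=.
by rewrite ge_min lexx orbT.
Qed.

(** The head lives on a set of measure 1, so it costs at most its supremum; only the tail grows with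
    the number of terms. *)
Lemma ZE_sorted_upper (A d : R) : 0 <= A -> (forall k, (k < n)%N -> `|a k| <= A) ->
  (forall k, (k < n)%N -> m k <= 2 * d) ->
  nZ f <= A + Num.sqrt (2 * d * \sum_(j < n) a j ^+ 2).
Proof.
move=> A0 hA hm; rewrite ZE_sorted_norm; apply: lerD.
  have mgI : measurable_fun I01 g by exact: mg.
  apply: (ri_bounded hE mgI _).2 => t It.
  by rewrite ger0_norm//; exact: g_le (I01_ge0 It).
have h : \sum_(j < n) a j ^+ 2 * tail_len m j <= 2 * d * \sum_(j < n) a j ^+ 2.
  rewrite big_distrr /=; apply: ler_sum => j _; rewrite mulrC ler_wpM2r ?sqr_ge0//.
  by apply: le_trans (hm _ (ltn_ord j)); exact: tail_len_le.
rewrite ler_sqrt//; apply: le_trans h.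
by apply: sumr_ge0 => j _; rewrite mulr_ge0 ?sqr_ge0// tail_len_ge0.
Qed.

Lemma ZE_sorted_head (d : R) : 0 < d <= 1 -> (0 < n)%N -> d <= m 0%N ->
  `|a 0%N| * fundamental E d <= nE g.
Proof.
move=> /andP[d0 d1] n0 dm.
have mi : measurable (`[0, d[%classic : set R) by exact: measurable_itv.
have hi := ri_indic hE mi.
have h1 : fundamental E d <= nE \1_(`[0, d[%classic : set R).
  apply: (ri_fundamental_indic hE) => //; first by rewrite (ltW d0).
  have -> : I01 `&` `[0, d[%classic = `[0, d[%classic.
    apply/seteqP; split=> t /=; rewrite !in_itv /=; first by case.
    by move=> /andP[-> td]; rewrite td (le_trans (ltW td)).
  by rewrite lebesgue_measure_itv /= lte_fin d0 sube0.
apply: (@le_trans _ _ (nE (`|a 0%N| *: \1_(`[0, d[%classic : set R)))).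
  by rewrite (ri_normZ hE)// normr_id ler_wpM2l.
apply: (ri_le hE _ hg _).2.
  by apply: (ri_measurable hE); exact: (ri_carrierZ hE).
move=> t It; rewrite (ger0_norm (g_ge0 t)) fctE.
have [dt|dt] := pselect ((`[0, d[%classic : set R) t); last first.
  by rewrite indic_notin// [X in `|X|]mulr0 normr0.
rewrite indic_in// [X in `|X|]mulr1 normr_id /g.
have p0 : psum m 0 = 0 by rewrite /psum big_ord0.
have p1 : psum m 1 = m 0%N by rewrite /psum big_ord1.
move: dt; rewrite /= in_itv /= => /andP[t0 td].
rewrite (sum_steps (df_ge0 hF) (fun j => `|a j|) n0) ?p0//.
by rewrite p1 (lt_le_trans td).
Qed.

(** The steps inside [[0, 1]] have total length at most 1 and heights at most [|a 0|], so the tail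
    misses at most [|a 0| ^+ 2] of the sum of [a j ^+ 2 * m j]. The head controls [|a 0|] through
    the fundamental function. *)
Lemma ZE_sorted_lower (d : R) : 0 < d <= 1 -> 0 < fundamental E d ->
  (forall k, (k < n)%N -> d <= m k) ->
  Num.sqrt (d * \sum_(j < n) a j ^+ 2) <= (1 + (fundamental E d)^-1) * nZ f.
Proof.
move=> /andP[d0 d1] f0 hm; rewrite ZE_sorted_norm.
set T := \sum_(j < n) a j ^+ 2 * tail_len m j.
have T0 : 0 <= T.
  by apply: sumr_ge0 => j _; rewrite mulr_ge0 ?sqr_ge0// tail_len_ge0.
have fi0 : 0 <= (fundamental E d)^-1 by rewrite invr_ge0 ltW.
have sT0 : 0 <= Num.sqrt T := sqrtr_ge0 T.
have [n0|n0] := posnP n.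
  rewrite [X in d * X]big1 ?mulr0 ?sqrtr0 => [|[j jn]]; last first.
    by exfalso; move: jn; rewrite n0.
  by rewrite mulr_ge0// addr_ge0.
have hd : `|a 0%N| <= (fundamental E d)^-1 * nE g.
  by rewrite ler_pdivlMl// mulrC; apply: ZE_sorted_head => //; [rewrite d0|exact: hm].
have key : d * \sum_(j < n) a j ^+ 2 <= T + `|a 0%N| ^+ 2.
  apply: (@le_trans _ _ (\sum_(j < n) a j ^+ 2 * m j)).
    rewrite big_distrr /=; apply: ler_sum => j _.
    by rewrite mulrC ler_wpM2l ?sqr_ge0// hm.
  have -> : \sum_(j < n) a j ^+ 2 * m j =
      T + \sum_(j < n) a j ^+ 2 * (m j - tail_len m j).
    by rewrite -big_split /=; apply: eq_bigr => j _; ring.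
  rewrite lerD2l; apply: (@le_trans _ _ (\sum_(j < n) `|a 0%N| ^+ 2 * (m j - tail_len m j))).
    apply: ler_sum => j _; rewrite ler_wpM2r ?subr_ge0 ?tail_len_le//.
    rewrite -[leLHS]real_normK ?num_real//; apply: lerXn2r; rewrite ?nnegrE//.
    by apply: a_sorted; rewrite ltn_ord.
  rewrite -big_distrr /= -[leRHS]mulr1 ler_wpM2l ?sqr_ge0//.
  under eq_bigr do rewrite len_sub_tail.
  rewrite -(big_mkord xpredT (fun j => Num.min (psum m j.+1) 1 - Num.min (psum m j) 1)).
  have p0 : Num.min (psum m 0) 1 = 0 by rewrite /psum big_ord0 min_l.
  rewrite telescope_sumr// p0 subr0.
  by rewrite ge_min lexx orbT.
apply: (@le_trans _ _ (Num.sqrt T + `|a 0%N|)).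
  rewrite -[leRHS]ger0_norm ?addr_ge0// -sqrtr_sqr ler_sqrt ?sqr_ge0//.
  apply: le_trans key _; rewrite sqrrD sqr_sqrtr// -addrA lerD2l lerDr.
  by rewrite mulrn_wge0// mulr_ge0.
have : 0 <= (fundamental E d)^-1 * Num.sqrt T by rewrite mulr_ge0.
have := head_ge0; lra.
Qed.

End Sorted.

Lemma disj_family_comp n U m (k : nat -> nat) : disj_family n U m ->
  (forall i, (i < n)%N -> (k i < n)%N) ->
  (forall i j, (i < n)%N -> (j < n)%N -> k i = k j -> i = j) ->
  disj_family n (U \o k) (m \o k).
Proof.
move=> hF kn kinj; split.
- by move=> i iN; apply: (df_meas hF); exact: kn.
- by move=> i iN; apply: (df_half hF); exact: kn.
- move=> i j t iN jN ij; apply: (df_disj hF); [exact: kn|exact: kn|].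
  by apply: contra ij => /eqP /kinj -> .
- by move=> i iN; apply: (df_mu hF); exact: kn.
- by move=> i iN; apply: (df_ge0 hF); exact: kn.
Qed.

Lemma sorting_permutation (n : nat) (a : nat -> R) : exists k : nat -> nat,
  [/\ forall i, (i < n)%N -> (k i < n)%N,
      forall i j, (i < n)%N -> (j < n)%N -> k i = k j -> i = j,
      forall i j, (i <= j < n)%N -> `|a (k j)| <= `|a (k i)| &
      forall (V : nmodType) (F : nat -> V), \sum_(i < n) F i = \sum_(i < n) F (k i)].
Proof.
pose r i j := `|a j| <= `|a i|.
pose s := sort r (iota 0 n).
have sz : size s = n by rewrite size_sort size_iota.
have us : uniq s by rewrite sort_uniq iota_uniq.
have rtot : total r by move=> i j; exact: le_total.
have rtr : transitive r by move=> i j l h1 h2; exact: le_trans h2 h1.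
have rrefl : reflexive r by move=> i; exact: lexx.
have ss : sorted r s := sort_sorted rtot (iota 0 n).
exists (nth 0%N s); split.
- move=> i iN; have : nth 0%N s i \in s by rewrite mem_nth ?sz.
  by rewrite mem_sort mem_iota /= add0n.
- move=> i j iN jN /eqP; rewrite nth_uniq ?sz// => /eqP //.
- move=> i j /andP[ij jn]; apply: (sorted_leq_nth rtr rrefl 0%N ss) => //.
    by rewrite inE sz (leq_ltn_trans ij).
  by rewrite inE sz.
- move=> V F; rewrite -(big_mkord xpredT F) -(big_mkord xpredT (fun i => F (nth 0%N s i))).
  have hp : perm_eq (index_iota 0 n) s by rewrite /index_iota subn0 perm_sym perm_sort.
  by rewrite (perm_big _ hp) /= (big_nth 0%N) sz.
Qed.

(** Sorting the coefficients reduces this to an explicit rearrangement. The upper bound keeps a free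
    [A]: the l^2-norm of [a] for the l^2-estimate, and 1 for plain sums, which yields $1 +
    \sqrt{2dn}$. *)
Lemma ZE_disj_bounds (n : nat) (U : nat -> set R) (m : nat -> R) (d : R) (a : nat -> R) :
  disj_family n U m -> 0 < d <= 1 -> 0 < fundamental E d ->
  (forall k, (k < n)%N -> d <= m k <= 2 * d) ->
  let f := \sum_(k < n) a k *: \1_(U k) in
  [/\ carrier (ZE E) f,
      forall A, 0 <= A -> (forall k, (k < n)%N -> `|a k| <= A) ->
        nZ f <= A + Num.sqrt (2 * d * \sum_(j < n) a j ^+ 2),
      forall k, (k < n)%N -> `|a k| * fundamental E d <= nZ f &
      Num.sqrt (d * \sum_(j < n) a j ^+ 2) <= (1 + (fundamental E d)^-1) * nZ f].
Proof.
move=> hF d01 f0 hm f.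
have [k [kn kinj ksort ksum]] := sorting_permutation n a.
have hFk := disj_family_comp hF kn kinj.
have -> : f = disj_sum n (U \o k) (a \o k) by exact: (ksum _ (fun i => a i *: \1_(U i))).
rewrite (ksum _ (fun j => a j ^+ 2)).
have d_le i : (i < n)%N -> d <= (m \o k) i by move=> /kn/hm/andP[].
have le_d i : (i < n)%N -> (m \o k) i <= 2 * d by move=> /kn/hm/andP[].
split.
- exact: ZE_sorted_carrier hFk ksort.
- move=> A A0 hA; apply: (ZE_sorted_upper hFk ksort A0 _ le_d) => i iN.
  by apply: hA; exact: kn.
- move=> j jn; have n0 : (0 < n)%N by exact: leq_ltn_trans jn.
  have aj : `|a j| <= `|a (k 0%N)|.
    have [i iN ->] : exists2 i, (i < n)%N & j = k i.
      apply: contrapT => hn.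
      (* Surjectivity of [k] is read off from the invariance of the sum of the indicator of [j]. *)
      have := ksum _ (fun i => (i == j)%N : nat).
      rewrite (bigD1 (Ordinal jn))//= eqxx [RHS]big1 // => i _.
      by case: eqP => // e; exfalso; apply: hn; exists i.
    exact: ksort.
  apply: (@le_trans _ _ (`|a (k 0%N)| * fundamental E d)).
    by rewrite ler_wpM2r// ltW.
  have h := ZE_sorted_head (a \o k) hFk d01 n0 (d_le _ n0).
  apply: le_trans h _.
  by rewrite (ZE_sorted_norm hFk ksort) lerDl sqrtr_ge0.
- exact: ZE_sorted_lower hFk ksort _ d01 f0 d_le.
Qed.

End DisjointFamilies.

(** * Blocks of the Rosenthal sets *)

Section LinearSpans.
Context {R : realType}.

Lemma lin_span_linear (x : nat -> R -> R) : linear_set (lin_span x).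
Proof.
split; first by exists 0%N, (fun=> 0); rewrite big_ord0.
move=> c _ _ [n [a ->]] [p [b ->]].
exists (n + p)%N, (fun i => c * (if (i < n)%N then a i else 0) + (if (i < p)%N then b i else 0)).
have widen (q N : nat) (d : nat -> R) : (q <= N)%N ->
    \sum_(i < q) d i *: x i = \sum_(i < N) (if (i < q)%N then d i else 0) *: x i.
  move=> qN; rewrite (big_ord_widen N (fun i => d i *: x i) qN) big_mkcond /=.
  by apply: eq_bigr => i _; case: ifP; rewrite ?scale0r.
rewrite (widen n (n + p)%N) ?leq_addr// (widen p (n + p)%N) ?leq_addl//.
rewrite scaler_sumr -big_split /=; apply: eq_bigr => i _.
by rewrite scalerDl scalerA.
Qed.

Lemma lin_span_gen (x : nat -> R -> R) (i : nat) : lin_span x (x i).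
Proof.
exists i.+1, (fun j => (j == i)%:R).
rewrite big_ord_recr /= eqxx scale1r big1 ?add0r// => j _.
by rewrite ltn_eqF ?scale0r.
Qed.

Lemma linear_set_sum (S : set (R -> R)) (n : nat) (a : nat -> R) (x : nat -> R -> R) :
  linear_set S -> (forall i, S (x i)) -> S (\sum_(i < n) a i *: x i).
Proof.
move=> [S0 SD] Sx; elim: n => [|n IH]; first by rewrite big_ord0.
by rewrite big_ord_recr /= addrC; apply: SD.
Qed.

End LinearSpans.

Section Blocks.
Context {R : realType}.
Local Notation mu := (@lebesgue_measure R).
Variables (A : nat -> set R) (hA : rosenthal_sets A).

Let a i := fine (mu (A i)).

Let mu_a i : mu (A i) = (a i)%:E.
Proof.
rewrite /a fineK// ge0_fin_numE//; apply: le_lt_trans (rs_le1 hA i) _; exact: ltry.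
Qed.

Let a_ge0 i : 0 <= a i.
Proof. by rewrite -lee_fin -mu_a. Qed.

Let a_small (d : R) : 0 < d -> exists N, forall i, (N <= i)%N -> a i <= d.
Proof.
move=> d0; have := rs_cvg0 hA.
move=> /fine_cvgP[_ /cvgr0Pnorm_lt/(_ _ d0)[N _ hN]].
by exists N => i /hN /= h; apply: le_trans (ltW h); exact: ler_norm.
Qed.

Let a_div (N : nat) (d : R) : exists P, (N < P)%N /\ d <= \sum_(N <= i < P) a i.
Proof.
apply: contrapT => hn.
have hb n : (\sum_(0 <= i < n) mu (A i) <= (\sum_(0 <= i < N) a i + Num.max 0 d)%:E)%E.
  under eq_bigr do rewrite mu_a.
  rewrite sumEFin lee_fin; have [nN|Nn] := leqP n N.
    rewrite [in leRHS](big_cat_nat (leq0n n) nN) /= -addrA lerDl addr_ge0//.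
      by apply: sumr_ge0.
    by rewrite le_max lexx.
  rewrite (big_cat_nat (leq0n N) (ltnW Nn)) /= lerD2l le_max; apply/orP; right.
  by rewrite leNgt; apply/negP => h; apply: hn; exists n; split=> //; exact: ltW.
have := rs_sum hA.
have hc : cvgn (fun n => \sum_(0 <= i < n) mu (A i))%E by exact: is_cvg_nneseries.
have : (limn (fun n => \sum_(0 <= i < n) mu (A i)) <= (\sum_(0 <= i < N) a i + Num.max 0 d)%:E)%E.
  by apply: lime_le => //; exists 0%N => // n _; exact: hb.
by move=> h e; move: h; rewrite e leye_eq.
Qed.

(** The terms are eventually at most [d] and their sum diverges, so a run stopped as soon as it
    reaches [d] is at most [2 * d]. The condition on [N] stands after [P] so that a total choice
    function exists. *)
Let greedy (d : R) : 0 < d -> exists N0, forall N, exists P, (N0 <= N)%N ->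
  (N < P)%N /\ d <= \sum_(N <= i < P) a i <= 2 * d.
Proof.
move=> d0; have [N0 hN0] := a_small d0; exists N0 => N.
have [NN|NN] := leqP N0 N; last by exists 0%N.
have ex : exists P, (N < P)%N && (d <= \sum_(N <= i < P) a i).
  by have [P [h1 h2]] := a_div N d; exists P; rewrite h1.
have [P /andP[h1 h2] hmin] := ex_minnP ex.
exists P => _; split=> //; rewrite h2 /=.
case: P h1 h2 hmin => // P; rewrite ltnS => NP h2 hmin.
rewrite big_nat_recr//=; have aP : a P <= d by apply: hN0; exact: leq_trans NP.
have [PN|NP'] := leqP P N; first by rewrite big_geq//; lra.
have : \sum_(N <= i < P) a i < d.
  by rewrite ltNge; apply/negP => h; have := hmin P; rewrite NP' h ltnn => /(_ isT).
lra.
Qed.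

(** Each [U k] is a finite union of consecutive sets [A i], so its indicator lies in the span
    itself, not only in the closure. *)
Lemma rosenthal_blocks (d : R) : 0 < d ->
  exists (U : nat -> set R) (m : nat -> R), [/\ forall n, disj_family n U m,
    forall k, d <= m k <= 2 * d & forall k, lin_span (fun n => \1_(A n)) \1_(U k)].
Proof.
move=> d0; have [N0 /choice[nx hnx]] := greedy d0.
pose b := fix b k := if k is j.+1 then nx (b j) else N0.
have bN k : (N0 <= b k)%N.
  elim: k => [|k IH]; first exact: leqnn.
  by have [h _] := hnx (b k) IH; exact: leq_trans (ltnW h).
have bS k : (b k < b k.+1)%N by have [] := hnx (b k) (bN k).
have bm k : d <= \sum_(b k <= i < b k.+1) a i <= 2 * d by have [] := hnx (b k) (bN k).
have ble i j : (i <= j)%N -> (b i <= b j)%N.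
  by apply: (@homo_leq _ _ leq); [exact: leqnn|exact: leq_trans|move=> k; exact: ltnW].
have Adisj i j t : i != j -> A i t -> ~ A j t.
  move=> ij Ai Aj; move: ij; rewrite (rs_disjoint hA (i := i) (j := j) I I) ?eqxx//.
  by exists t.
pose F k i := A (b k + i)%N.
pose len k := (b k.+1 - b k)%N.
pose U k := \bigcup_(i < len k) F k i.
pose m k := \sum_(i < len k) a (b k + i)%N.
have Fdisj k i j t : i != j -> F k i t -> ~ F k j t.
  by move=> ij; apply: Adisj; rewrite eqn_add2l.
have mUm k : measurable (U k) /\ mu (U k) = (m k)%:E.
  apply: (@leb_bigcup_disj _ (len k) (F k) (fun i => a (b k + i)%N)).
  - by move=> i _; exact: (rs_measurable hA).
  - by move=> i j t _ _; exact: Fdisj.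
  - by move=> i _; exact: mu_a.
exists U, m; split.
- move=> n; split.
  + by move=> k _; have [] := mUm k.
  + by move=> k _ t [i _ Fi]; exact: (rs_sub hA Fi).
  + move=> k l t _ _ kl [i /= ik Fi] [j /= jl Fj].
    have idx p q : (q < len p)%N -> (b p <= b p + q < b p.+1)%N.
      by rewrite /len => qp; rewrite leq_addr /= -ltn_subRL.
    have /andP[i1 i2] := idx _ _ ik; have /andP[j1 j2] := idx _ _ jl.
    have e : (b k + i)%N = (b l + j)%N.
      by apply/eqP; apply: contrapT => /negP ne; exact: Adisj ne Fi Fj.
    move: kl; rewrite neq_ltn => /orP[kl|lk].
      by have := ble _ _ kl; rewrite leqNgt => /negP; apply; apply: leq_ltn_trans i2; rewrite e.
    by have := ble _ _ lk; rewrite leqNgt => /negP; apply; apply: leq_ltn_trans j2; rewrite -e.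
  + by move=> k _; have [] := mUm k.
  + by move=> k _; apply: sumr_ge0.
- move=> k; suff <- : \sum_(b k <= i < b k.+1) a i = m k by [].
  rewrite /m -{1}[b k]add0n big_addn big_mkord; apply: eq_bigr => i _.
  by rewrite addnC.
- move=> k.
  have -> : (\1_(U k) : R -> R) = \sum_(i < len k) (fun=> 1) i *: (\1_(F k i) : R -> R).
    apply/funext => t; have [[i /= il Fi]|hn] := pselect (U k t).
      rewrite indic_in; last by exists i.
      rewrite -[RHS]/(disj_sum (len k) (F k) (fun=> 1) t).
      rewrite (@disj_sum_in _ (len k) (F k) (fun=> 1) _ i)//.
      by move=> p q s _ _; exact: Fdisj.
    rewrite indic_notin//; symmetry; apply: (@disj_sum_notin _ (len k) (F k) (fun=> 1)).
    by move=> i il Fi; apply: hn; exists i.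
  exact: (@linear_set_sum _ (lin_span (fun n => \1_(A n))) (len k) (fun=> 1)
    (fun i => \1_(F k i)) (lin_span_linear _)
    (fun i => lin_span_gen (fun n => \1_(A n)) (b k + i))).
Qed.

End Blocks.

(** * The two cases *)

Section Perturbation.
Context {R : realType}.
Variables (E : fun_space R) (hE : ri_space01 E).
Local Notation nE := (fnorm E).

Definition increasing_below (n : nat) (K : nat -> nat) :=
  forall i j, (i < j < n)%N -> (K i < K j)%N.

Lemma increasing_below_ge n K j : increasing_below n K -> (j < n)%N -> (j <= K j)%N.
Proof.
move=> hK; elim: j => // j IH jn.
by apply: leq_ltn_trans (IH (ltnW jn)) _; apply: hK; rewrite ltnSn.
Qed.

Lemma ri_comb (n : nat) (a : nat -> R) (x : nat -> R -> R) :
  (forall j, carrier E (x j)) -> carrier E (\sum_(j < n) a j *: x j).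
Proof.
by move=> hx; apply: (ri_carrier_sum hE) => j _; exact: (ri_carrierZ hE).
Qed.

Lemma geometric_le1 (n : nat) : \sum_(j < n) 1 / 2 ^+ j.+1 <= 1 :> R.
Proof.
suff -> : \sum_(j < n) 1 / 2 ^+ j.+1 = 1 - 1 / 2 ^+ n :> R.
  by rewrite gerBl divr_ge0// exprn_ge0.
elim: n => [|n IH]; first by rewrite big_ord0 expr0 divr1 subrr.
by rewrite big_ord_recr /= IH exprS; field; rewrite gt_eqF// exprn_gt0.
Qed.

(** Geometrically decaying errors need only a uniform bound on the coefficients. With the l^2-norm
    as [B], l^2-estimates pass from [x] to [y]. *)
Lemma ri_perturb (n : nat) (a : nat -> R) (x y : nat -> R -> R) (B eta : R) :
  (forall j, carrier E (x j)) -> (forall j, carrier E (y j)) ->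
  0 <= eta -> 0 <= B -> (forall j, (j < n)%N -> `|a j| <= B) ->
  (forall j, (j < n)%N -> nE (x j - y j) <= eta / 2 ^+ j.+1) ->
  nE (\sum_(j < n) a j *: x j - \sum_(j < n) a j *: y j) <= B * eta.
Proof.
move=> hx hy eta0 B0 aB hxy.
have -> : \sum_(j < n) a j *: x j - \sum_(j < n) a j *: y j =
    \sum_(j < n) a j *: (x j - y j).
  by rewrite -sumrB; apply: eq_bigr => j _; rewrite scalerBr.
have hd j : carrier E (x j - y j) by exact: (ri_carrierB hE).
apply: le_trans (ri_norm_sum hE _ _) _; first by move=> j _; exact: (ri_carrierZ hE).
apply: (@le_trans _ _ (\sum_(j < n) B * eta * (1 / 2 ^+ j.+1))).
  apply: ler_sum => j _; rewrite (ri_normZ hE)// -mulrA.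
  by apply: ler_pM => //; [exact: (ri_norm_ge0 hE)|exact: aB|rewrite mulrA mulr1; exact: hxy].
by rewrite -big_distrr /= -[leRHS]mulr1 ler_wpM2l ?mulr_ge0// geometric_le1.
Qed.

Lemma coef_le_l2 (n : nat) (a : nat -> R) j : (j < n)%N ->
  `|a j| <= Num.sqrt (\sum_(i < n) a i ^+ 2).
Proof.
move=> jn; rewrite -sqrtr_sqr ler_sqrt; last by apply: sumr_ge0 => i _; exact: sqr_ge0.
by rewrite (bigD1 (Ordinal jn))//= lerDl; apply: sumr_ge0 => i _; exact: sqr_ge0.
Qed.

Lemma l2_scale (n : nat) (b r : nat -> R) (B : R) : 0 <= B ->
  (forall j, (j < n)%N -> `|r j| <= B) ->
  Num.sqrt (\sum_(j < n) (b j * r j) ^+ 2) <= B * Num.sqrt (\sum_(j < n) b j ^+ 2).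
Proof.
move=> B0 hr; have s0 : 0 <= \sum_(j < n) b j ^+ 2 by apply: sumr_ge0 => i _; exact: sqr_ge0.
rewrite -{1}(ger0_norm B0) -sqrtr_sqr -sqrtrM ?sqr_ge0// ler_sqrt; last first.
  by rewrite mulr_ge0// sqr_ge0.
rewrite big_distrr /=; apply: ler_sum => j _; rewrite exprMn mulrC ler_wpM2r ?sqr_ge0//.
by rewrite -[leLHS]real_normK ?num_real//; apply: lerXn2r; rewrite ?nnegrE// hr.
Qed.

(* By the disjoint [Q_2]-property, sums of [n] normalized terms [h] have norm at
   least [sqrt n / Q], with a [Q] that does not depend on [lo] and [hi]; on the
   other hand these norms grow at most like [g1 * sqrt n]. *)
Lemma disjoint_l2_constant (Q lo hi beta g0 g1 eta : R) (x h : nat -> R -> R) :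
  0 < Q -> 0 < lo -> 0 < hi -> 0 < beta ->
  (forall h : nat -> R -> R,
    (forall n, carrier E (h n) /\ nE (h n) = 1) ->
    disjoint_seq E h -> l2_equivalent E h ->
    exists2 k : nat -> nat, {homo k : m n / (m < n)%N} &
      l2_equivalent_with E Q (h \o k)) ->
  (forall k, carrier E (x k)) -> (forall k, carrier E (h k)) ->
  disjoint_seq E h -> 0 <= eta -> eta <= lo / 2 -> eta <= beta ->
  (forall j, nE (x j - h j) <= eta / 2 ^+ j.+1) ->
  (forall j, beta <= nE (x j)) ->
  (forall n (a : nat -> R), lo * Num.sqrt (\sum_(j < n) a j ^+ 2) <= nE (\sum_(j < n) a j *: x j)
     <= hi * Num.sqrt (\sum_(j < n) a j ^+ 2)) ->
  (forall n K, increasing_below n K ->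
     nE (\sum_(j < n) 1 *: x (K j)) <= g0 + g1 * Num.sqrt n%:R) ->
  Q^-1 * (beta / 2) <= g1.
Proof.
move=> Q0 lo0 hi0 beta0 hQ hx hh dh eta0 eta_lo eta_beta xh xbeta x2 xsum.
have p2 j : 0 < 2 ^+ j :> R by rewrite exprn_gt0.
have hlow j : beta / 2 <= nE (h j).
  have h1 : nE (x j) <= nE (x j - h j) + nE (h j).
    by rewrite -{1}(subrK (h j) (x j)); apply: (ri_normD hE) => //; exact: (ri_carrierB hE).
  have h2 : eta / 2 ^+ j.+1 <= eta / 2.
    rewrite ler_wpM2l// lef_pV2 ?posrE// exprS ler_peMr// exprn_ege1// ler1n//.
  have := xh j; have := xbeta j; lra.
have hhi j : nE (h j) <= hi + eta.
  have := ri_normB hE (hx j) (ri_carrierB hE (hx j) (hh j)); rewrite subKr => h1.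
  have h2 : eta / 2 ^+ j.+1 <= eta by rewrite ler_pdivrMr// ler_peMr// exprn_ege1// ler1n.
  have h3 : nE (x j) <= hi.
    have /andP[_] := x2 j.+1 (fun i => (i == j)%:R).
    rewrite !big_ord_recr /= eqxx scale1r big1 ?add0r => [|i _]; last first.
      by rewrite ltn_eqF// scale0r.
    rewrite big1 ?add0r ?expr1n ?sqrtr1 ?mulr1// => i _.
    by rewrite ltn_eqF// expr0n.
  have := xh j; lra.
pose H j := nE (h j).
have H0 j : 0 < H j by apply: lt_le_trans (hlow j); rewrite divr_gt0.
pose h' j : R -> R := (H j)^-1 *: h j.
have hh' j : carrier E (h' j) by exact: (ri_carrierZ hE).
have hcomb n (b : nat -> R) : lo / 2 * Num.sqrt (\sum_(j < n) b j ^+ 2) <= nE (\sum_(j < n) b j *: h j)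
    <= (hi + eta) * Num.sqrt (\sum_(j < n) b j ^+ 2).
  set s := Num.sqrt _; have s0 : 0 <= s by exact: sqrtr_ge0.
  have hp := ri_perturb hx hh eta0 s0 (fun j => @coef_le_l2 n b j) (fun j _ => xh j).
  have cx := ri_comb n b hx; have ch := ri_comb n b hh.
  have h1 := ri_normD hE (ri_carrierB hE cx ch) ch; rewrite subrK in h1.
  have h2 := ri_normB hE cx (ri_carrierB hE cx ch); rewrite subKr in h2.
  have /andP[] := x2 n b; rewrite -/s.
  have : s * eta <= s * (lo / 2) by rewrite ler_wpM2l.
  move=> h3 h4 h5; apply/andP; split; lra.
have n1 j : carrier E (h' j) /\ nE (h' j) = 1.
  split=> //; rewrite (ri_normZ hE)// gtr0_norm ?invr_gt0//.
  by rewrite mulVf// gt_eqF.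
have d' : disjoint_seq E h'.
  move=> i j ij; have := dh i j ij; apply: leb_ae_mono => t ht Dt; have /= h1 := ht Dt.
  rewrite /h' !fctE !normrM (@gtr0_norm _ (H i)^-1) ?invr_gt0//.
  rewrite (@gtr0_norm _ (H j)^-1) ?invr_gt0//.
  have hz : h i t = 0 \/ h j t = 0.
    by move: h1; case: leP => _ /eqP; rewrite normr_eq0 => /eqP; [left|right].
  have [-> | ->] := hz; rewrite normr0 mulr0.
    by apply/min_idPl; rewrite mulr_ge0// invr_ge0 ltW.
  by apply/min_idPr; rewrite mulr_ge0// invr_ge0 ltW.
have hiE : 0 < hi + eta by rewrite ltr_wpDr.
(* Normalization divides the coefficients by [H j], which lies between [beta / 2] and [hi + eta]. *)
pose l := lo / 2 / (hi + eta); pose u := (hi + eta) * (beta / 2)^-1.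
have l0 : 0 < l by rewrite !divr_gt0.
have u0 : 0 < u by rewrite mulr_gt0// invr_gt0 divr_gt0.
have C0 : 0 < l^-1 + u by rewrite addr_gt0// invr_gt0.
have Cl : (l^-1 + u)^-1 <= l.
  by rewrite -[leRHS]invrK lef_pV2 ?posrE ?invr_gt0// lerDl ltW.
have eq' : l2_equivalent E h'.
  exists (l^-1 + u) => // n b.
  set s := Num.sqrt _; have s0 : 0 <= s by exact: sqrtr_ge0.
  pose c j := b j * (H j)^-1.
  have -> : \sum_(j < n) b j *: h' j = \sum_(j < n) c j *: h j.
    by apply: eq_bigr => j _; rewrite scalerA.
  have /andP[c1 c2] := hcomb n c.
  have cs : Num.sqrt (\sum_(j < n) c j ^+ 2) <= (beta / 2)^-1 * s.
    apply: (@l2_scale n b (fun j => (H j)^-1)) => [|j _]; first by rewrite invr_ge0 divr_ge0// ltW.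
    by rewrite gtr0_norm ?invr_gt0// lef_pV2 ?posrE ?divr_gt0// hlow.
  have sc : s <= (hi + eta) * Num.sqrt (\sum_(j < n) c j ^+ 2).
    have -> : s = Num.sqrt (\sum_(j < n) (c j * H j) ^+ 2).
      congr (Num.sqrt _); apply: eq_bigr => j _; congr (_ ^+ 2).
      by rewrite /c divfK// gt_eqF.
    apply: (@l2_scale n c H) => [|j _]; first exact: ltW.
    by rewrite gtr0_norm// hhi.
  apply/andP; split.
    apply: (@le_trans _ _ (l * s)); first by rewrite ler_wpM2r.
    apply: le_trans c1; rewrite /l -!mulrA ler_wpM2l ?(ltW lo0)// ler_wpM2l//.
    by rewrite ler_pdivrMl.
  apply: le_trans c2 _; apply: (@le_trans _ _ (u * s)).
    by rewrite /u -mulrA ler_wpM2l// ltW.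
  by rewrite ler_wpM2r// lerDr invr_ge0 ltW.
have [k kincr hk] := hQ h' n1 d' eq'.
have kn n : increasing_below n k by move=> i j /andP[ij _]; exact: kincr.
pose al := Q^-1 * (beta / 2).
(* The coefficients [H (k j)] undo the normalization, so the lower bound given by [Q] applies to the
   plain sum of the [h (k j)]. *)
have key n : al * Num.sqrt n%:R <= g0 + eta + g1 * Num.sqrt n%:R.
  have /andP[k1 _] := hk n (fun j => H (k j)).
  have e1 : \sum_(j < n) H (k j) *: (h' \o k) j = \sum_(j < n) (fun=> 1) j *: (h \o k) j.
    apply: eq_bigr => j _; rewrite /h' /= scalerA scale1r divff ?scale1r//.
    by rewrite gt_eqF.
  rewrite e1 in k1.
  have hxk j : carrier E ((x \o k) j) by exact: hx.
  have hhk j : carrier E ((h \o k) j) by exact: hh.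
  have one j : (j < n)%N -> `|(fun=> 1) j : R| <= 1 by rewrite normr1.
  have xhk j : (j < n)%N -> nE ((x \o k) j - (h \o k) j) <= eta / 2 ^+ j.+1.
    move=> jn; apply: le_trans (xh (k j)) _; rewrite ler_wpM2l// lef_pV2 ?posrE//.
    by rewrite ler_weXn2l ?ler1n// ltnS; exact: increasing_below_ge (kn n) jn.
  have hp := ri_perturb hxk hhk eta0 ler01 one xhk.
  have cx := ri_comb n (fun=> 1) hxk; have ch := ri_comb n (fun=> 1) hhk.
  have h2 := ri_normB hE cx (ri_carrierB hE cx ch); rewrite subKr in h2.
  have h3 := xsum n k (kn n).
  have h4 : al * Num.sqrt n%:R <= Q^-1 * Num.sqrt (\sum_(j < n) H (k j) ^+ 2).
    rewrite /al -mulrA ler_wpM2l ?invr_ge0 ?(ltW Q0)//.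
    have b20 : 0 <= beta / 2 by rewrite divr_ge0// ltW.
    rewrite -{1}(ger0_norm b20) -sqrtr_sqr -sqrtrM ?sqr_ge0// ler_sqrt; last first.
      by apply: sumr_ge0 => j _; exact: sqr_ge0.
    rewrite mulr_natr -[X in _ *+ X]card_ord -sumr_const; apply: ler_sum => j _.
    by apply: lerXn2r; rewrite ?nnegrE ?hlow// ltW.
  rewrite /= in h2 hp; lra.
rewrite leNgt; apply/negP => g1al; rewrite -/al in g1al.
have dpos : 0 < al - g1 by rewrite subr_gt0.
pose p := (Num.truncn (`|g0 + eta| / (al - g1))).+1.
have hp : g0 + eta < p%:R * (al - g1).
  rewrite -ltr_pdivrMr//; apply: le_lt_trans (truncnS_gt _).
  by rewrite ler_pM2r ?invr_gt0// ler_norm.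
have := key (p ^ 2)%N.
rewrite natrX sqrtr_sqr ger0_norm//; lra.
Qed.

End Perturbation.

(** * The embedding of Rosenthal's space *)

Section Embedding.
Context {R : realType}.
Variables (E : fun_space R) (hE : ri_space01 E).
Local Notation I01 := (`[0, 1]%classic : set R).
Local Notation nE := (fnorm E).
Local Notation nZ := (fnorm (ZE E)).

Lemma disj_family_sub (U : nat -> set R) (m : nat -> R) n K :
  (forall n, disj_family n U m) -> increasing_below n K ->
  disj_family n (U \o K) (m \o K).
Proof.
move=> hF hK.
have Kinj i j : (i < n)%N -> (j < n)%N -> i != j -> K i != K j.
  move=> iN jN; rewrite neq_ltn => /orP[ij|ji].
    by rewrite ltn_eqF// hK// ij.
  by rewrite gtn_eqF// hK// ji.
split.
- by move=> k _; exact: (df_meas (hF (K k).+1)).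
- by move=> k _; exact: (df_half (hF (K k).+1)).
- move=> i j t iN jN ij.
  apply: (df_disj (hF (maxn (K i) (K j)).+1)); rewrite ?ltnS ?leq_maxl ?leq_maxr//.
  exact: Kinj.
- by move=> k _; exact: (df_mu (hF (K k).+1)).
- by move=> k _; exact: (df_ge0 (hF (K k).+1)).
Qed.

Section Operator.
Variables (X : set (R -> R)) (T : (R -> R) -> R -> R).
Hypothesis TE : forall x, X x -> carrier E (T x).
Hypothesis Tlin : forall (a : R) x y, X x -> X y ->
  ae_eq_on I01 (T (a *: x + y)) (a *: T x + T y).

Lemma operator_sum (u : nat -> R -> R) (a : nat -> R) (n : nat) :
  (forall p, (p <= n)%N -> X (\sum_(j < p) a j *: u j)) ->
  (forall j, X (u j)) ->
  nE (T (\sum_(j < n) a j *: u j)) = nE (\sum_(j < n) a j *: T (u j)).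
Proof.
move=> Xu Xj.
have hT := @ri_comb _ _ hE n a (fun j => T (u j)) (fun j => TE (Xj j)).
apply: (ri_norm_ae hE (TE (Xu n (leqnn n))) hT).
suff H p : (p <= n)%N ->
  ae_eq_on I01 (T (\sum_(j < p) a j *: u j)) (\sum_(j < p) a j *: T (u j)) by exact: H.
elim: p => [|p IH] pn.
  have X0 : X 0 by have := Xu 0%N (leq0n n); rewrite big_ord0.
  have := Tlin 1 X0 X0; rewrite !big_ord0 addr0 scaler0.
  apply: leb_ae_mono => t h It; have := h It; rewrite !fctE scale1r => e.
  by have -> : (0 : R -> R) t = 0 by []; move: e; move: (T 0 t) => r; lra.
have := leb_ae_and (IH (ltnW pn)) (Tlin (a p) (Xj p) (Xu p (ltnW pn))).
apply: leb_ae_mono => t [h1 h2] It; rewrite !big_ord_recr /= addrC h2//.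
by rewrite !fctE h1// addrC.
Qed.

End Operator.

Variables (A : nat -> set R) (hsep : separable_space E) (hQ : disjoint_Q2 E).
Variable (hA : rosenthal_sets A).

(** Failure of one square root bound at a single [d] is enough: this [d] stays fixed, and [lo], [hi]
    and [eps] may depend on it. *)
Lemma rosenthal_dichotomy : isomorphic_to_subspace (rosenthal_space E A) E ->
  (exists K0 : R, forall d, 0 < d <= 1 -> fundamental E d <= K0 * Num.sqrt d) \/
  (exists C : R, gauss_bounded E 12^-1 C).
Proof.
move=> [S [[SE _ _] [T [T1 T2 _ [c [C [c0 C0 T4]]]]]]].
have [Q Q0 hQ'] := hQ.
have [h|hnot] := pselect (forall d, 0 < d <= 1 -> fundamental E d <= 4 * C * Q / c * Num.sqrt d).
  by left; exists (4 * C * Q / c).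
right; have [d d01 hd] : exists2 d, 0 < d <= 1 & 4 * C * Q / c * Num.sqrt d < fundamental E d.
  move/existsNP: hnot => [d /not_implyP[d01 /negP]]; rewrite -ltNge => h.
  by exists d.
have /andP[d0 d1] := d01.
have sd0 : 0 < Num.sqrt d by rewrite sqrtr_gt0.
have f0 : 0 < fundamental E d.
  by apply: le_lt_trans hd; rewrite mulr_ge0 ?ltW// !mulr_gt0// invr_gt0.
have [U [m [hF hm span]]] := rosenthal_blocks hA d0.
pose u k : R -> R := \1_(U k).
pose X := carrier (rosenthal_space E A).
have bounds n K (a : nat -> R) : increasing_below n K ->
    let f := \sum_(j < n) a j *: u (K j) in
    [/\ carrier (ZE E) f,
      forall A, 0 <= A -> (forall k, (k < n)%N -> `|a k| <= A) ->
        nZ f <= A + Num.sqrt (2 * d * \sum_(j < n) a j ^+ 2),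
      forall k, (k < n)%N -> `|a k| * fundamental E d <= nZ f &
      Num.sqrt (d * \sum_(j < n) a j ^+ 2) <= (1 + (fundamental E d)^-1) * nZ f].
  move=> hK; apply: (ZE_disj_bounds hE a (disj_family_sub hF hK) d01 f0) => k _.
  exact: hm.
(* An element of the span approximates itself at distance [nZ 0], which the definition of the
   closure wants below every [e]. *)
have z0 : nZ 0 <= 0.
  have [_ /(_ 0 (lexx 0)) h _ _] := bounds 0%N id (fun=> 0) (fun i j h => proj1 (andP h)).
  have := h (fun k (h : (k < 0)%N) => False_ind _ (notF h)).
  by rewrite !big_ord0 mulr0 sqrtr0 addr0.
have Xsum n K (a : nat -> R) : increasing_below n K -> X (\sum_(j < n) a j *: u (K j)).
  move=> hK; have [hc _ _ _] := bounds n K a hK; split=> // e e0.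
  exists (\sum_(j < n) a j *: u (K j)); split=> //.
    exact: (@linear_set_sum _ _ n a (u \o K) (lin_span_linear _) (fun i => span (K i))).
  by rewrite subrr; exact: le_lt_trans z0 e0.
have Xu k : X (u k).
  have := Xsum 1%N (fun=> k) (fun=> 1); rewrite big_ord1 scale1r; apply.
  by move=> i [|j] /andP[].
pose x k := T (u k).
have hx k : carrier E (x k) by exact/SE/T1/Xu.
have sub n p K : increasing_below n K -> (p <= n)%N -> increasing_below p K.
  by move=> hK pn i j /andP[ij jp]; apply: hK; rewrite ij (leq_trans jp).
have Tnorm n K (a : nat -> R) : increasing_below n K ->
    c * nZ (\sum_(j < n) a j *: u (K j)) <= nE (\sum_(j < n) a j *: x (K j))
      <= C * nZ (\sum_(j < n) a j *: u (K j)).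
  move=> hK; have <- := @operator_sum X T (fun y hy => SE _ (T1 y hy)) _ (u \o K) a n.
  - exact: T4 (Xsum n K a hK).
  - by move=> b y z hy hz; have := T2 b y z hy hz; rewrite /= (ri01_dom hE).
  - by move=> p pn; apply: Xsum; exact: sub pn.
  - by move=> j; exact: Xu.
have fi0 : 0 < 1 + (fundamental E d)^-1 by rewrite addr_gt0// invr_gt0.
pose lo := c * (Num.sqrt d / (1 + (fundamental E d)^-1)).
pose hi := C * (1 + Num.sqrt (2 * d)).
have lo0 : 0 < lo by rewrite mulr_gt0// divr_gt0.
have hi0 : 0 < hi by rewrite mulr_gt0// ltr_wpDr.
have x2 n K (a : nat -> R) : increasing_below n K ->
    lo * Num.sqrt (\sum_(j < n) a j ^+ 2) <= nE (\sum_(j < n) a j *: x (K j))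
      <= hi * Num.sqrt (\sum_(j < n) a j ^+ 2).
  move=> hK; have [_ up _ low] := bounds n K a hK; have /andP[t1 t2] := Tnorm n K a hK.
  set s := Num.sqrt _; have s0 : 0 <= s by exact: sqrtr_ge0.
  have := up s s0 (fun j => @coef_le_l2 _ n a j).
  rewrite sqrtrM -/s => [up'|]; last by rewrite mulr_ge0// ltW.
  rewrite sqrtrM -/s in low; last exact: ltW.
  apply/andP; split.
    apply: le_trans t1; rewrite /lo -mulrA ler_pM2l//.
    by rewrite mulrAC ler_pdivrMr// [leRHS]mulrC.
  apply: le_trans t2 _; rewrite /hi -mulrA ler_pM2l//.
  by rewrite mulrDl mul1r.
pose beta := c * fundamental E d.
have beta0 : 0 < beta by rewrite mulr_gt0.
have xbeta k : beta <= nE (x k).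
  have hK : increasing_below 1 (fun=> k) by move=> i [|j] /andP[].
  have [_ _ low _] := bounds 1%N (fun=> k) (fun=> 1) hK.
  have /andP[t1 _] := Tnorm 1%N (fun=> k) (fun=> 1) hK.
  have := low 0%N isT; rewrite !big_ord1 !scale1r normr1 mul1r in t1 *.
  by move=> l; apply: le_trans t1; rewrite ler_pM2l.
(* Two perturbations, to step functions and then to disjoint functions, give the error [2 * eps],
   which must be at most [lo / 2] and [beta]. *)
pose eps := Num.min lo beta / 4.
have eps0 : 0 < eps by rewrite divr_gt0// lt_min lo0.
have eps_lo : eps <= lo / 4 by rewrite ler_pM2r ?invr_gt0// ge_min lexx.
have eps_beta : eps <= beta / 4 by rewrite ler_pM2r ?invr_gt0// ge_min lexx orbT.
have p2 j : 0 < 2 ^+ j :> R by rewrite exprn_gt0.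
have epsj i j : (i <= j)%N -> eps / 2 ^+ j.+1 <= eps / 2 ^+ i.+1.
  by move=> ij; rewrite ler_pM2l// lef_pV2 ?posrE// ler_weXn2l// ler1n.
have approx k : exists Dv : nat * (nat -> R), (0 < Dv.1)%N /\
    nE (x k - stepf Dv.1 Dv.2) <= eps / 2 ^+ k.+1.
  have ek : 0 < eps / 2 ^+ k.+1 by rewrite divr_gt0.
  have [D [v [D0 /ltW h]]] := ri_step_dense hE hsep (hx k) ek.
  by exists (D, v).
have /choice[Dv hDv] := approx.
pose D k := (Dv k).1; pose v k := (Dv k).2.
have D0 k : (0 < D k)%N by have [] := hDv k.
pose y k := stepf (D k) (v k).
have hy k : carrier E (y k) := ri_stepf hE (v k) (D0 k).
have xy k : nE (x k - y k) <= eps / 2 ^+ k.+1 by have [] := hDv k.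
have hup : upper_l2 E D v (hi + eps).
  move=> n K a hK; set s := Num.sqrt _; have s0 : 0 <= s by exact: sqrtr_ge0.
  have hxK j : carrier E ((x \o K) j) by exact: hx.
  have hyK j : carrier E ((y \o K) j) by exact: hy.
  have xyK j : (j < n)%N -> nE ((x \o K) j - (y \o K) j) <= eps / 2 ^+ j.+1.
    by move=> jn; apply: le_trans (xy _) _; apply: epsj; exact: increasing_below_ge hK jn.
  have hp := ri_perturb hE hxK hyK (ltW eps0) s0 (fun j => @coef_le_l2 _ n a j) xyK.
  have cx := ri_comb hE n a hxK; have cy := ri_comb hE n a hyK.
  have h1 := ri_normB hE cx (ri_carrierB hE cx cy); rewrite subKr in h1.
  have /andP[_ h2] := x2 n K a hK; rewrite -/s in h2.
  rewrite mulrDl (mulrC eps); apply: le_trans h1 _; exact: lerD.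
(* Either the L^1-norms stay away from 0 from some [B] on, and the sequence is shifted by [B], or
   beyond every index some are arbitrarily small, as the disjoint subsequence requires. *)
have [[c1 [B [c10 hB]]]|hnull] := pselect (exists (c1 : R) (B : nat),
    0 < c1 /\ forall k, (B <= k)%N -> c1 <= smean (D k) (fun i => `|v k i|)).
  exists (4 * ((hi + eps) / (c1 / 4))).
  apply: (@nonnull_gauss_bounded _ E hE (fun k => D (B + k)%N) (fun k => v (B + k)%N)) => //.
  - move=> n K a hK; apply: (hup n (fun j => (B + K j)%N) a) => i j ij.
    by rewrite ltn_add2l; exact: hK.
  - by rewrite ltW// addr_gt0.
  - by move=> k; apply: hB; rewrite leq_addr.
exfalso.
have [|K [h [Kinc hh dh yh]]] := almost_disjoint_subsequence hE hsep D0 eps0 (v := v).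
  move=> B e e0; apply: contrapT => hn; apply: hnull; exists e, B; split=> // k Bk.
  by rewrite leNgt; apply/negP => /ltW hk; apply: hn; exists k.
have Kn n : increasing_below n K by move=> i j /andP[ij _]; exact: Kinc.
have xh j : nE ((x \o K) j - h j) <= (2 * eps) / 2 ^+ j.+1.
  have -> : (x \o K) j - h j = ((x \o K) j - y (K j)) + (y (K j) - h j) by rewrite addrA subrK.
  apply: le_trans (ri_normD hE (ri_carrierB hE (hx _) (hy _)) (ri_carrierB hE (hy _) (hh _))) _.
  have := yh j; have := le_trans (xy (K j)) (epsj _ _ (increasing_below_ge (Kn j.+1) (ltnSn j))).
  rewrite /y /= -mulrA; lra.
have := @disjoint_l2_constant _ E hE Q lo hi beta C (C * Num.sqrt (2 * d)) (2 * eps)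
  (x \o K) h Q0 lo0 hi0 beta0 hQ' (fun k => hx (K k)) hh dh.
have e1 : 0 <= 2 * eps by rewrite mulr_ge0// ltW.
have e2 : 2 * eps <= lo / 2 by lra.
have e3 : 2 * eps <= beta by lra.
move=> /(_ e1 e2 e3 xh (fun j => xbeta (K j)) (fun n a => x2 n K a (Kn n))) con.
have : Q^-1 * (beta / 2) <= C * Num.sqrt (2 * d).
  apply: con => n K' hK'.
  have hKK : increasing_below n (K \o K') by move=> i j /hK'; exact: Kinc.
  have /andP[_ t2] := Tnorm n (K \o K') (fun=> 1) hKK.
  have [_ up _ _] := bounds n (K \o K') (fun=> 1) hKK.
  have one k : (k < n)%N -> `|(fun=> 1) k : R| <= 1 by rewrite normr1.
  have := up 1 ler01 one.
  have -> : \sum_(j < n) 1 ^+ 2 = n%:R :> R.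
    by rewrite (eq_bigr (fun=> 1)) => [|i _]; rewrite ?expr1n// sumr_const card_ord.
  rewrite sqrtrM => [up1|]; last by rewrite mulr_ge0// ltW.
  apply: le_trans t2 _; apply: le_trans (ler_wpM2l (ltW C0) up1) _.
  by rewrite mulrDr mulr1 mulrA.
have s2 : Num.sqrt (2 * d) <= 2 * Num.sqrt d.
  have -> : 2 * Num.sqrt d = Num.sqrt (2 ^+ 2 * d).
    by rewrite sqrtrM ?sqr_ge0// sqrtr_sqr ger0_norm.
  rewrite ler_sqrt; last by rewrite mulr_ge0 ?sqr_ge0// ltW.
  by rewrite ler_pM2r// expr2 -natrM ler_nat.
have hd' : 4 * C * Q * Num.sqrt d < beta.
  by move: hd; rewrite mulrAC ltr_pdivrMr// /beta (mulrC c).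
have : C * Num.sqrt (2 * d) <= C * (2 * Num.sqrt d) by rewrite ler_pM2l.
rewrite ler_pdivrMl// => h1 h2.
have : Q * (C * Num.sqrt (2 * d)) <= Q * (C * (2 * Num.sqrt d)) by rewrite ler_pM2l.
lra.
Qed.

End Embedding.

Theorem theorem3 (R : realType) (E : fun_space R) (A : nat -> set R) (M : R -> R)
  (hE : ri_space01 E) (hsep : separable_space E) (hQ : disjoint_Q2 E)
  (hA : rosenthal_sets A)
  (hU : isomorphic_to_subspace (rosenthal_space E A) E)
  (hM : exp_L2_function M) :
  closure_Linfty M `<=` carrier E.
Proof.
(* The two alternatives give [gauss_bounded] with the bases 1/16 and 1/12. *)
have [[K0 hK0]|[C hC]] := rosenthal_dichotomy hE hsep hQ hA hU.
  apply: (closure_Linfty_sub hE _ _ (sqrt_fundamental_gauss_bounded hE hK0) hM).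
    by rewrite exprn_gt0// invr_gt0.
  by rewrite exprn_ilt1// ?invr_ge0// invf_lt1// ltr1n.
apply: (closure_Linfty_sub hE _ _ hC hM); first by rewrite invr_gt0.
by rewrite invf_lt1// ltr1n.
Qed.
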